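(* Let $\mathcal V_{\rm matter}$ be a graded-unitary vertex algebra of CFT type equipped with a good Hamiltonian $\widehat{\mathfrak g}_{-2h^\vee}$ action. Moreover, assume its internal $\mathbb Z$ grading satisfies the BPS bound, and let $\mathcal V=(\mathcal V_{\rm matter}\otimes{\rm Sf}[\mathbb C^2\otimes\mathfrak g])^G$ be the corresponding graded-unitary vertex algebra with the diagonal internal $\mathbb Z$ grading (which satisfies the BPS bound). Then ${\rm HL}_{\mathcal V}$, with the differential $Q^+$, can be identified with the derived Poisson reduction of ${\rm HL}_{\mathcal V_{\rm matter}}$ by $G$. In other words, $${\rm Spec}\,{\rm HL}_{\mathcal V}\simeq({\rm Spec}\,{\rm HL}_{\mathcal V_{\rm matter}})/\!\!/G .$$
   Context: Conventions. Vertex algebras are over $\mathbb C$ and may have Grassmann-odd elements; $|x|$ is Grassmann parity, $Y(x,z)=\sum_{n\in\mathbb Z}x_nz^{-n-1}$, $\partial$ is translation, $[\,,]$ is the graded commutator. Repeated indices are summed. Möbius vertex algebra: a $\frac12\mathbb Z$-graded vertex algebra $\mathcal V=\bigoplus_h\mathcal V_h$, $\dim\mathcal V_h<\infty$, $\mathcal V_h=0$ for $h\ll0$, with endomorphisms $L_{\pm1},L_0$ satisfying $[L_m,L_n]=(m-n)L_{m+n}$, $L_m|0\rangle=0$, $L_{-1}=\partial$, $L_0|_{\mathcal V_h}=h$, $[L_m,Y(x,z)]=\sum_{n=0}^{m+1}\binom{m+1}{n}z^{m+1-n}Y(L_{n-1}x,z)$. CFT type: $\mathcal V_h=0$ for $h<0$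 and $\mathcal V_0=\mathbb C|0\rangle$. A bilinear form is invariant if $(Y(x,z)u,v)=(-1)^{|x||u|}(u,Y(e^{zL_1}(e^{\mathrm i\pi}z^{-2})^{L_0}x,z^{-1})v)$ and $(L_mu,v)=(u,L_{-m}v)$. A half-integral good filtration of a $\mathbb Z_2$-graded $\mathcal V=\mathcal V^0\oplus\mathcal V^{1/2}$ is an increasing exhaustive filtration by $\mathfrak R_p\mathcal V$, $p\in\frac12\mathbb Z$ (in $\mathcal V^0$ for $p\in\mathbb Z$, in $\mathcal V^{1/2}$ for $p\in\frac12+\mathbb Z$; integer steps), with $|0\rangle\in\mathfrak R_0$, $x_ny\in\mathfrak R_{p+q}$ for $x\in\mathfrak R_p,y\in\mathfrak R_q$, and $x_ny\in\mathfrak R_{p+q-1}$ for $n\ge0$. It is nondegenerate if the invariant form restricts nondegenerately to each component; filtrations are understood separated and compatible with all gradings, so orthogonality refines it to a grading $\mathcal V=\bigoplus\mathcal V_{h,R}$. Set $\sigma|_{\mathcal V_{h,R}}=\mathrm i^{2R}$, $s=\sigma^2$. A graded-unitary vertex algebra is $(\mathcal V,(-,-),\mathfrak R_\bullet,\rho)$ with $\mathcal V$ Möbius, $(-,-)$ nondegenerate invariant, $\mathfrak R_\bullet$ a nondegenerate half-integral good filtration, $\rho$ an anti-linear isomorphism fixing $|0\rangle$, commuting with $L_{\pm1},L_0$, $\rho(x_ny)=(-1)^{|x||y|}\rho(x)_n\rho(y)$, preserving $\mathfrak R_\bullet$, $\rho^2=s$, $\rho\sigma=\sigma^{-1}\rho$,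 with $\langle x|y\rangle=((\sigma\rho)(x),y)$ Hermitian positive-definite. Internal grading and Hall–Littlewood ring. An internal $\mathbb Z$ grading $d$ is a vertex algebra $\mathbb Z$-grading with $|x|\equiv d$ mod 2, giving $\mathcal V=\bigoplus\mathcal V_{h,R,d}$, with $(\mathcal V_{\bullet,\bullet,d},\mathcal V_{\bullet,\bullet,d'})=0$ unless $d'=-d$. It satisfies the BPS bound if $\mathcal V_{h,R,d}=0$ for $h<R+\frac12|d|$. ${\rm gr}_{\mathfrak R}\mathcal V=\bigoplus_p\mathfrak R_p\mathcal V/\mathfrak R_{p-1}\mathcal V\cong\bigoplus\mathcal V_{h,R,d}$ is a Poisson vertex algebra. The Hall–Littlewood operators are the elements of $\mathcal V_{R-\frac12d,R,d}$, $d\le0$; they form a Poisson algebra ${\rm HL}_{\mathcal V}\subset{\rm gr}_{\mathfrak R}\mathcal V$ with product the component of $x_{-1}y$ of degree $R_x+R_y$ and bracket the component of $x_0y$ of degree $R_x+R_y-1$. Hamiltonian actions. $G$ is a complex reductive group with Lie algebra $\mathfrak g=\mathfrak g_c\otimes\mathbb C$, $\mathfrak g_c$ the Lie algebra of a compact form; $G$-invariants below mean $\mathfrak g$-invariants. $\{T_A\}$ is a basis of $\mathfrak g_c$, $[T_A,T_B]=f_{AB}^CT_C$; $\kappa$ is a nondegenerate invariant form on $\mathfrak g_c$ restricting to the normalized Killing form (long roots of squared length 2) on simple factors, $K_{AB}=\kappa(T_A,T_B)$ with inverse $K^{AB}$, $f_{ABC}=f^D_{AB}K_{DC}$; the basis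 is adapted to the simple ideals and centre with $(K_{AB})$ diagonal with entries $\pm1$. A Hamiltonian $\widehat{\mathfrak g}_{-2h^\vee}$ action is a vertex algebra homomorphism from the universal affine vertex algebra (level $-2h^\vee$ on simple factors, $0$ on the centre) with $J_A(z)J_B(w)\sim\frac{kK_{AB}}{(z-w)^2}+\frac{f_{AB}^CJ_C(w)}{z-w}$; $J_A$ also denotes the images. It is good if (i) $J_A\in\mathfrak R_1(\mathcal V_{\rm matter})_{h=1}$; (ii) the component of $J_{A,n}$ raising $R$ by 1 vanishes for $n\ge0$; (iii) $\rho(J_A)=J_A$. The complex. ${\rm Sf}[\mathbb C^2\otimes\mathfrak g]$ is freely generated by odd $\eta^{\pm,A}$ of weight 1 with $[\eta^{\alpha,A}_n,\eta^{\beta,B}_m]=n\epsilon^{\alpha\beta}K^{AB}\delta_{n+m,0}$, $\epsilon^{+-}=1=-\epsilon^{-+}$; monomials in creation modes with $\ell$ factors have $R=\ell/2$; $\eta^{\pm,A}$ has $d=\pm1$; its conjugation is $\rho(\eta^{\alpha,A})=\mathrm i\epsilon_{\alpha\beta}K_{AB}\eta^{\beta,B}$ ($\epsilon_{\alpha\beta}\epsilon^{\beta\gamma}=\delta_\alpha^\gamma$) and form normalized by $(|0\rangle,|0\rangle)=1$. $\mathcal V=(\mathcal V_{\rm matter}\otimes{\rm Sf}[\mathbb C^2\otimes\mathfrak g])^G=\{x:(J_{A,0}+\theta_A)x=0\ \forall A\}$, $\theta_A:\eta^{\alpha,B}\mapsto-f_{AC}^B\eta^{\alpha,C}$, with the restricted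 tensor-product structure (additive $h,R,d$). With $\Lambda$ the even derivation, zero on $\mathcal V_{\rm matter}$, $\Lambda\eta^{-,A}=\eta^{+,A}$, $\Lambda\eta^{+,A}=0$, set $$\mathbf Q^-=\sum_{n\ne0}\tfrac1n\eta^{-,A}_{-n}J_{A,n}+\sum_{m,n\ne0,\,m\ne n}\tfrac{f_{ABC}}{2mn}:\!\eta^{-,A}_{-n}\eta^{-,B}_m\eta^{+,C}_{n-m}\!:,\qquad\mathbf Q^+=[\Lambda,\mathbf Q^-].$$ $\mathbf Q^\pm$ decomposes into parts of $R$-degree $\pm\frac12$; $Q^\pm={\rm gr}\,\mathbf Q^\pm$ is the degree $+\frac12$ part, a differential on ${\rm gr}_{\mathfrak R}\mathcal V$. $Q^+$ preserves Hall–Littlewood operators and has $d$-degree $+1$, making ${\rm HL}_{\mathcal V}$ a DG Poisson algebra. Derived Poisson reduction. For a Poisson (super)algebra $A$ with Hamiltonian action of the reductive group $G$ and comoment map $\mu^*:\mathfrak g\to A$, the derived Poisson reduction of $A$ by $G$ is represented by the DG Poisson algebra $(A\otimes\bigwedge^\bullet\mathfrak g)^G$ ($\bigwedge^k\mathfrak g$ in degree $-k$) with Koszul differential $d(a)=0$ for $a\in A$, $d(T)=\mu^*(T)$ for $T\in\mathfrak g$ (up to an overall sign convention), and bracket induced from that of $A$ with trivial bracket on $\bigwedge^\bullet\mathfrak g$; its ${\rm Spec}$ is written $({\rm Spec}A)/\!\!/G$. On $A={\rm HL}_{\mathcal V_{\rm matter}}$ the comoment map is $T_A\mapsto J_A$.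 *)

(* Defs.v *)
(* Half-integers (conformal weights h, filtration indices p, R-charges) are
   stored doubled, as elements of int; the internal degree d is not doubled.
   Parity is a bool (true = odd). *)
From HB Require Import structures.
From mathcomp Require Import all_boot all_order all_algebra.
From mathcomp Require Import boolp classical_sets functions fsbigop reals.
From mathcomp Require Import complex.

Set Implicit Arguments.
Unset Strict Implicit.
Unset Printing Implicit Defensive.

Import Order.TTheory GRing.Theory Num.Theory.

Local Open Scope classical_set_scope.
Local Open Scope ring_scope.
Local Open Scope complex_scope.

Section LinearAlgebra.
Variables (K : fieldType).

Definition subspace (V : lmodType K) (P : set V) : Prop :=
  P 0 /\ forall a x y, P x -> P y -> P (a *: x + y).

Definition lspan (V : lmodType K) (G : set V) : set V :=
  [set x | exists n (c : 'I_n -> K) (e : 'I_n -> V),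
     (forall i, G (e i)) /\ x = \sum_(i < n) c i *: e i].

Definition finite_dimensional (V : lmodType K) (P : set V) : Prop :=
  exists n (e : 'I_n -> V), forall x, P x ->
    exists c : 'I_n -> K, x = \sum_(i < n) c i *: e i.

Definition direct_sum (I : eqType) (V : lmodType K) (S : I -> set V) : Prop :=
  [/\ forall i, subspace (S i),
      forall x, exists (s : seq I) (c : I -> V),
        (forall i, S i (c i)) /\ x = \sum_(i <- s) c i &
      forall (s : seq I) (c : I -> V), uniq s -> (forall i, S i (c i)) ->
        \sum_(i <- s) c i = 0 -> forall i, i \in s -> c i = 0].

(* z is the component of x in S i. *)
Definition is_component (I : eqType) (V : lmodType K) (S : I -> set V)
    (i : I) (x z : V) : Prop :=
  S i z /\ exists (s : seq I) (c : I -> V),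
    [/\ i \notin s, forall j, S j (c j) & x = z + \sum_(j <- s) c j].

Definition component (I : eqType) (V : lmodType K) (S : I -> set V)
    (i : I) (x : V) : V :=
  xget 0 [set z | is_component S i x z].

Definition graded_subspace (I : eqType) (V : lmodType K) (S : I -> set V)
    (P : set V) : Prop :=
  forall x i z, P x -> is_component S i x z -> P z.

Definition is_basis (I : eqType) (P : pred I) (V : lmodType K) (b : I -> V) :
    Prop :=
  (forall x, exists (s : seq I) (c : I -> K),
     all P s /\ x = \sum_(i <- s) c i *: b i) /\
  (forall (s : seq I) (c : I -> K), uniq s -> all P s ->
     \sum_(i <- s) c i *: b i = 0 -> forall i, i \in s -> c i = 0).

Definition bilinear_map (V W X : lmodType K) (f : V -> W -> X) : Prop :=
  (forall a x y w, f (a *: x + y) w = a *: f x w + f y w) /\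
  (forall a v x y, f v (a *: x + y) = a *: f v x + f v y).

Definition is_tensor_product (V W T : lmodType K) (tens : V -> W -> T) : Prop :=
  bilinear_map tens /\
  forall (X : lmodType K) (f : V -> W -> X), bilinear_map f ->
    exists! g : {linear T -> X}, forall v w, g (tens v w) = f v w.

End LinearAlgebra.

(* Binomial coefficient with integer upper argument. *)
Definition binz (m : int) (j : nat) : int :=
  match m with
  | Posz n => 'C(n, j)%:Z
  | Negz n => (-1) ^+ j * 'C(n + j, j)%:Z
  end.

Definition oddz (p : int) : bool := odd (absz p).

Section VertexAlgebras.
Variable (R : realType).
Local Notation C := R[i].

(* [mode x n y] is x_n y, where Y(x,z) = sum_n x_n z^(-n-1). *)
Record vertexAlgebra := VertexAlgebra {
  va_sort :> lmodType C;
  par : bool -> set va_sort;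
  vac : va_sort;
  mode : va_sort -> int -> va_sort -> va_sort;
  par_direct : direct_sum par;
  par_vac : par false vac;
  par_mode : forall a b x y n, par a x -> par b y -> par (a (+) b) (mode x n y);
  mode_bilinear : forall n, bilinear_map (fun x y => mode x n y);
  mode_trunc : forall x y, exists N : int, forall n, N <= n -> mode x n y = 0;
  vac_mode : forall n x, mode vac n x = if n == -1 then x else 0;
  mode_vac : forall x, mode x (-1) vac = x;
  mode_vac_ge0 : forall x (n : nat), mode x n vac = 0;
  (* Borcherds identity *)
  va_borcherds : forall a b x y z (l m n : int), par a x -> par b y ->
    \sum_(j \in [set: nat])
       (binz m j)%:~R *: mode (mode x (l + j%:Z) y) (m + n - j%:Z) z =
    \sum_(j \in [set: nat])
       ((-1) ^+ j * (binz l j)%:~R) *: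
         (mode x (m + l - j%:Z) (mode y (n + j%:Z) z)
          - ((-1) ^ l * (-1) ^+ (a && b)) *:
              mode y (n + l - j%:Z) (mode x (m + j%:Z) z))
}.

Definition translation (V : vertexAlgebra) (x : V) : V := mode x (-2) (vac V).

Definition va_hom (V W : vertexAlgebra) (phi : {linear V -> W}) : Prop :=
  [/\ phi (vac V) = vac W,
      forall x n y, phi (mode x n y) = mode (phi x) n (phi y) &
      forall b x, par b x -> par b (phi x)].

Definition even_derivation (V : vertexAlgebra) (D : {linear V -> V}) : Prop :=
  (forall b x, par b x -> par b (D x)) /\
  (forall x n y, D (mode x n y) = mode (D x) n y + mode x n (D y)).

(* x |-> (-1)^|x| x *)
Definition parity_sign (V : vertexAlgebra) (x : V) : V :=
  component (@par V) false x - component (@par V) true x.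

(* For s = [:: (i1, k1); ...; (ir, kr)], the vector
   (x_i1)_(-k1-1) ... (x_ir)_(-kr-1) |0>. *)
Definition creation_monomial (V : vertexAlgebra) (I : finType) (x : I -> V)
    (s : seq (I * nat)) : V :=
  foldr (fun p v => mode (x p.1) (- p.2.+1%:Z) v) (vac V) s.

Definition creation_lt (I : finType) : rel (I * nat) := fun p q =>
  (p.2 < q.2)%N || ((p.2 == q.2) && (enum_rank p.1 < enum_rank q.1)%N).

Definition creation_le (I : finType) : rel (I * nat) := fun p q =>
  (p == q) || creation_lt p q.

(* All generators x i have the same parity b. *)
Definition freely_generated (V : vertexAlgebra) (b : bool) (I : finType)
    (x : I -> V) : Prop :=
  (forall i, par b (x i)) /\
  is_basis (sorted (if b then @creation_lt I else @creation_le I))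
    (creation_monomial x).

Definition is_tensor_va (V W T : vertexAlgebra) (tens : V -> W -> T) : Prop :=
  [/\ is_tensor_product tens,
      vac T = tens (vac V) (vac W),
      forall a b x y, par a x -> par b y -> par (a (+) b) (tens x y) &
      forall a b x y u v n, par a y -> par b u ->
        mode (tens x u) n (tens y v) =
        (-1) ^+ (a && b) *:
          \sum_(k \in [set: int]) tens (mode x k y) (mode u (n - k - 1) v)].

Record mobius (V : vertexAlgebra) := Mobius {
  wt : int -> set V;
  Lop : int -> {linear V -> V};   (* only L_(-1), L_0, L_1 are meaningful *)
  wt_direct : direct_sum wt;
  wt_par : forall h, graded_subspace (@par V) (wt h);
  wt_vac : wt 0 (vac V);
  wt_mode : forall h k x y (n : int), wt h x -> wt k y ->
    wt (h + k - 2 * n - 2) (mode x n y);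
  wt_fin : forall h, finite_dimensional (wt h);
  wt_bounded : exists N : int, forall (h : int) x, h < N -> wt h x -> x = 0;
  L_par : forall (m : int) b x, `|m| <= 1 -> par b x -> par b (Lop m x);
  L_comm : forall (m n : int) x, `|m| <= 1 -> `|n| <= 1 -> `|m + n| <= 1 ->
    Lop m (Lop n x) - Lop n (Lop m x) = (m - n)%:~R *: Lop (m + n) x;
  L_vac : forall m : int, `|m| <= 1 -> Lop m (vac V) = 0;
  L_translation : forall x, Lop (-1) x = translation x;
  L0_wt : forall h x, wt h x -> Lop 0 x = (h%:~R / 2) *: x;
  L_mode : forall (m : int) x k y, `|m| <= 1 ->
    Lop m (mode x k y) - mode x k (Lop m y) =
    \sum_(n < (absz (m + 1)).+1)
       'C(absz (m + 1), n)%:R *: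
          mode (Lop (n%:Z - 1) x) (k + m + 1 - n%:Z) y
}.

Definition CFT_type (V : vertexAlgebra) (M : mobius V) : Prop :=
  (forall (h : int) x, h < 0 -> wt M h x -> x = 0) /\
  (forall x, wt M 0 x <-> exists c : C, x = c *: vac V).

(* The coefficient of z^(-n-1) in
   Y(e^(z L_1) (e^(i pi) z^(-2))^(L_0) x, z^(-1)) v, for x of weight h/2. *)
Definition adjoint_mode (V : vertexAlgebra) (M : mobius V)
    (h : int) (x : V) (n : int) (v : V) : V :=
  'i ^ h *: \sum_(j \in [set: nat])
              (j`!)%:R^-1 *: mode (iter j (Lop M 1) x) (h - j%:Z - n - 2) v.

Definition invariant_form (V : vertexAlgebra) (M : mobius V)
    (B : V -> V -> C) : Prop :=
  [/\ forall a x y v, B (a *: x + y) v = a * B x v + B y v,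
      forall a u x y, B u (a *: x + y) = a * B u x + B u y,
      forall a b h x u n v, par a x -> par b u -> wt M h x ->
        B (mode x n u) v = (-1) ^+ (a && b) * B u (adjoint_mode M h x n v) &
      forall (m : int) u v, `|m| <= 1 -> B (Lop M m u) v = B u (Lop M (- m) v)].

Definition nondegenerate_on (V : lmodType C) (P : set V) (B : V -> V -> C) :
    Prop :=
  (forall x, P x -> (forall y, P y -> B x y = 0) -> x = 0) /\
  (forall x, P x -> (forall y, P y -> B y x = 0) -> x = 0).

(* E false + E true is the decomposition V = V^0 + V^(1/2). *)
Definition good_filtration (V : vertexAlgebra) (E : bool -> set V)
    (F : int -> set V) : Prop :=
  [/\ direct_sum E,
      forall p, subspace (F p) /\ F p `<=` E (oddz p) `&` F (p + 2),
      forall e x, E e x -> exists p, oddz p = e /\ F p x,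
      F 0 (vac V) &
      forall p q x y (n : int), F p x -> F q y ->
        F (p + q) (mode x n y) /\ (0 <= n -> F (p + q - 2) (mode x n y))].

Definition separated_filtration (V : lmodType C) (F : int -> set V) : Prop :=
  forall (e : bool) x, (forall p, oddz p = e -> F p x) -> x = 0.

Record gradedUnitary (V : vertexAlgebra) := GradedUnitary {
  gu_mobius :> mobius V;
  form : V -> V -> C;
  z2part : bool -> set V;
  filt : int -> set V;
  sigma : {linear V -> V};
  rho : V -> V;
  form_inv : invariant_form gu_mobius form;
  form_nondeg : nondegenerate_on setT form;
  filt_good : good_filtration z2part filt;
  filt_sep : separated_filtration filt;
  filt_par : forall p, graded_subspace (@par V) (filt p);
  filt_wt : forall p, graded_subspace (wt gu_mobius) (filt p);
  filt_nondeg : forall p, nondegenerate_on (filt p) form;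
  (* the R-grading is F_p orthogonal to F_(p-1) *)
  sigmaE : forall p x, filt p x -> (forall y, filt (p - 2) y -> form x y = 0) ->
    sigma x = 'i ^ p *: x;
  rho_antilinear : forall a x y, rho (a *: x + y) = a^* *: rho x + rho y;
  rho_bij : bijective rho;
  rho_par : forall b x, par b x -> par b (rho x);
  rho_vac : rho (vac V) = vac V;
  rho_L : forall (m : int) x, `|m| <= 1 ->
    rho (Lop gu_mobius m x) = Lop gu_mobius m (rho x);
  rho_mode : forall a b x n y, par a x -> par b y ->
    rho (mode x n y) = (-1) ^+ (a && b) *: mode (rho x) n (rho y);
  rho_filt : forall p x, filt p x -> filt p (rho x);
  rho_sq : forall x, rho (rho x) = sigma (sigma x);
  rho_sigma : forall x, sigma (rho (sigma x)) = rho x;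
  herm : forall x y,
    form (sigma (rho x)) y = (form (sigma (rho y)) x)^*;
  herm_pos : forall x, x != 0 -> 0 < form (sigma (rho x)) x
}.

Definition Rcharge (V : vertexAlgebra) (U : gradedUnitary V) (p : int) :
    set V :=
  [set x | filt U p x /\ forall y, filt U (p - 2) y -> form U x y = 0].

Record internalGrading (V : vertexAlgebra) (U : gradedUnitary V) :=
  InternalGrading {
  intdeg : int -> set V;
  intdeg_direct : direct_sum intdeg;
  intdeg_vac : intdeg 0 (vac V);
  intdeg_mode : forall d e x y n, intdeg d x -> intdeg e y ->
    intdeg (d + e) (mode x n y);
  intdeg_par : forall d x, intdeg d x -> par (oddz d) x;
  intdeg_wt : forall h, graded_subspace intdeg (wt U h);
  intdeg_filt : forall p, graded_subspace intdeg (filt U p);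
  intdeg_form : forall d e x y, intdeg d x -> intdeg e y -> e != - d ->
    form U x y = 0
}.

Record trigrading (V : vertexAlgebra) := Trigrading {
  tri_wt : int -> set V;
  tri_R : int -> set V;
  tri_d : int -> set V
}.

Definition tri_piece (V : vertexAlgebra) (t : trigrading V) (h r d : int) :
    set V :=
  tri_wt t h `&` tri_R t r `&` tri_d t d.

Definition trigrading_of (V : vertexAlgebra) (U : gradedUnitary V)
    (D : internalGrading U) : trigrading V :=
  Trigrading (wt U) (Rcharge U) (intdeg D).

Definition restrict_trigrading (V : vertexAlgebra) (t : trigrading V)
    (P : set V) : trigrading V :=
  Trigrading (fun h => tri_wt t h `&` P) (fun r => tri_R t r `&` P)
             (fun d => tri_d t d `&` P).

Definition tensor_grading (V W T : vertexAlgebra) (tens : V -> W -> T)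
    (S : int -> set V) (S' : int -> set W) (k : int) : set T :=
  lspan [set z | exists i j x y,
           [/\ S i x, S' j y, i + j = k & z = tens x y]].

Definition tensor_trigrading (V W T : vertexAlgebra) (tens : V -> W -> T)
    (t : trigrading V) (t' : trigrading W) : trigrading T :=
  Trigrading (tensor_grading tens (tri_wt t) (tri_wt t'))
             (tensor_grading tens (tri_R t) (tri_R t'))
             (tensor_grading tens (tri_d t) (tri_d t')).

(* h >= R + |d|/2 *)
Definition BPS_bound (V : vertexAlgebra) (t : trigrading V) : Prop :=
  forall (h r d : int) x, h < r + `|d| -> tri_piece t h r d x -> x = 0.

(* Underlying data of a (DG) Poisson superalgebra over C.  The algebra is the
   subspace pois_car of the vector space pois_sort, and the operations are only
   meaningful on it.  pois_sgn is a |-> (-1)^|a| a. *)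
Record poissonData := PoissonData {
  pois_sort :> lmodType C;
  pois_car : set pois_sort;
  pois_deg : int -> set pois_sort;
  pois_sgn : pois_sort -> pois_sort;
  pois_one : pois_sort;
  pois_mul : pois_sort -> pois_sort -> pois_sort;
  pois_br : pois_sort -> pois_sort -> pois_sort
}.

Record dgPoissonData := DGPoissonData {
  dg_pois :> poissonData;
  dg_dif : dg_pois -> dg_pois
}.

Definition dg_poisson_iso (A B : dgPoissonData) : Prop :=
  exists phi : A -> B,
    [/\ set_bij (@pois_car A) (@pois_car B) phi,
        forall a x y, pois_car x -> pois_car y ->
          phi (a *: x + y) = a *: phi x + phi y,
        forall x, pois_car x ->
          (forall k, pois_deg k x <-> pois_deg k (phi x)) /\
          phi (pois_sgn x) = pois_sgn (phi x),
        phi (pois_one A) = pois_one B /\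
        (forall x y, pois_car x -> pois_car y ->
           phi (pois_mul x y) = pois_mul (phi x) (phi y) /\
           phi (pois_br x y) = pois_br (phi x) (phi y)) &
        forall x, pois_car x -> phi (dg_dif x) = dg_dif (phi x)].

(* The span of the V_{R - d/2, R, d} with d <= 0. *)
Definition HL (V : vertexAlgebra) (t : trigrading V) : set V :=
  lspan [set x | exists r d : int, d <= 0 /\ tri_piece t (r - d) r d x].

(* The bilinear operation which on V_R x V_R' is the component of x_n y of
   degree R + R' + k/2. *)
Definition gr_mode (V : vertexAlgebra) (t : trigrading V) (n k : int)
    (x y : V) : V :=
  \sum_(p \in [set: int * int])
     component (tri_R t) (p.1 + p.2 + k)
       (mode (component (tri_R t) p.1 x) n (component (tri_R t) p.2 y)).

Definition HL_poisson (V : vertexAlgebra) (t : trigrading V) : poissonData :=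
  PoissonData (HL t) (fun d => HL t `&` tri_d t d) (@parity_sign V) (vac V)
    (gr_mode t (-1) 0) (gr_mode t 0 (-2)).

(* The part of an operator raising R by k/2. *)
Definition gr_operator (V : vertexAlgebra) (t : trigrading V) (k : int)
    (Q : V -> V) (x : V) : V :=
  \sum_(p \in [set: int])
     component (tri_R t) (p + k) (Q (component (tri_R t) p x)).

End VertexAlgebras.

Section LieBracket.
Variables (K : fieldType) (n : nat) (f : 'I_n -> 'I_n -> 'I_n -> K).

Definition lie_bracket (x y : 'rV[K]_n) : 'rV[K]_n :=
  \row_c \sum_a \sum_b x 0 a * y 0 b * f a b c.

End LieBracket.

Section Reductive.
Variable (R : realType).
Local Notation C := R[i].

Definition in_block (K : fieldType) n s (blk : 'I_n -> option 'I_s) (i : 'I_s) :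
    set 'rV[K]_n :=
  [set x | forall a, blk a <> Some i -> x 0 a = 0].

Definition bilin n (k : 'M[R]_n) (x y : 'rV[R]_n) : R := (x *m k *m y^T) 0 0.

Definition killing_mx n (f : 'I_n -> 'I_n -> 'I_n -> R) : 'M[R]_n :=
  \matrix_(a, b) \sum_c \sum_d f a c d * f b d c.

(* Maximal abelian subalgebras of the i-th simple factor of the compact form. *)
Definition maximal_torus n s (f : 'I_n -> 'I_n -> 'I_n -> R)
    (blk : 'I_n -> option 'I_s) (i : 'I_s) (t : set 'rV[R]_n) : Prop :=
  [/\ subspace t, t `<=` in_block blk i,
      forall x y, t x -> t y -> lie_bracket f x y = 0 &
      forall x, in_block blk i x ->
        (forall y, t y -> lie_bracket f x y = 0) -> t x].

(* Roots are purely imaginary on t; v in t stands for the root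
   h |-> 'i * k(v, h), whose squared length with respect to k is - k(v, v). *)
Definition is_root n s (f : 'I_n -> 'I_n -> 'I_n -> R) (k : 'M[R]_n)
    (blk : 'I_n -> option 'I_s) (i : 'I_s) (t : set 'rV[R]_n) (v : 'rV[R]_n) :
    Prop :=
  [/\ t v, v != 0 &
      exists e : 'rV[C]_n, [/\ e != 0, in_block blk i e &
        forall h, t h ->
          lie_bracket (fun a b c => (f a b c)%:C)
            (map_mx (real_complex R) h) e =
          ('i * (bilin k v h)%:C) *: e]].

(* The real Lie algebra g_c in an adapted basis T_A, A < dimg: basis vectors
   with blk A = Some i span the i-th simple ideal, those with blk A = None span
   the centre.  fstr A B C is f_AB^C. *)
Record reductiveLie := ReductiveLie {
  dimg : nat;
  nsimple : nat;
  fstr : 'I_dimg -> 'I_dimg -> 'I_dimg -> R;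
  blk : 'I_dimg -> option 'I_nsimple;
  Kmx : 'M[R]_dimg;
  dual_coxeter : 'I_nsimple -> R;
  f_anti : forall a b c, fstr a b c = - fstr b a c;
  f_jacobi : forall x y z : 'rV[R]_dimg,
    lie_bracket fstr (lie_bracket fstr x y) z
    + lie_bracket fstr (lie_bracket fstr y z) x
    + lie_bracket fstr (lie_bracket fstr z x) y = 0;
  f_blk : forall a b c, fstr a b c != 0 ->
    exists i, [/\ blk a = Some i, blk b = Some i & blk c = Some i];
  blk_nonabelian : forall i, exists a b c, blk a = Some i /\ fstr a b c != 0;
  blk_simple : forall i (I : set 'rV[R]_dimg),
    subspace I -> I `<=` in_block blk i ->
    (forall x y, in_block blk i x -> I y -> I (lie_bracket fstr x y)) ->
    (forall x, I x -> x = 0) \/ I = in_block blk i;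
  blk_compact : forall i x, in_block blk i x -> x != 0 ->
    bilin (killing_mx fstr) x x < 0;
  K_diag : forall a b,
    if a == b then Kmx a b = 1 \/ Kmx a b = -1 else Kmx a b = 0;
  K_invariant : forall x y z,
    bilin Kmx (lie_bracket fstr x y) z = bilin Kmx x (lie_bracket fstr y z);
  (* long roots have squared length 2 *)
  K_normalized : forall i t, maximal_torus fstr blk i t ->
    (forall v, is_root fstr Kmx blk i t v -> - bilin Kmx v v <= 2) /\
    (exists v, is_root fstr Kmx blk i t v /\ - bilin Kmx v v = 2);
  (* the Killing form is 2 h^vee times the normalized form *)
  dual_coxeterE : forall i a b, blk a = Some i -> blk b = Some i ->
    killing_mx fstr a b = 2 * dual_coxeter i * Kmx a b
}.

Section Reduction.
Variable (g : reductiveLie).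
Local Notation I := 'I_(dimg g).

Definition fC (a b c : I) : C := (fstr a b c)%:C.
(* K^AB and f_ABC *)
Definition Kinv (a b : I) : C := (invmx (Kmx g) a b)%:C.
Definition flow (a b c : I) : C := (\sum_d fstr a b d * Kmx g d c)%:C.

Definition critical_level (a : I) : R :=
  if blk a is Some i then - 2 * dual_coxeter i else 0.

Definition is_universal_affine (U : vertexAlgebra R) (J : I -> U) : Prop :=
  freely_generated false J /\
  forall a b,
    [/\ mode (J a) 0 (J b) = \sum_c fC a b c *: J c,
        mode (J a) 1 (J b) = (critical_level a * Kmx g a b)%:C *: vac U &
        forall n : int, 2 <= n -> mode (J a) n (J b) = 0].

Record hamiltonianAction (V : vertexAlgebra R) := HamiltonianAction {
  affine_va : vertexAlgebra R;
  affine_gen : I -> affine_va;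
  affine_gen_spec : is_universal_affine affine_gen;
  ham_map : {linear affine_va -> V};
  ham_hom : va_hom ham_map
}.

Definition current (V : vertexAlgebra R) (H : hamiltonianAction V) (a : I) : V :=
  ham_map H (affine_gen H a).

Definition good_action (V : vertexAlgebra R) (U : gradedUnitary V)
    (H : hamiltonianAction V) : Prop :=
  forall a,
    [/\ filt U 2 (current H a) /\ wt U 2 (current H a),
        forall (n : int) p x z, 0 <= n -> Rcharge U p x ->
          is_component (Rcharge U) (p + 2) (mode (current H a) n x) z ->
          z = 0 &
        rho U (current H a) = current H a].

(* epsilon^{+-} = 1; true is + and false is - *)
Definition eps (s t : bool) : C :=
  if s == t then 0 else if s then 1 else -1.

(* eta (s, A) is eta^{s, A}. *)
Definition is_symplectic_fermions (S : vertexAlgebra R)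
    (eta : bool * I -> S) : Prop :=
  freely_generated true eta /\
  forall s t a b n m x,
    mode (eta (s, a)) n (mode (eta (t, b)) m x)
    + mode (eta (t, b)) m (mode (eta (s, a)) n x) =
    (if n + m == 0 then n%:~R * eps s t * Kinv a b else 0) *: x.

Definition sf_trigrading (S : vertexAlgebra R) (eta : bool * I -> S) :
    trigrading S :=
  Trigrading
    (fun h => lspan [set x | exists s, x = creation_monomial eta s /\
                      h = \sum_(q <- s) 2 * q.2.+1%:Z])
    (fun r => lspan [set x | exists s, x = creation_monomial eta s /\
                      r = (size s)%:Z])
    (fun d => lspan [set x | exists s, x = creation_monomial eta s /\
                      d = \sum_(q <- s) (if q.1.1 then 1 else -1)]).

(* Normally ordered product of the modes (x_i)_n of odd vectors x_i:
   annihilation modes (n > 0) are moved to the right with Koszul signs. *)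
Fixpoint normal_ordered (V : vertexAlgebra R) (s : seq (V * int)) (x : V) : V :=
  match s with
  | [::] => x
  | p :: s' =>
      if p.2 < 0 then mode p.1 p.2 (normal_ordered s' x)
      else (-1) ^+ size s' *: normal_ordered s' (mode p.1 p.2 x)
  end.

(* The operator Q^- on a vertex algebra containing currents J_A and fermions
   eta^{s, A}. *)
Definition Qminus (T : vertexAlgebra R) (J : I -> T) (eta : bool * I -> T)
    (x : T) : T :=
  \sum_(n \in [set n : int | n != 0]) \sum_a
     n%:~R^-1 *: mode (eta (false, a)) (- n) (mode (J a) n x)
  + \sum_(mn \in [set mn : int * int |
                    [&& mn.1 != 0, mn.2 != 0 & mn.1 != mn.2]])
      \sum_a \sum_b \sum_c
        (flow a b c / (2 * mn.1%:~R * mn.2%:~R)) *: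
          normal_ordered [:: (eta (false, a), - mn.2); (eta (false, b), mn.1);
                             (eta (true, c), mn.2 - mn.1)] x.

Definition Qplus (T : vertexAlgebra R) (J : I -> T) (eta : bool * I -> T)
    (Lam : {linear T -> T}) (x : T) : T :=
  Lam (Qminus J eta x) - Qminus J eta (Lam x).

(* The currents, the fermions and the derivations theta_A and Lambda on the
   tensor product T of the matter vertex algebra V and S = Sf[C^2 (x) g]. *)
Section Complex.
Variables (V S T : vertexAlgebra R) (tens : V -> S -> T).
Variables (J : I -> V) (eta : bool * I -> S).

Definition left_current (a : I) : T := tens (J a) (vac S).
Definition right_fermion (sa : bool * I) : T := tens (vac V) (eta sa).

Definition is_theta (theta : I -> {linear T -> T}) : Prop :=
  forall a,
    [/\ even_derivation (theta a),
        forall x, theta a (tens x (vac S)) = 0 &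
        forall s b, theta a (right_fermion (s, b)) =
          - \sum_c fC a c b *: right_fermion (s, c)].

Definition is_Lambda (Lam : {linear T -> T}) : Prop :=
  [/\ even_derivation Lam,
      forall x, Lam (tens x (vac S)) = 0 &
      forall a, Lam (right_fermion (false, a)) = right_fermion (true, a) /\
                Lam (right_fermion (true, a)) = 0].

Definition invariants (theta : I -> {linear T -> T}) : set T :=
  [set x | forall a, mode (left_current a) 0 x + theta a x = 0].

(* HL_V for V = T^G, with the differential Q^+ *)
Definition HL_complex (theta : I -> {linear T -> T}) (Lam : {linear T -> T})
    (t : trigrading V) : dgPoissonData R :=
  let tV := restrict_trigrading
              (tensor_trigrading tens t (sf_trigrading eta))
              (invariants theta) in
  @DGPoissonData R (HL_poisson tV)
    (gr_operator tV 1 (Qplus left_current right_fermion Lam)).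

End Complex.

(* The exterior algebra of g with coefficients in A: the value u X of
   u : {ffun {set I} -> A} is the coefficient of T_A1 /\ ... /\ T_Ak,
   where X = {A1 < ... < Ak}. *)
Section DerivedReduction.
Variables (A : poissonData R) (mu : I -> A).
Local Notation ext := {ffun {set I} -> A}.

Definition below (b : I) (X : {set I}) : nat := #|[set d in X | (d < b)%N]|.

Definition wedge (b : I) (u : ext) : ext :=
  [ffun X : {set I} => if b \in X then (-1) ^+ below b X *: u (X :\ b) else 0].

Definition contract (b : I) (u : ext) : ext :=
  [ffun X : {set I} => if b \in X then 0 else (-1) ^+ below b X *: u (b |: X)].

Definition ext_adjoint (a : I) (u : ext) : ext :=
  \sum_b \sum_c fC a b c *: wedge c (contract b u).

Definition ext_action (a : I) (u : ext) : ext :=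
  ([ffun X : {set I} => pois_br (mu a) (u X)] : ext) + ext_adjoint a u.

(* The sign in e_X /\ e_Y = shuffle_sign X Y e_(X u Y), for X, Y disjoint. *)
Definition shuffle_sign (X Y : {set I}) : C :=
  (-1) ^+ (\sum_(x in X) below x Y)%N.

(* Extension of an even bilinear operation on A, with the sign of
   (a e_X) (b e_Y) = (-1)^(|X| |b|) (a b) (e_X /\ e_Y). *)
Definition ext_op (op : A -> A -> A) (u v : ext) : ext :=
  [ffun Z : {set I} =>
     \sum_(X : {set I} | X \subset Z)
        shuffle_sign X (Z :\: X) *:
          op (u X) (iter #|X| (@pois_sgn R A) (v (Z :\: X)))].

(* d(a T) = (-1)^|a| a mu(T) *)
Definition koszul (u : ext) : ext :=
  [ffun X : {set I} => \sum_b pois_mul (pois_sgn (contract b u X)) (mu b)].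

Definition derived_reduction : dgPoissonData R :=
  @DGPoissonData R
    (@PoissonData R ext
       [set u : ext | (forall X, pois_car (u X)) /\ forall a, ext_action a u = 0]
       (fun k => [set u : ext | forall X : {set I}, pois_deg (k + #|X|%:Z) (u X)])
       (fun u : ext => [ffun X : {set I} => (-1) ^+ #|X| *: pois_sgn (u X)])
       [ffun X : {set I} => if X == finset.set0 then pois_one A else 0]
       (ext_op (@pois_mul R A))
       (ext_op (@pois_br R A)))
    koszul.

End DerivedReduction.
End Reduction.
End Reductive.

(* Main.v *)
Require Import Defs.
From HB Require Import structures.
From mathcomp Require Import all_boot all_order all_algebra.
From mathcomp Require Import boolp classical_sets functions fsbigop reals.
From mathcomp Require Import complex zify.

Set Implicit Arguments.
Unset Strict Implicit.
Unset Printing Implicit Defensive.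

Import Order.TTheory GRing.Theory Num.Theory.

Local Open Scope classical_set_scope.
Local Open Scope ring_scope.

(** The reason for the theorem is a counting of degrees. On the matter side the
    BPS bound gives h - R + d/2 >= h - R - |d|/2 >= 0. On the fermionic side a
    creation mode eta^+-_(-n) contributes n - 1/2 +- 1/2 >= 0 to h - R + d/2, and
    nothing exactly when it is eta^-_(-1) ([deg_excess], [deg_excess_eq]). A
    Hall-Littlewood vector has h - R + d/2 = 0, so both contributions vanish:
    before taking invariants, the Hall-Littlewood part of the tensor product is
    HL_matter (x) E, where E is the exterior algebra generated by the
    eta^-_(-1) ([HL_piece_ext], [HL_tensorP]). With its index lowered, eta^-_a
    transforms like the basis vector T_a of g, so E is the exterior algebra
    of g, and the comparison map is
      Psi(u) = sum_X (-1)^|X| u_X (x) eta_X,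
    where X runs over the subsets of the basis and eta_X is the corresponding
    monomial. The map of the theorem is the inverse of Psi.

    Invariants. The currents are homogeneous of degree (h, R, d) = (1, 1, 0):
    a component with R <= 0 would pair trivially with its whole filtration
    piece ([filt0_wt1]), and a component with d <> 0 would violate the bound.
    The zero modes J_(a,0) are skew-adjoint up to a scalar, hence preserve the
    R-grading and not only the filtration ([zero_mode_charge]). So the total action of g
    preserves the gradings and can be imposed after the Hall-Littlewood
    condition ([HL_invariantsP]), and Psi intertwines it with the action on
    exterior forms ([adj_Psi]). That the R-grading exists at all is
    [Rcharge_direct].

    Product and bracket. The modes of a monomial eta_X on E vanish for
    nonnegative index, and the (-1)-mode is the exterior product
    ([ext_list_mode], [ext_mono_product]). Modes of lower index are accompanied
    by modes of the matter factor which have no component of the required charge,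
    by the filtration for the product and by the BPS bound for the bracket
    ([tensor_gr_mode]).

    Differential. In Q^+ x = Lambda Q^- x - Q^- Lambda x, for x a Hall-Littlewood
    vector, the degrees leave room for a single term of leading charge
    ([Qplus_leading]): terms with J_n, n > 0, are excluded by the bound, and the
    others land in degrees of the fermions that contain no monomial
    ([sf_piece_empty]). What remains is eta^-_1 J_(-1) Lambda, and
    commuting eta^-_1 past Lambda turns it into -J_(-1) (x) eta^+_1. As eta^+_1
    acts on E by contraction ([ext_mono_iota]), this is the Koszul
    differential, the sign in Psi absorbing the minus sign.

    In formulas weights and charges are stored doubled, so that the
    Hall-Littlewood condition reads h = r - d. *)

(** * Subspaces and graded vector spaces *)

Section Subspaces.
Variables (K : fieldType) (V : lmodType K).
Implicit Types (P : set V).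

Lemma subspace0 P : subspace P -> P 0. Proof. by case. Qed.

Lemma subspaceZ P a x : subspace P -> P x -> P (a *: x).
Proof. by move=> [P0 PL] Px; rewrite -[_ *: _]addr0; apply: PL. Qed.

Lemma subspaceD P x y : subspace P -> P x -> P y -> P (x + y).
Proof. by move=> [P0 PL] Px Py; rewrite -[x]scale1r; apply: PL. Qed.

Lemma subspaceN P x : subspace P -> P x -> P (- x).
Proof. by move=> sP Px; rewrite -scaleN1r; apply: subspaceZ. Qed.

Lemma subspaceB P x y : subspace P -> P x -> P y -> P (x - y).
Proof. by move=> sP Px Py; apply: subspaceD => //; apply: subspaceN. Qed.

Lemma subspace_sum (I : Type) (s : seq I) (Q : pred I) P (F : I -> V) :
  subspace P -> (forall i, Q i -> P (F i)) -> P (\sum_(i <- s | Q i) F i).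
Proof.
move=> sP PF; elim/big_rec: _ => [|i x Qi Px]; first exact: subspace0.
by apply: subspaceD => //; apply: PF.
Qed.

Lemma subspace_fsum (I : choiceType) (A : set I) P (F : I -> V) :
  subspace P -> (forall i, A i -> P (F i)) -> P (\sum_(i \in A) F i).
Proof.
move=> sP PF; rewrite big_seq_cond; apply: subspace_sum => // i.
rewrite andbT; case: finite_supportP => //= X XA _ _ Xi.
by apply: PF; apply: XA.
Qed.

Lemma subspaceI P Q : subspace P -> subspace Q -> subspace (P `&` Q).
Proof.
move=> [P0 PL] [Q0 QL]; split=> // a x y [Px Qx] [Py Qy].
by split; [apply: PL | apply: QL].
Qed.

Lemma lspan_subspace (G : set V) : subspace (lspan G).
Proof.
split; first by exists 0%N, (fun=> 0), (fun=> 0); split; [case | rewrite big_ord0].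
move=> a x y [n [c [e [Ge ->]]]] [m [c' [e' [Ge' ->]]]].
exists (n + m)%N,
  (fun i => match fintype.split i with inl j => a * c j | inr j => c' j end),
  (fun i => match fintype.split i with inl j => e j | inr j => e' j end).
split; first by move=> i; case: (fintype.split i).
rewrite big_split_ord /= scaler_sumr; congr (_ + _); apply: eq_bigr => i _.
  have /= -> := unsplitK (inl i : 'I_n + 'I_m)%type.
  by rewrite scalerA.
by have /= -> := unsplitK (inr i : 'I_n + 'I_m)%type.
Qed.

Lemma lspan_gen (G : set V) x : G x -> lspan G x.
Proof.
move=> Gx; exists 1%N, (fun=> 1), (fun=> x); split=> //.
by rewrite big_ord1 scale1r.
Qed.

Lemma lspan_min (G P : set V) : subspace P -> G `<=` P -> lspan G `<=` P.
Proof.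
move=> sP GP x [n [c [e [Ge ->]]]]; apply: subspace_sum => // i _.
by apply: subspaceZ => //; apply: GP.
Qed.

Lemma lspan_mono (G H : set V) : G `<=` H -> lspan G `<=` lspan H.
Proof.
move=> GH; apply: lspan_min; first exact: lspan_subspace.
by move=> x /GH; apply: lspan_gen.
Qed.

End Subspaces.

Lemma subspace_preim (K : fieldType) (V W : lmodType K) (f : {linear V -> W})
  (P : set W) : subspace P -> subspace [set x | P (f x)].
Proof.
move=> [P0 PL]; split=> [|a x y Px Py] /=; first by rewrite linear0.
by rewrite linearP; apply: PL.
Qed.

Section FiniteSums.
Variables (V : zmodType).

Lemma fsum_seq (I : choiceType) (A : set I) (s : seq I) (F : I -> V) : uniq s ->
  (forall i, i \in s -> A i) ->
  (forall i, A i -> i \notin s -> F i = 0) ->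
  \sum_(i \in A) F i = \sum_(i <- s) F i.
Proof.
move=> us sA Fs; rewrite (fsbigE s) //.
rewrite big_seq_cond [RHS]big_seq_cond; apply: eq_bigl => i.
by case si: (i \in s); rewrite //= mem_set //; apply: sA.
Qed.

Lemma fsum_seqT (I : choiceType) (s : seq I) (F : I -> V) : uniq s ->
  (forall i, i \notin s -> F i = 0) ->
  \sum_(i \in [set: I]) F i = \sum_(i <- s) F i.
Proof. by move=> us Fs; apply: fsum_seq => // i _; apply: Fs. Qed.

Lemma fsum_single (I : choiceType) (i0 : I) (F : I -> V) :
  (forall i, i != i0 -> F i = 0) -> \sum_(i \in [set: I]) F i = F i0.
Proof.
move=> F0; rewrite (@fsum_seqT _ [:: i0]) ?big_seq1 // => i.
by rewrite inE => /F0.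
Qed.

Lemma sum_widen (I : choiceType) (r t : seq I) (F : I -> V) : uniq r -> uniq t ->
  {subset r <= t} -> (forall i, i \notin r -> F i = 0) ->
  \sum_(i <- t) F i = \sum_(i <- r) F i.
Proof.
move=> ur ut rt F0; rewrite -(@fsum_seqT _ r) // -(@fsum_seqT _ t) // => j jt.
by apply: F0; apply: contra jt; apply: rt.
Qed.

End FiniteSums.

Section DirectSums.
Variables (K : fieldType) (I : choiceType) (V : lmodType K) (S : I -> set V).
Hypothesis dS : direct_sum S.

Let sS i : subspace (S i). Proof. by case: dS. Qed.

(** A decomposition may repeat an index; collecting terms, a decomposition with
    distinct indices always exists. *)
Lemma sum_regroup (s : seq I) (c : I -> V) : (forall i, S i (c i)) ->
  exists c', (forall i, S i (c' i)) /\
    (forall i, i \notin s -> c' i = 0) /\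
    \sum_(i <- s) c i = \sum_(i <- undup s) c' i.
Proof.
move=> Sc; exists (fun i => c i *+ count_mem i s); split; last split.
- by move=> i; rewrite -scaler_nat; apply: subspaceZ.
- by move=> i /count_memPn ->; rewrite mulr0n.
- by rewrite -big_undup_iterop_count.
Qed.

Lemma direct_sum_decomp x : exists (s : seq I) (c : I -> V),
  [/\ uniq s, forall i, S i (c i), forall i, i \notin s -> c i = 0 &
      x = \sum_(i <- s) c i].
Proof.
have [_ /(_ x)[s [c [Sc ->]]] _] := dS.
have [c' [Sc' [c0 ->]]] := sum_regroup s Sc.
by exists (undup s), c'; split; rewrite ?undup_uniq // => i; rewrite mem_undup; apply: c0.
Qed.

Lemma direct_sum_eq (s s' : seq I) (c c' : I -> V) : uniq s -> uniq s' ->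
  (forall i, S i (c i)) -> (forall i, S i (c' i)) ->
  (forall i, i \notin s -> c i = 0) -> (forall i, i \notin s' -> c' i = 0) ->
  \sum_(i <- s) c i = \sum_(i <- s') c' i -> forall i, c i = c' i.
Proof.
move=> us us' Sc Sc' c0 c0' E i.
set t := undup (s ++ s').
have ut : uniq t by rewrite undup_uniq.
have st : {subset s <= t} by move=> j js; rewrite mem_undup mem_cat js.
have st' : {subset s' <= t} by move=> j js; rewrite mem_undup mem_cat js orbT.
have /eqP : \sum_(i <- t) c i = \sum_(i <- t) c' i.
  by rewrite (sum_widen us ut st c0) (sum_widen us' ut st' c0').
rewrite -subr_eq0 -sumrB => /eqP E0.
case it: (i \in t); last first.
  by move: it; rewrite mem_undup mem_cat => /negbT; rewrite negb_or => /andP[/c0-> /c0'->].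
have [_ _ /(_ t (fun j => c j - c' j) ut)] := dS.
move=> /(_ (fun j => subspaceB (sS j) (Sc j) (Sc' j)) E0 i it) /eqP.
by rewrite subr_eq0 => /eqP.
Qed.

Lemma is_componentP (s : seq I) (c : I -> V) i z : uniq s ->
  (forall i, S i (c i)) -> (forall i, i \notin s -> c i = 0) ->
  is_component S i (\sum_(i <- s) c i) z <-> z = c i.
Proof.
move=> us Sc c0; split.
  move=> [Sz [s' [c' [ins Sc' E]]]].
  have [c1 [Sc1 [c10 E1]]] := sum_regroup s' Sc'.
  pose d j := if j == i then z else c1 j.
  have := @direct_sum_eq s (i :: undup s') c d us.
  rewrite /= mem_undup ins undup_uniq => /(_ isT Sc) H; apply/esym.
  have -> : z = d i by rewrite /d eqxx.
  apply: H => //.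
  - by move=> j; rewrite /d; case: eqP => // ->.
  - move=> j; rewrite inE mem_undup negb_or /d => /andP[/negbTE-> ?]; exact: c10.
  - rewrite E E1 big_cons /d eqxx; congr (_ + _).
    rewrite big_seq [RHS]big_seq; apply: eq_bigr => j.
    by rewrite mem_undup; case: eqP ins => // -> /negbTE ->.
move=> ->; split=> //; exists (rem i s), c; split=> //.
  by rewrite mem_rem_uniq // inE eqxx.
case si: (i \in s); first by rewrite (big_rem _ si).
by rewrite c0 ?si // add0r rem_id ?si.
Qed.

Lemma componentE (s : seq I) (c : I -> V) i : uniq s ->
  (forall i, S i (c i)) -> (forall i, i \notin s -> c i = 0) ->
  component S i (\sum_(i <- s) c i) = c i.
Proof.
move=> us Sc c0; have := is_componentP _ _ us Sc c0; rewrite /component => H.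
case: xgetP => [z _ /H //|/(_ (c i)) []]; exact/H.
Qed.

Lemma componentP x i : is_component S i x (component S i x).
Proof.
have [s [c [us Sc c0 ->]]] := direct_sum_decomp x.
by rewrite componentE //; apply/is_componentP.
Qed.

Lemma component_uniq x i z : is_component S i x z -> component S i x = z.
Proof.
have [s [c [us Sc c0 ->]]] := direct_sum_decomp x.
by move=> /(is_componentP _ _ us Sc c0) ->; rewrite componentE.
Qed.

Lemma component_in x i : S i (component S i x).
Proof. by case: (componentP x i). Qed.

Lemma component_support x : exists s : seq I, [/\ uniq s,
   forall i, i \notin s -> component S i x = 0 &
   x = \sum_(i <- s) component S i x].
Proof.
have [s [c [us Sc c0 E]]] := direct_sum_decomp x.
have cE i : component S i x = c i by rewrite E componentE.
exists s; split=> // [i /c0|]; rewrite ?cE //.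
by rewrite {1}E; apply: eq_bigr => i _; rewrite cE.
Qed.

Lemma component_is_linear i : linear (component S i).
Proof.
move=> a x y.
have [s [us s0 Ex]] := component_support x.
have [t [ut t0 Ey]] := component_support y.
set r := undup (s ++ t).
have ur : uniq r by rewrite undup_uniq.
have sr : {subset s <= r} by move=> j js; rewrite mem_undup mem_cat js.
have tr : {subset t <= r} by move=> j js; rewrite mem_undup mem_cat js orbT.
have E : a *: x + y = \sum_(j <- r) (a *: component S j x + component S j y).
  rewrite big_split /= -scaler_sumr {1}Ex {1}Ey.
  by rewrite (sum_widen us ur sr s0) (sum_widen ut ur tr t0).
rewrite {1}E componentE // => j; first by case: (sS j) => _; apply; apply: component_in.
by rewrite mem_undup mem_cat negb_or => /andP[/s0-> /t0->]; rewrite scaler0 addr0.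
Qed.

HB.instance Definition _ i :=
  GRing.isLinear.Build K V V *:%R (component S i) (component_is_linear i).

Definition componentL i : {linear V -> V} := component S i.

Lemma component_id i x : S i x -> component S i x = x.
Proof.
move=> Sx; apply: component_uniq; split=> //; exists [::], (fun=> 0).
by rewrite big_nil addr0; split=> // j; apply: subspace0.
Qed.

Lemma component_neq i j x : S j x -> i != j -> component S i x = 0.
Proof.
move=> Sx ij; apply: component_uniq; split; first exact: subspace0.
exists [:: j], (fun k => if k == j then x else 0).
rewrite big_seq1 eqxx add0r inE ij; split=> // k.
by case: eqP => [->|_] //; apply: subspace0.
Qed.

Lemma component_homog i j x : S j x -> component S i x = (if i == j then x else 0).
Proof. by move=> Sx; case: eqP => [->|/eqP ij]; [exact: component_id | exact: component_neq Sx ij]. Qed.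

Lemma component_eq0 x : (forall i, component S i x = 0) -> x = 0.
Proof. by move=> H; have [s [_ _ ->]] := component_support x; rewrite big1. Qed.

Lemma component_inj x y : (forall i, component S i x = component S i y) -> x = y.
Proof.
move=> H; apply/eqP; rewrite -subr_eq0; apply/eqP/component_eq0 => i.
by rewrite linearB /= H subrr.
Qed.

Lemma component_commute (f : {linear V -> V}) :
  (forall i x, S i x -> S i (f x)) ->
  forall i x, component S i (f x) = f (component S i x).
Proof.
move=> Sf i x; have [s [us s0 E]] := component_support x.
rewrite {1}E linear_sum componentE // => j; first by apply: Sf; apply: component_in.
by move=> /s0 ->; rewrite linear0.
Qed.

Lemma homog_of_components x i :
  (forall j, j != i -> component S j x = 0) -> S i x.
Proof.
move=> H; have -> : x = component S i x.
  apply: component_inj => j; rewrite (component_homog j (component_in x i)).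
  by case: eqP => [->|/eqP /H].
exact: component_in.
Qed.

Lemma componentD i x y :
  component S i (x + y) = component S i x + component S i y.
Proof. exact: (linearD (componentL i)). Qed.

Lemma componentB i x y :
  component S i (x - y) = component S i x - component S i y.
Proof. exact: (linearB (componentL i)). Qed.

Lemma component0 i : component S i 0 = 0.
Proof. exact: (linear0 (componentL i)). Qed.

Lemma componentZ i a x : component S i (a *: x) = a *: component S i x.
Proof. by have := component_is_linear i a x 0; rewrite component0 !addr0. Qed.

Lemma component_sum i (J : Type) (r : seq J) (Q : pred J) (F : J -> V) :
  component S i (\sum_(j <- r | Q j) F j) = \sum_(j <- r | Q j) component S i (F j).
Proof. exact: (linear_sum (componentL i)). Qed.

End DirectSums.

Lemma graded_component (K : fieldType) (I : choiceType) (V : lmodType K)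
  (S : I -> set V) (P : set V) : direct_sum S -> graded_subspace S P ->
  forall i x, P x -> P (component S i x).
Proof. by move=> dS gP i x Px; apply: gP Px _; apply: componentP. Qed.

(** The [A]-components of [x] have further [B]-components; those outside the
    degree [j] of [x] add up to zero, so each vanishes. *)
Lemma component_graded (K : fieldType) (I J : choiceType) (V : lmodType K)
  (A : I -> set V) (B : J -> set V) : direct_sum A -> direct_sum B ->
  (forall i, graded_subspace B (A i)) ->
  forall i j x, B j x -> B j (component A i x).
Proof.
move=> dA dB gA i j x Bx; apply: (homog_of_components dB) => k kj.
have [s [us s0 E]] := component_support dA x.
have := component_neq dB Bx kj; rewrite {1}E linear_sum => E0.
case si: (i \in s); last by rewrite s0 ?si // linear0.
have [_ _ /(_ s (fun i => component B k (component A i x)) us)] := dA.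
move=> /(_ _ E0 _ si) -> // l.
apply: graded_component => //; exact: component_in.
Qed.

Section Coordinates.
Variables (K : fieldType) (I : choiceType) (P : pred I) (V : lmodType K).
Variables (b : I -> V).
Hypothesis bb : is_basis P b.

Let line i : set V := [set x | exists k, (~~ P i -> k = 0) /\ x = k *: b i].

Let line_sub i : subspace (line i).
Proof.
split; first by exists 0; rewrite scale0r.
move=> a _ _ [k [k0 ->]] [l [l0 ->]]; exists (a * k + l); split.
  by move=> Pi; rewrite k0 // l0 // mulr0 addr0.
by rewrite scalerA scalerDl.
Qed.

Let basis_free i k : P i -> k *: b i = 0 -> k = 0.
Proof.
move=> Pi E; have [_ /(_ [:: i] (fun=> k) isT)] := bb.
rewrite /= Pi big_seq1 => /(_ isT E i); apply; exact: mem_head.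
Qed.

Let line_direct : direct_sum line.
Proof.
split=> // [x|s c us Lc E i si].
  have [/(_ x)[s [c [Ps ->]]] _] := bb.
  exists s, (fun i => (if P i then c i else 0) *: b i); split.
    by move=> i; exists (if P i then c i else 0); split=> //; case: (P i).
  by rewrite big_seq [RHS]big_seq; apply: eq_bigr => i /(allP Ps) ->.
have [k kP] := choice Lc.
have E1 : \sum_(i <- filter P s) k i *: b i = 0.
  rewrite big_filter -[RHS]E [RHS](bigID P) /= [X in _ = _ + X]big1 ?addr0.
    by apply: eq_bigr => j _; have [_ ->] := kP j.
  by move=> j nPj; have [k0 ->] := kP j; rewrite k0 ?scale0r.
have [k0 ->] := kP i; case Pi: (P i); last by rewrite k0 ?Pi ?scale0r.
have [_ /(_ (filter P s) k)] := bb.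
rewrite filter_uniq // filter_all => /(_ isT isT E1 i) ->; first by rewrite scale0r.
by rewrite mem_filter Pi.
Qed.

(** A basis splits the space into lines, and the coordinates are the components
    along them; the lines at indices outside [P] are zero. *)
Lemma basis_coordinates : exists co : I -> {linear V -> K^o},
  (forall i j, P i -> P j -> co i (b j) = (i == j)%:R) /\
  forall x, exists s : seq I, [/\ uniq s, all P s,
     forall i, i \notin s -> co i x = 0 & x = \sum_(i <- s) co i x *: b i].
Proof.
have H i : exists f : {linear V -> K^o}, forall x, component line i x = f x *: b i /\ (~~ P i -> f x = 0).
  have [f fP] := choice (fun x => component_in line_direct x i).
  have fL : linear (f : V -> K^o).
    move=> a x y; case Pi: (P i); last first.
      by rewrite !(proj1 (fP _)) ?Pi // scaler0 addr0.
    apply/eqP; rewrite -subr_eq0; apply/eqP/(basis_free Pi).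
    have := component_is_linear line_direct i a x y.
    rewrite (proj2 (fP _)) (proj2 (fP x)) (proj2 (fP y)) => E.
    by rewrite scalerBl E scalerDl scalerA subrr.
  pose h := GRing.isLinear.Build K V K^o *:%R (f : V -> K^o) fL.
  pose F : {linear V -> K^o} := HB.pack (f : V -> K^o) h.
  by exists F => x; split; [exact: (proj2 (fP x)) | exact: (proj1 (fP x))].
have [co coP] := choice H; exists co; split.
  move=> i j Pi Pj; have [E _] := coP i (b j).
  have Lj : line j (b j) by exists 1; rewrite scale1r Pj.
  move: E; rewrite (component_homog line_direct i Lj).
  case: eqP => [-> E|_ /esym /(basis_free Pi) //].
  apply/eqP; rewrite -subr_eq0; apply/eqP/(basis_free Pj).
  by rewrite scalerBl -E scale1r subrr.
move=> x; have [s [us s0 E]] := component_support line_direct x.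
exists (filter P s); split; rewrite ?filter_uniq ?filter_all //.
  move=> i; case Pi: (P i); last by move=> _; have [_ ->] := coP i x; rewrite ?Pi.
  rewrite mem_filter Pi /= => /s0 E0.
  by apply: (basis_free Pi); rewrite -E0; have [->] := coP i x.
rewrite {1}E big_filter (bigID P) /= [X in _ + X]big1 ?addr0.
  by apply: eq_bigr => i _; have [->] := coP i x.
by move=> i nPi; have [-> ->] := coP i x; rewrite ?scale0r.
Qed.

End Coordinates.

(** A span has to be a type of its own for the universal property of a tensor
    product to apply to it. *)
Section SpanType.
Variables (K : fieldType) (V : lmodType K) (G : set V).

Definition span_pred : pred V := fun x => `[< lspan G x >].

Lemma span_submod : GRing.submod_closed span_pred.
Proof.
split; first by apply/asboolP; apply: subspace0; exact: lspan_subspace.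
move=> a x y /asboolP Gx /asboolP Gy; apply/asboolP.
by have [_] := lspan_subspace G; apply.
Qed.

HB.instance Definition _ := GRing.isSubmodClosed.Build K V span_pred span_submod.

Record span_type := SpanType { span_val : V; span_valP : span_val \in span_pred }.

HB.instance Definition _ := [isSub for span_val].
HB.instance Definition _ := [Choice of span_type by <:].
HB.instance Definition _ := [SubChoice_isSubLmodule of span_type by <:].

End SpanType.

Section TensorSpan.
Variables (K : fieldType) (V W T : lmodType K) (tens : V -> W -> T).
Hypothesis hT : is_tensor_product tens.

Lemma tensorDl x y w : tens (x + y) w = tens x w + tens y w.
Proof. by have [[H _] _] := hT; rewrite -[x]scale1r H !scale1r. Qed.

Lemma tensorDr v x y : tens v (x + y) = tens v x + tens v y.
Proof. by have [[_ H] _] := hT; rewrite -[x]scale1r H !scale1r. Qed.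

Lemma tensor0l w : tens 0 w = 0.
Proof. by apply: (addrI (tens 0 w)); rewrite -tensorDl !addr0. Qed.

Lemma tensor0r v : tens v 0 = 0.
Proof. by apply: (addrI (tens v 0)); rewrite -tensorDr !addr0. Qed.

Lemma tensorZl a x w : tens (a *: x) w = a *: tens x w.
Proof. by have [[H _] _] := hT; rewrite -[a *: x]addr0 H tensor0l addr0. Qed.

Lemma tensorZr a v x : tens v (a *: x) = a *: tens v x.
Proof. by have [[_ H] _] := hT; rewrite -[a *: x]addr0 H tensor0r addr0. Qed.

Lemma tensor_suml (J : Type) (r : seq J) (Q : pred J) (F : J -> V) w :
  tens (\sum_(j <- r | Q j) F j) w = \sum_(j <- r | Q j) tens (F j) w.
Proof.
by elim/big_rec2: _ => [|j y x _ <-]; rewrite ?tensor0l // tensorDl.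
Qed.

Lemma tensor_sumr (J : Type) (r : seq J) (Q : pred J) (F : J -> W) v :
  tens v (\sum_(j <- r | Q j) F j) = \sum_(j <- r | Q j) tens v (F j).
Proof.
by elim/big_rec2: _ => [|j y x _ <-]; rewrite ?tensor0r // tensorDr.
Qed.

Lemma tensor_ext (X : lmodType K) (f h : {linear T -> X}) :
  (forall v w, f (tens v w) = h (tens v w)) -> f =1 h.
Proof.
move=> E; have [[Hl Hr] /(_ X (fun v w => f (tens v w)))[]] := hT.
  by split=> [a x y w|a v x y]; rewrite ?Hl ?Hr linearP.
move=> g [_ gu]; have -> : f = g by apply/esym/gu.
by have -> : h = g by apply/esym/gu => v w; rewrite E.
Qed.

(** Elementary tensors span: composing the inclusion of their span with the map
    into it given by the universal property fixes all elementary tensors, so it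
    is the identity. *)
Lemma tensor_span z : lspan [set z | exists v w, z = tens v w] z.
Proof.
set G := (X in lspan X).
have GP v w : tens v w \in span_pred G.
  by apply/asboolP; apply: lspan_gen; exists v, w.
have [_ /(_ (span_type G) (fun v w => SpanType (GP v w)))[]] := hT.
  by split=> *; apply: val_inj; rewrite /= ?tensorDl ?tensorZl ?tensorDr ?tensorZr.
move=> g [gP _].
pose f : {linear T -> T} := (\val : {linear span_type G -> T}) \o g.
have -> : z = f z.
  by rewrite (@tensor_ext _ f idfun) // => v w /=; rewrite gP.
by have /asboolP := span_valP (g z).
Qed.

Lemma tensor_ind (P : set T) : subspace P -> (forall v w, P (tens v w)) ->
  forall z, P z.
Proof.
move=> sP PT z; apply: (lspan_min sP) (tensor_span z) => _ [v [w ->]]; exact: PT.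
Qed.

Lemma tensor_lin (f : {linear W -> K^o}) : exists g : {linear T -> V},
  forall v w, g (tens v w) = (f w : K) *: v.
Proof.
have [_ /(_ V (fun v w => (f w : K) *: v))[]] := hT.
  split=> [a x y w|a v x y].
    by rewrite scalerDr !scalerA mulrC.
  by rewrite linearP scalerDl -scalerA.
by move=> g [gP _]; exists g.
Qed.

End TensorSpan.

(** * Modes and the associated graded operations *)

Lemma fsum_ext (V : zmodType) (I : choiceType) (A : set I) (F G : I -> V) :
  (forall i, A i -> F i = G i) -> \sum_(i \in A) F i = \sum_(i \in A) G i.
Proof. by move=> FG; apply: eq_fsbigr => i /set_mem; apply: FG. Qed.

Section Modes.
Variables (R : realType) (V : vertexAlgebra R).
Local Notation C := R[i].
Implicit Types (x y z : V) (n m : int).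

Lemma mode_linearr x n : linear (mode x n : V -> V).
Proof. by move=> a y z; have [_ ->] := mode_bilinear V n. Qed.

HB.instance Definition _ x n :=
  GRing.isLinear.Build C V V *:%R (mode x n) (mode_linearr x n).

Definition modeL x n : {linear V -> V} := mode x n.

Definition modeRf n y : V -> V := fun x => mode x n y.

Lemma mode_linearl n y : linear (modeRf n y).
Proof. by move=> a x z; rewrite /modeRf; have [-> _] := mode_bilinear V n. Qed.

HB.instance Definition _ n y :=
  GRing.isLinear.Build C V V *:%R (modeRf n y) (mode_linearl n y).

Definition modeR n y : {linear V -> V} := modeRf n y.

Lemma modeDr x n y z : mode x n (y + z) = mode x n y + mode x n z.
Proof. exact: linearD. Qed.
Lemma modeBr x n y z : mode x n (y - z) = mode x n y - mode x n z.
Proof. exact: linearB. Qed.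
Lemma mode0r x n : mode x n 0 = 0.
Proof. exact: linear0. Qed.
Lemma modeZr x n a y : mode x n (a *: y) = a *: mode x n y.
Proof. exact: (linearZ_LR (modeL x n)). Qed.
Lemma mode_sumr x n (J : Type) (r : seq J) (Q : pred J) (F : J -> V) :
  mode x n (\sum_(j <- r | Q j) F j) = \sum_(j <- r | Q j) mode x n (F j).
Proof. exact: linear_sum. Qed.

Lemma modeDl x n y z : mode (y + z) n x = mode y n x + mode z n x.
Proof. exact: (linearD (modeR n x)). Qed.
Lemma mode0l x n : mode 0 n x = 0.
Proof. exact: (linear0 (modeR n x)). Qed.
Lemma modeNl x n y : mode (- y) n x = - mode y n x.
Proof. exact: (linearN (modeR n x)). Qed.
Lemma modeZl x n a y : mode (a *: y) n x = a *: mode y n x.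
Proof. exact: (linearZ_LR (modeR n x)). Qed.
Lemma mode_suml x n (J : Type) (r : seq J) (Q : pred J) (F : J -> V) :
  mode (\sum_(j <- r | Q j) F j) n x = \sum_(j <- r | Q j) mode (F j) n x.
Proof. exact: (linear_sum (modeR n x)). Qed.

Lemma par_sub b : subspace (@par R V b).
Proof. by case: (par_direct V). Qed.

Lemma par_ind (P : set V) : subspace P -> (forall b x, par b x -> P x) ->
  forall x, P x.
Proof.
move=> sP PP x; have [s [_ _ ->]] := component_support (par_direct V) x.
apply: subspace_sum => // b _; apply: (PP b); exact: component_in (par_direct V) _ _.
Qed.

Lemma commutator a b x y z m n : par a x -> par b y ->
  mode x m (mode y n z) - (-1) ^+ (a && b) *: mode y n (mode x m z) =
  \sum_(j \in [set: nat]) (binz m j)%:~R *: mode (mode x j%:Z y) (m + n - j%:Z) z.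
Proof.
move=> xa yb; have := va_borcherds z 0 m n xa yb.
under fsum_ext do rewrite add0r.
move=> ->; rewrite (@fsum_single _ _ 0%N); last first.
  by move=> [|j] //= _; rewrite bin0n /= mulr0 scale0r.
by rewrite /= bin0 expr0 mul1r scale1r !addr0 expr0z mul1r.
Qed.

(** The case m = 0 of the commutator formula: zero modes of even vectors are
    derivations of all products. *)
Lemma even_zero_mode x y z n : par false x ->
  mode x 0 (mode y n z) = mode (mode x 0 y) n z + mode y n (mode x 0 z).
Proof.
move=> xa; pose P := [set y | mode x 0 (mode y n z) =
  mode (mode x 0 y) n z + mode y n (mode x 0 z)].
apply: (@par_ind P) => [|b {}y yb].
  split=> [|a u v Pu Pv]; rewrite /P /=; first by rewrite !(mode0l, mode0r) addr0.
  rewrite !modeDl !modeZl !(modeDr, modeZr) Pu Pv !(modeDl, modeZl) scalerDr.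
  by rewrite !addrA; congr (_ + _); rewrite -!addrA; congr (_ + _); rewrite addrC.
have := commutator z 0 n xa yb; rewrite /= expr0 scale1r.
rewrite (@fsum_single _ _ 0%N); last by move=> [|j] //= _; rewrite scale0r.
by rewrite scale1r add0r subr0 => /eqP; rewrite subr_eq => /eqP.
Qed.

(** Modes of [x_(-1) y], from the Borcherds identity with first index -1. *)
Lemma iterate a b x y z n : par a x -> par b y ->
  mode (mode x (-1) y) n z = \sum_(j \in [set: nat])
    (mode x (- j.+1%:Z) (mode y (n + j%:Z) z) +
     (-1) ^+ (a && b) *: mode y (n - j.+1%:Z) (mode x j%:Z z)).
Proof.
move=> xa yb; have := va_borcherds z (-1) 0 n xa yb.
rewrite (@fsum_single _ _ 0%N); last by move=> [|j] //= _; rewrite scale0r.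
rewrite /= scale1r !add0r addr0 subr0 => ->.
apply: fsum_ext => j _.
rewrite binn mulr1 rmorphXn /= rmorphN1 -exprMn mulrNN mulr1 expr1n scale1r add0r.
rewrite (_ : (-1 : R[i]) ^ (-1 : int) = -1); last by rewrite exprN1 invrN1.
have E (k : int) : k - 1 - j%:Z = k - j.+1%:Z by rewrite -addrA -opprD.
by rewrite mulN1r scaleNr opprK E -[-1 - j%:Z]add0r addrA E add0r.
Qed.

End Modes.

Section AssociatedGraded.
Variables (R : realType) (V : vertexAlgebra R) (t : trigrading V).
Hypothesis dR : direct_sum (tri_R t).

(** The sum over pairs of charges is finite, over any lists containing the
    charges that occur; this is what makes the operation bilinear. *)
Lemma gr_modeE n k x y (s s' : seq int) : uniq s -> uniq s' ->
  (forall p, p \notin s -> component (tri_R t) p x = 0) ->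
  (forall p, p \notin s' -> component (tri_R t) p y = 0) ->
  gr_mode t n k x y = \sum_(p <- s) \sum_(q <- s')
     component (tri_R t) (p + q + k)
       (mode (component (tri_R t) p x) n (component (tri_R t) q y)).
Proof.
move=> us us' s0 s0'; rewrite /gr_mode (@fsum_seqT _ _ [seq (p, q) | p <- s, q <- s']).
- by rewrite big_allpairs_dep /=.
- by apply: allpairs_uniq => // -[? ?] [? ?] _ _.
move=> [p q] /= /allpairsP H; case sp: (p \in s); last first.
  by rewrite s0 ?sp // mode0l component0.
case sq: (q \in s'); last by rewrite s0' ?sq // mode0r component0.
by case: H; exists (p, q).
Qed.

Lemma common_support (x y : V) : exists s : seq int, [/\ uniq s,
  forall p, p \notin s -> component (tri_R t) p x = 0 &
  forall p, p \notin s -> component (tri_R t) p y = 0].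
Proof.
have [s [us s0 _]] := component_support dR x.
have [s' [us' s0' _]] := component_support dR y.
exists (undup (s ++ s')); rewrite undup_uniq; split=> // p;
  by rewrite mem_undup mem_cat negb_or => /andP[? ?]; rewrite ?s0 ?s0'.
Qed.

Lemma gr_mode_linearl n k y : linear (fun x => gr_mode t n k x y).
Proof.
move=> a x x'; have [s [us s0 s1]] := common_support x x'.
have [s' [us' s0' _]] := component_support dR y.
have s2 p : p \notin s -> component (tri_R t) p (a *: x + x') = 0.
  by move=> ps; rewrite componentD // componentZ // s0 // s1 // scaler0 addr0.
rewrite !(gr_modeE n k us us') // scaler_sumr -big_split /=; apply: eq_bigr => p _.
rewrite scaler_sumr -big_split /=; apply: eq_bigr => q _.
by rewrite componentD // componentZ // modeDl modeZl componentD // componentZ.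
Qed.

Lemma gr_mode_linearr n k x : linear (gr_mode t n k x : V -> V).
Proof.
move=> a y y'; have [s' [us' s0' s1']] := common_support y y'.
have [s [us s0 _]] := component_support dR x.
have s2 p : p \notin s' -> component (tri_R t) p (a *: y + y') = 0.
  by move=> ps; rewrite componentD // componentZ // s0' // s1' // scaler0 addr0.
rewrite !(gr_modeE n k us us') // scaler_sumr -big_split /=; apply: eq_bigr => p _.
rewrite scaler_sumr -big_split /=; apply: eq_bigr => q _.
by rewrite componentD // componentZ // modeDr modeZr componentD // componentZ.
Qed.

Lemma gr_mode_homog n k p q x y : tri_R t p x -> tri_R t q y ->
  gr_mode t n k x y = component (tri_R t) (p + q + k) (mode x n y).
Proof.
move=> xp yq; rewrite (@gr_modeE _ _ _ _ [:: p] [:: q]) //.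
- by rewrite !big_seq1 (component_id dR xp) (component_id dR yq).
- by move=> r; rewrite inE => rp; rewrite (component_neq dR xp).
- by move=> r; rewrite inE => rp; rewrite (component_neq dR yq).
Qed.

Lemma gr_operatorE k Q x (s : seq int) : uniq s -> Q 0 = 0 ->
  (forall p, p \notin s -> component (tri_R t) p x = 0) ->
  gr_operator t k Q x = \sum_(p <- s)
     component (tri_R t) (p + k) (Q (component (tri_R t) p x)).
Proof.
move=> us Q0 s0; rewrite /gr_operator (@fsum_seqT _ _ s) // => p ps.
by rewrite s0 // Q0 component0.
Qed.

Lemma gr_operator_linear k (Q : {linear V -> V}) : linear (gr_operator t k Q).
Proof.
move=> a x x'; have [s [us s0 s1]] := common_support x x'.
have s2 p : p \notin s -> component (tri_R t) p (a *: x + x') = 0.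
  by move=> ps; rewrite componentD // componentZ // s0 // s1 // scaler0 addr0.
rewrite !(gr_operatorE k us) ?linear0 // scaler_sumr -big_split /=.
apply: eq_bigr => p _.
by rewrite componentD // componentZ // linearP componentD // componentZ.
Qed.

Lemma gr_operator_homog k (Q : V -> V) p x : Q 0 = 0 -> tri_R t p x ->
  gr_operator t k Q x = component (tri_R t) (p + k) (Q x).
Proof.
move=> Q0 xp; rewrite (@gr_operatorE _ _ _ [:: p]) ?big_seq1 ?(component_id dR xp) //.
by move=> r; rewrite inE => rp; rewrite (component_neq dR xp).
Qed.

End AssociatedGraded.

(** * Forms on finite-dimensional subspaces *)

Section FiniteDimension.
Variables (K : fieldType) (V : lmodType K).

Let tail n (e : 'I_n.+1 -> V) (i : 'I_n) : V := e (lift ord0 i).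

Let comb n (e : 'I_n -> V) : set V := [set x | exists c : 'I_n -> K, x = \sum_i c i *: e i].

Let comb_sub n (e : 'I_n -> V) : subspace (comb e).
Proof.
split; first by exists (fun=> 0); rewrite big1 // => i _; rewrite scale0r.
move=> a _ _ [c ->] [d ->]; exists (fun i => a * c i + d i).
rewrite scaler_sumr -big_split; apply: eq_bigr => i _.
by rewrite scalerDl scalerA.
Qed.

Let combS n (e : 'I_n.+1 -> V) x : comb e x ->
  exists c y, comb (tail e) y /\ x = c *: e ord0 + y.
Proof.
move=> [c ->]; exists (c ord0), (\sum_i c (lift ord0 i) *: tail e i).
by split; [exists (fun i => c (lift ord0 i)) | rewrite big_ord_recl].
Qed.

(** In finite dimension a decreasing chain of subspaces with zero intersection
    reaches zero: a chain of nonzero subspaces becomes stationary. *)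
Lemma chain_stops n (e : 'I_n -> V) (W : nat -> set V) :
  (forall k, subspace (W k)) -> (forall k, W k.+1 `<=` W k) ->
  (forall x, W 0%N x -> exists c : 'I_n -> K, x = \sum_i c i *: e i) ->
  (forall x, (forall k, W k x) -> x = 0) ->
  exists k, forall x, W k x -> x = 0.
Proof.
elim: n e W => [|n IH] e W sW dW We W0.
  by exists 0%N => x /We [c ->]; rewrite big_ord0.
have mW k l : (k <= l)%N -> W l `<=` W k.
  by move=> /subnK <-; elim: (l - k)%N => // m IHm x /dW /IHm.
have [||||k0 k0P] := IH (tail e) (fun k => W k `&` comb (tail e)).
- by move=> k; apply: subspaceI.
- by move=> k x [/dW ? ?].
- by move=> x [].
- by move=> x H; apply: W0 => k; have [] := H k.
apply: contrapT => nz.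
have nzk k : exists x, W k x /\ x != 0.
  apply: contrapT => H; apply: nz; exists k => x Wx; apply/eqP/negPn/negP => x0.
  by apply: H; exists x.
have [w [Ww /eqP w0]] := nzk k0; apply: (w0).
have Wc k x : W k x -> exists c y, comb (tail e) y /\ x = c *: e ord0 + y.
  by move=> /(mW 0%N k (leq0n k)) /We /combS.
have [c [y [ty Ew]]] := Wc _ _ Ww.
have c0 : c != 0.
  apply/eqP => c0; apply: w0; apply: k0P; split=> //.
  by rewrite Ew c0 scale0r add0r.
apply: W0 => k; have [lt_k|le_k] := ltnP k k0; first exact: (mW _ _ (ltnW lt_k)).
have [v [Wv v0]] := nzk k; have [d [z [tz Ev]]] := Wc _ _ Wv.
have E : c *: v - d *: w = 0.
  apply: k0P; split.
    apply: subspaceB; [exact: sW|apply: subspaceZ => //|exact: subspaceZ].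
    exact: (mW _ _ le_k).
  rewrite Ew Ev !scalerDr !scalerA [d * c]mulrC opprD addrACA subrr add0r.
  by apply: subspaceB; [exact: comb_sub|apply: subspaceZ => //; exact: comb_sub|apply: subspaceZ => //; exact: comb_sub].
have d0 : d != 0.
  apply: contraNneq v0 => d0; move/eqP: E.
  by rewrite d0 scale0r subr0 scaler_eq0 (negbTE c0).
have -> : w = (d^-1 * c) *: v.
  by move/eqP: E; rewrite subr_eq0 -scalerA => /eqP ->; rewrite scalerA mulVf // scale1r.
exact: subspaceZ.
Qed.

(** The given spanning vectors need not belong to the subspace; generators
    inside it are found by induction, adding one whenever the first coordinate is
    not identically zero. *)
Lemma subspace_generators n (e : 'I_n -> V) (W : set V) : subspace W ->
  (forall x, W x -> exists c : 'I_n -> K, x = \sum_i c i *: e i) ->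
  exists m (w : 'I_m -> V), (forall i, W (w i)) /\
    forall x, W x -> exists c : 'I_m -> K, x = \sum_i c i *: w i.
Proof.
elim: n e W => [|n IH] e W sW We.
  exists 0%N, (fun=> 0); split=> [i|x /We [c ->]]; first exact: subspace0.
  by exists (fun=> 0); rewrite !big_ord0.
have [||m [w [Ww wP]]] := IH (tail e) (W `&` comb (tail e)).
- exact: subspaceI.
- by move=> x [].
case: (pselect (exists c y, [/\ c != 0, comb (tail e) y & W (c *: e ord0 + y)])); last first.
  move=> H; exists m, w; split=> [i|x Wx]; first by have [] := Ww i.
  apply: wP; split=> //; have [c [y [ty Ex]]] := combS (We x Wx).
  case: (eqVneq c 0) => [c0|c0]; first by rewrite Ex c0 scale0r add0r.
  by case: H; exists c, y; rewrite -Ex.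
move=> [c [y [c0 ty Wv]]]; set v := _ + _ in Wv.
exists m.+1, (fun i => if unlift ord0 i is Some j then w j else v); split.
  by move=> i; case: unliftP => // j _; have [] := Ww j.
move=> x Wx; have [d [z [tz Ex]]] := combS (We x Wx).
have [|a Ea] := wP (x - (d / c) *: v).
  split; first by apply: subspaceB => //; apply: subspaceZ.
  rewrite Ex /v scalerDr scalerA divfK // opprD addrACA subrr add0r.
  by apply: subspaceB; [exact: comb_sub| |apply: subspaceZ => //; exact: comb_sub].
exists (fun i => if unlift ord0 i is Some j then a j else d / c).
rewrite big_ord_recl unlift_none; under eq_bigr do rewrite liftK.
by rewrite -Ea addrC subrK.
Qed.

(** Orthogonal projection: a form nondegenerate on a finite-dimensional subspace
    represents every functional on it, because the Gram matrix of a generating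
    family has no more relations among its columns than the family itself. *)
Lemma nondegenerate_projection (W : set V) (B : V -> V -> K) : subspace W ->
  finite_dimensional W ->
  (forall a x y v, B (a *: x + y) v = a * B x v + B y v) ->
  (forall a u x y, B u (a *: x + y) = a * B u x + B u y) ->
  (forall x, W x -> (forall y, W y -> B y x = 0) -> x = 0) ->
  forall x, exists2 x', W x' & forall y, W y -> B x' y = B x y.
Proof.
move=> sW [n [e We]] Bl Br nd x.
have [m [w [Ww wP]]] := subspace_generators sW We.
have B0l v : B 0 v = 0.
  by apply: (addrI (B 0 v)); rewrite -[X in X + _ = _]mul1r -Bl scaler0 !addr0.
have B0r v : B v 0 = 0.
  by apply: (addrI (B v 0)); rewrite -[X in X + _ = _]mul1r -Br scaler0 !addr0.
have Bsl (c : 'I_m -> K) v : B (\sum_i c i *: w i) v = \sum_i c i * B (w i) v.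
  by elim/big_rec2: _ => // i a b _ <-; rewrite Bl.
have Bsr (c : 'I_m -> K) v : B v (\sum_i c i *: w i) = \sum_i c i * B v (w i).
  by elim/big_rec2: _ => // i a b _ <-; rewrite Br.
pose G : 'M[K]_m := \matrix_(i, j) B (w i) (w j).
pose phi : 'rV[K]_m := \row_j B x (w j).
have /submxP[c Ec] : (phi <= G)%MS.
  rewrite submxE; apply/eqP/rowP => j; rewrite !mxE.
  have Gk : G *m cokermx G = 0 by rewrite mulmx_coker.
  have v0 : \sum_i cokermx G i j *: w i = 0.
    apply: nd; first by apply: subspace_sum => // i _; apply: subspaceZ.
    move=> _ /wP [c ->]; rewrite Bsl big1 // => i _.
    have /matrixP /(_ i j) := Gk; rewrite !mxE Bsr => E.
    rewrite (_ : \sum_i0 _ = 0) ?mulr0 // -[RHS]E.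
    by apply: eq_bigr => k _; rewrite !mxE mulrC.
  rewrite -[RHS](B0r x) -[in RHS]v0 Bsr; apply: eq_bigr => i _.
  by rewrite !mxE mulrC.
exists (\sum_i c 0 i *: w i); first by apply: subspace_sum => // i _; apply: subspaceZ.
move=> _ /wP [d ->]; rewrite Bsr [RHS]Bsr; apply: eq_bigr => j _; congr (_ * _).
have /rowP /(_ j) := Ec; rewrite !mxE => ->; rewrite Bsl.
by apply: eq_bigr => i _; rewrite !mxE.
Qed.

End FiniteDimension.

(** * The charge grading of a graded-unitary vertex algebra *)

Lemma oddz_le_step (p q : int) : oddz p = oddz q -> p < q -> p <= q - 2.
Proof. by rewrite /oddz => H; lia. Qed.

Lemma oddz_eq_step (p q : int) : oddz p = oddz q -> q <= p ->
  exists k : nat, p = q + 2 * k%:Z.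
Proof. by rewrite /oddz => H L; exists (`|p - q|./2)%N; lia. Qed.

Lemma seq_int_max (s : seq int) : s != [::] ->
  exists2 p, p \in s & forall q, q \in s -> q <= p.
Proof.
elim: s => // p s IH _; case: (eqVneq s [::]) => [->|/IH [q qs qM]].
  by exists p => [|q]; rewrite ?mem_head // inE => /eqP ->.
have [le|lt] := leP q p.
  exists p => [|r]; first exact: mem_head.
  by rewrite inE => /orP[/eqP ->//|/qM /le_trans]; apply.
exists q => [|r]; first by rewrite inE qs orbT.
by rewrite inE => /orP[/eqP ->|/qM //]; apply: ltW.
Qed.

Lemma direct_sum_intro (K : fieldType) (I : choiceType) (V : lmodType K)
    (S : I -> set V) : (forall i, subspace (S i)) ->
  (forall x, lspan [set x | exists i, S i x] x) ->
  (forall (s : seq I) (c : I -> V), uniq s -> (forall i, S i (c i)) ->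
        \sum_(i <- s) c i = 0 -> forall i, i \in s -> c i = 0) ->
  direct_sum S.
Proof.
move=> sS gen ind; split=> // x.
pose P x := exists (s : seq I) (c : I -> V), [/\ uniq s, forall i, S i (c i),
   forall i, i \notin s -> c i = 0 & x = \sum_(i <- s) c i].
suff [s [c [_ Sc _ Ex]]] : P x by exists s, c.
apply: lspan_min (gen x); last first.
  move=> y [i Sy]; exists [:: i], (fun j => if j == i then y else 0).
  rewrite big_seq1 eqxx; split=> // j; last by rewrite inE => /negbTE ->.
  by case: eqP => [->|_] //; apply: subspace0.
split; first by exists [::], (fun=> 0); rewrite big_nil; split=> // i; apply: subspace0.
move=> a _ _ [s [c [us Sc c0 ->]]] [t [d [ut Sd d0 ->]]].
have ur : uniq (undup (s ++ t)) by exact: undup_uniq.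
have sr : {subset s <= undup (s ++ t)} by move=> j js; rewrite mem_undup mem_cat js.
have tr : {subset t <= undup (s ++ t)} by move=> j js; rewrite mem_undup mem_cat js orbT.
exists (undup (s ++ t)), (fun i => a *: c i + d i); split=> // [i|i|].
- by have [_] := sS i; apply.
- by rewrite mem_undup mem_cat negb_or => /andP[/c0-> /d0->]; rewrite scaler0 addr0.
by rewrite big_split -scaler_sumr /= (sum_widen us ur sr c0) (sum_widen ut ur tr d0).
Qed.

(** If a form pairs each graded piece with only one other, the projections are
    adjoint to each other. *)
Lemma form_component (K : fieldType) (V : lmodType K) (S : int -> set V)
    (B : V -> V -> K) (nu : int -> int) : direct_sum S -> involutive nu ->
  (forall a x y v, B (a *: x + y) v = a * B x v + B y v) ->
  (forall a u x y, B u (a *: x + y) = a * B u x + B u y) ->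
  (forall d e x y, S d x -> S e y -> e != nu d -> B x y = 0) ->
  forall d x y, B (component S d x) y = B x (component S (nu d) y).
Proof.
move=> dS nuK Bl Br B0 d x y.
have B0l v : B 0 v = 0.
  by apply: (addrI (B 0 v)); rewrite -[X in X + _ = _]mul1r -Bl scaler0 !addr0.
have B0r v : B v 0 = 0.
  by apply: (addrI (B v 0)); rewrite -[X in X + _ = _]mul1r -Br scaler0 !addr0.
have Bsl s (c : int -> V) v : B (\sum_(i <- s) c i) v = \sum_(i <- s) B (c i) v.
  by elim/big_rec2: _ => // i a b _ <-; rewrite -[c i]scale1r Bl mul1r scale1r.
have Bsr s (c : int -> V) v : B v (\sum_(i <- s) c i) = \sum_(i <- s) B v (c i).
  by elim/big_rec2: _ => // i a b _ <-; rewrite -[c i]scale1r Br mul1r scale1r.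
have cS z e : S e (component S e z) by exact: component_in.
transitivity (B (component S d x) (component S (nu d) y)).
  have [s [us s0 {1}->]] := component_support dS y; rewrite Bsr.
  rewrite -(@fsum_seqT _ _ s) ?(@fsum_single _ _ (nu d)) //.
    by move=> e; apply: B0.
  by move=> e /s0 ->.
have [s [us s0 {2}->]] := component_support dS x; rewrite Bsl.
rewrite -(@fsum_seqT _ _ s) ?(@fsum_single _ _ d) //.
  by move=> e ed; apply: B0 => //; rewrite (inj_eq (inv_inj nuK)) eq_sym.
by move=> e /s0 ->.
Qed.

Section GradedUnitary.
Variables (R : realType) (V : vertexAlgebra R) (U : gradedUnitary V).
Local Notation C := R[i].
Local Notation B := (Defs.form U).
Local Notation F := (filt U).

Lemma formPl a x y v : B (a *: x + y) v = a * B x v + B y v.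
Proof. by have [H _ _ _] := form_inv U. Qed.

Lemma formPr a u x y : B u (a *: x + y) = a * B u x + B u y.
Proof. by have [_ H _ _] := form_inv U. Qed.

Lemma form0l v : B 0 v = 0.
Proof. by apply: (addrI (B 0 v)); rewrite -[X in X + _ = _]mul1r -formPl scaler0 !addr0. Qed.

Lemma form0r v : B v 0 = 0.
Proof. by apply: (addrI (B v 0)); rewrite -[X in X + _ = _]mul1r -formPr scaler0 !addr0. Qed.

Lemma formDl x y v : B (x + y) v = B x v + B y v.
Proof. by rewrite -[x]scale1r formPl mul1r scale1r. Qed.
Lemma formZl a x v : B (a *: x) v = a * B x v.
Proof. by rewrite -[a *: x]addr0 formPl form0l addr0. Qed.
Lemma formZr a x v : B v (a *: x) = a * B v x.
Proof. by rewrite -[a *: x]addr0 formPr form0r addr0. Qed.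

Lemma wt_subspace h : subspace (wt U h).
Proof. by case: (wt_direct U). Qed.

Lemma filt_subspace p : subspace (F p).
Proof. by have [_ /(_ p)[]] := filt_good U. Qed.

Lemma filt_mono p (k : nat) x : F p x -> F (p + 2 * k%:Z) x.
Proof.
elim: k => [|k IH] Fx; first by rewrite mulr0 addr0.
have [_ /(_ (p + 2 * k%:Z))[_ /(_ _ (IH Fx)) [_ H]] _ _ _] := filt_good U.
by rewrite (_ : _ + _ = p + 2 * k%:Z + 2) //; lia.
Qed.

Lemma filt_mode p q x y n : F p x -> F q y -> F (p + q) (mode x n y).
Proof. by move=> Fx Fy; have [_ _ _ _ /(_ _ _ _ _ n Fx Fy)[]] := filt_good U. Qed.

Lemma filt_mode_ge0 p q x y n : 0 <= n -> F p x -> F q y ->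
  F (p + q - 2) (mode x n y).
Proof. by move=> n0 Fx Fy; have [_ _ _ _ /(_ _ _ _ _ n Fx Fy)[_]] := filt_good U; apply. Qed.

Lemma filt_vac : F 0 (vac V).
Proof. by case: (filt_good U). Qed.

Lemma form_wt h k x y : wt U h x -> wt U k y -> k != h -> B x y = 0.
Proof.
move=> xh yk kh; have [_ _ _ /(_ 0 x y isT)] := form_inv U.
rewrite oppr0 (L0_wt xh) (L0_wt yk) formZl formZr => /eqP.
rewrite -subr_eq0 -mulrBl mulf_eq0 -mulrBl mulf_eq0 invr_eq0 pnatr_eq0 orbF.
by rewrite -intrB intr_eq0 subr_eq0 eq_sym (negbTE kh) => /eqP.
Qed.

Lemma form_component_wt h x y :
  B (component (wt U) h x) y = B x (component (wt U) h y).
Proof.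
apply: (form_component (nu := id) (wt_direct U)) => //.
- exact: formPl.
- exact: formPr.
- exact: form_wt.
Qed.

Lemma Rcharge_subspace p : subspace (Rcharge U p).
Proof.
split; first by split=> [|y _]; [exact: subspace0 (filt_subspace p)|rewrite form0l].
move=> a x y [Fx Bx] [Fy By]; split; first by have [_] := filt_subspace p; apply.
by move=> z Fz; rewrite formPl Bx // By // mulr0 addr0.
Qed.

Let wt_filt_component p h x : F p x -> F p (component (wt U) h x).
Proof. by apply: graded_component; [exact: wt_direct | exact: filt_wt]. Qed.

Lemma Rcharge_wt p : graded_subspace (wt U) (Rcharge U p).
Proof.
move=> x h z [Fx Bx] /(component_uniq (wt_direct U)) <-; split.
  exact: wt_filt_component.
by move=> y Fy; rewrite form_component_wt Bx //; exact: wt_filt_component.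
Qed.

(** Inside a weight space the filtration reaches zero, being separated and of
    finite dimension; climbing up from there, each step splits off the orthogonal
    complement. *)
Lemma Rcharge_generate h p x : wt U h x -> F p x ->
  lspan [set x | exists2 q, q <= p & Rcharge U q x] x.
Proof.
move=> xh xp; set G := lspan _.
have sG : subspace G by exact: lspan_subspace.
pose W (k : nat) := F (p - 2 * k%:Z) `&` wt U h.
have sW k : subspace (W k).
  by apply: subspaceI; [exact: filt_subspace|exact: wt_subspace].
have Wdown k : W k.+1 `<=` W k.
  move=> y [Fy hy]; split=> //; have := filt_mono 1 Fy.
  by rewrite (_ : _ + _ = p - 2 * k%:Z) //; lia.
have [n [e We]] := wt_fin U h.
have [||k0 k0P] := chain_stops (e := e) sW Wdown.
- by move=> y [_ /We].
- move=> y Wy; apply: (filt_sep (g := U) (e := oddz p)) => q Eq.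
  have [lt|le] := ltP q p.
    have [k Ek] := oddz_eq_step (esym Eq) (ltW lt).
    by have [] := Wy k; rewrite Ek addrK.
  have [k ->] := oddz_eq_step Eq le.
  by apply: filt_mono; have [] := Wy 0%N; rewrite mulr0 subr0.
(* Induction upwards along the filtration, from the index k0 where it is zero. *)
have H j : (j <= k0)%N -> forall y, W (k0 - j)%N y -> G y.
  elim: j => [|j IH] jk y Wy.
    by rewrite subn0 in Wy; rewrite (k0P y Wy); exact: subspace0.
  set i := (k0 - j.+1)%N in Wy; have Ei : (k0 - j)%N = i.+1 by rewrite /i; lia.
  have fdW : finite_dimensional (W i.+1) by exists n, e => z [_ /We].
  have red z : wt U h z -> (forall u, W i.+1 u -> B z u = 0) ->
      forall u, F (p - 2 * i.+1%:Z) u -> B z u = 0.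
    move=> zh z0 u Fu; rewrite -(component_id (wt_direct U) zh) form_component_wt z0 //.
    by split; [exact: wt_filt_component|exact: component_in (wt_direct U) _ _].
  have redl z : wt U h z -> (forall u, W i.+1 u -> B u z = 0) ->
      forall u, F (p - 2 * i.+1%:Z) u -> B u z = 0.
    move=> zh z0 u Fu; rewrite -(component_id (wt_direct U) zh) -form_component_wt z0 //.
    by split; [exact: wt_filt_component|exact: component_in (wt_direct U) _ _].
  have [z [Fz zh] zB] : exists2 z, W i.+1 z & forall u, W i.+1 u -> B z u = B y u.
    apply: (nondegenerate_projection (sW i.+1) fdW formPl formPr) => z [Fz zh] Bz.
    by have [_] := filt_nondeg U (p - 2 * i.+1%:Z); apply=> //; apply: redl.
  have [Fy yh] := Wy.
  rewrite -[y](subrK z); apply: subspaceD => //; last first.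
    by apply: (IH (ltnW jk)); rewrite Ei.
  apply: lspan_gen; exists (p - 2 * i%:Z); [by lia|split].
    by apply: subspaceB => //; [exact: filt_subspace|have [] := Wdown i z (conj Fz zh)].
  have -> : p - 2 * i%:Z - 2 = p - 2 * i.+1%:Z by lia.
  apply: red; first by apply: subspaceB => //; exact: wt_subspace.
  by move=> u Wu; rewrite -scaleN1r addrC formPl zB // mulN1r addrC subrr.
by apply: (H k0) => //; rewrite subnn /W mulr0 subr0.
Qed.

Lemma filt_span p x : F p x ->
  lspan [set x | exists2 q, q <= p & Rcharge U q x] x.
Proof.
move=> Fx; have [r [_ _ ->]] := component_support (wt_direct U) x.
apply: subspace_sum => [|h _]; first exact: lspan_subspace.
apply: (@Rcharge_generate h p); first exact: component_in (wt_direct U) _ _.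
exact: wt_filt_component.
Qed.

(** Directness: in a vanishing sum of vectors of charges of one parity, the term
    of highest charge lies in the previous filtration piece and is orthogonal to
    it. The two parities are separated by the Z/2-grading. *)
Lemma Rcharge_direct : direct_sum (Rcharge U).
Proof.
apply: direct_sum_intro; first exact: Rcharge_subspace.
  move=> x; set G := lspan _.
  have sG : subspace G by exact: lspan_subspace.
  have [dE _ Ex _ _] := filt_good U.
  have [s [_ _ ->]] := component_support dE x.
  apply: subspace_sum => // e _; have [p [_ Fp]] := Ex e _ (component_in dE x e).
  by apply: lspan_mono (filt_span Fp) => z [q _ ?]; exists q.
have one_parity e (s : seq int) c : uniq s -> (forall i, Rcharge U i (c i)) ->
    (forall i, i \in s -> oddz i = e) -> \sum_(i <- s) c i = 0 ->
    forall i, i \in s -> c i = 0.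
  move: {2}(size s) (erefl (size s)) => n; elim: n s => [|n IH] s.
    by move=> /size0nil ->.
  move=> sz us Rc se s0; have [|p ps pM] := @seq_int_max s.
    by rewrite -size_eq0 sz.
  move: s0; rewrite (big_rem p ps) /= => s0.
  have cp0 : c p = 0.
    have Fp : F (p - 2) (c p).
      move/eqP: s0; rewrite addr_eq0 => /eqP ->.
      apply: subspaceN; first exact: filt_subspace.
      rewrite big_seq; apply: subspace_sum => [|q]; first exact: filt_subspace.
      rewrite mem_rem_uniq // inE => /andP[/= qp qs].
      have le : q <= p - 2.
        by apply: oddz_le_step; [rewrite !se|rewrite lt_neqAle qp pM].
      have Eqp : oddz (p - 2) = oddz q.
        have : oddz p = oddz q by rewrite !se.
        by rewrite /oddz; lia.
      have [k ->] := oddz_eq_step Eqp le.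
      by apply: filt_mono; have [] := Rc q.
    have [H _] := filt_nondeg U (p - 2); apply: H => // y Fy.
    by have [_] := Rc p; apply.
  move=> i si; case: (eqVneq i p) => [->//|ip].
  apply: (IH (rem p s)) => //.
  - by rewrite size_rem // sz.
  - exact: rem_uniq.
  - by move=> j /mem_rem /se.
  - by move: s0; rewrite cp0 add0r.
  - by rewrite mem_rem_uniq // inE ip.
move=> s c us Rc s0 i si.
have [dE FE _ _ _] := filt_good U.
have Ec j : z2part U (oddz j) (c j).
  by have [_ /(_ (c j))[]] := FE j; have [] := Rc j.
have sum0 e : \sum_(j <- filter (fun j => oddz j == e) s) c j = 0.
  have := component0 dE e; rewrite -[X in component _ _ X]s0 component_sum // => E.
  rewrite big_filter -[RHS]E [RHS](bigID (fun j => oddz j == e)) /=.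
  rewrite [X in _ = _ + X]big1 ?addr0.
    by apply: eq_bigr => j /eqP <-; rewrite component_id.
  by move=> j; rewrite eq_sym => ej; rewrite (component_neq dE (Ec j)).
apply: (one_parity (oddz i) _ c _ Rc _ (sum0 (oddz i))).
- exact: filter_uniq.
- by move=> j; rewrite mem_filter => /andP[/eqP].
- by rewrite mem_filter eqxx.
Qed.

Lemma Rcharge_above p q x : F p x -> p < q -> component (Rcharge U) q x = 0.
Proof.
move=> /filt_span Gx lt; have dR := Rcharge_direct.
pose f := componentL dR q.
have := lspan_min (subspace_preim f (P := [set 0]) _) _ Gx; apply.
  by split=> // a y z -> ->; rewrite scaler0 addr0.
move=> y [r le Ry]; rewrite /= /f /= (component_neq dR Ry) //.
by apply: contraTneq le => <-; rewrite -ltNge.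
Qed.

Lemma L0_eigen k x : Lop U 0 x = (k%:~R / 2) *: x -> wt U k x.
Proof.
move=> E; apply: (homog_of_components (wt_direct U)) => h hk.
set z := component _ h x; have zh : wt U h z := component_in (wt_direct U) x h.
have : component (wt U) h (Lop U 0 x) = Lop U 0 z.
  apply: (component_commute (wt_direct U)) => j y yj; rewrite (L0_wt yj).
  exact: subspaceZ (wt_subspace j) _.
rewrite E (componentZ (wt_direct U)) -/z (L0_wt zh) => /eqP.
rewrite -subr_eq0 -scalerBl scaler_eq0 -mulrBl mulf_eq0 invr_eq0 pnatr_eq0 orbF.
by rewrite -intrB intr_eq0 subr_eq0 eq_sym (negbTE hk) => /eqP.
Qed.

Lemma L1_wt h x : wt U h x -> wt U (h - 2) (Lop U 1 x).
Proof.
move=> xh; apply: L0_eigen.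
have := L_comm U (m := 0) (n := 1) x isT isT isT.
rewrite !add0r mulrN1z scaleN1r (L0_wt xh) => /eqP; rewrite subr_eq => /eqP ->.
rewrite linearZ_LR /= -scaleN1r -scalerDl; congr (_ *: _).
rewrite intrB mulrBl addrC; congr (_ - _).
by rewrite divff // pnatr_eq0.
Qed.

Hypothesis hCFT : CFT_type U.

(** Weight one in CFT type: the only correction to the naive adjoint of a mode
    comes from [L_1 x], a multiple of the vacuum. *)
Lemma adjoint_weight_one x n v : wt U 2 x -> exists c : C,
  adjoint_mode U 2 x n v = - (mode x (- n) v + (if n == 0 then c *: v else 0)).
Proof.
move=> x2; have [neg vac0] := hCFT.
have [c Ec] : exists c, Lop U 1 x = c *: vac V by apply/vac0; exact: (L1_wt x2).
exists c; have hi j : iter j.+2 (Lop U 1) x = 0.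
  elim: j => [|j IH]; last by rewrite iterS IH linear0.
  by rewrite /= Ec; apply: (neg (-2)) => //; apply: (L1_wt (h := 0)); apply/vac0; exists c.
rewrite /adjoint_mode (@fsum_seqT _ _ [:: 0%N; 1%N]) //; last first.
  by move=> [|[|j]] // _; rewrite hi mode0l scaler0.
rewrite big_cons big_seq1 !invr1 !scale1r -[iter 0 _ _]/x -[iter 1 _ _]/(Lop U 1 x) Ec.
rewrite modeZl vac_mode.
rewrite (_ : 2 - 0%N%:Z - n - 2 = - n); last by lia.
rewrite (_ : (2 - 1%N%:Z - n - 2 == -1) = (n == 0)); last by lia.
have -> : ('i%C : R[i]) ^ (2 : int) = -1 by exact: sqr_i.
by rewrite scaleN1r; case: ifP; rewrite ?scaler0.
Qed.

(** If the vacuum had negative filtration degree, its powers, which are the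
    vacuum again, would have arbitrarily negative ones, against separatedness. *)
Lemma filt_neg_wt0 x : wt U 0 x -> F (-2) x -> x = 0.
Proof.
have [_ vac0] := hCFT; move=> /vac0 [c ->] Fx.
case: (eqVneq c 0) => [->|c0]; first by rewrite scale0r.
have Fv : F (-2) (vac V).
  have := subspaceZ c^-1 (filt_subspace (-2)) Fx.
  by rewrite scalerA mulVf // scale1r.
have Fk (k : nat) : F (- (2 * k%:Z)) (vac V).
  elim: k => [|k IH]; first by rewrite mulr0 oppr0; exact: filt_vac.
  have := filt_mode (-1) IH Fv; rewrite vac_mode eqxx.
  by rewrite (_ : _ + _ = - (2 * k.+1%:Z)) //; lia.
rewrite (filt_sep (g := U) (e := false) (x := vac V)) ?scaler0 // => p Ep.
have [le|lt] := leP 0 p.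
  have [k ->] := oddz_eq_step (q := 0) Ep le; apply: filt_mono; exact: filt_vac.
have [k Ek] := oddz_eq_step (p := 0) (esym Ep) (ltW lt).
by have := Fk k; rewrite (_ : - _ = p) //; lia.
Qed.

(** A vector of weight one and filtration degree zero is orthogonal to all
    vectors of filtration degree zero: the pairing with [y] is a multiple of
    the pairing of the vacuum with [x_1 y], and [x_1 y] vanishes, having weight
    zero and negative filtration degree. *)
Lemma filt0_wt1 x : wt U 2 x -> F 0 x -> x = 0.
Proof.
move=> x2 Fx; have [nd _] := filt_nondeg U 0; apply: nd => // y Fy.
have -> : B x y = B x (component (wt U) 2 y).
  by rewrite -form_component_wt (component_id (wt_direct U) x2).
have y2 : wt U 2 (component (wt U) 2 y) := component_in (wt_direct U) y 2.
have Fy2 : F 0 (component (wt U) 2 y) by exact: wt_filt_component.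
move: (component _ _ _) y2 Fy2 => {}y {Fy} y2 Fy.
(* The invariance of the form is available for vectors of definite parity. *)
have parB b z : wt U 2 z -> F 0 z -> par b z -> B z y = 0.
  move=> z2 Fz zb; rewrite -[z]mode_vac.
  have [_ _ H _] := form_inv U; rewrite (H _ _ _ _ _ _ _ zb (par_vac V) z2).
  rewrite andbF expr0 mul1r; have [c ->] := adjoint_weight_one (-1) y z2.
  rewrite /= addr0 opprK (filt_neg_wt0 (x := mode z 1 y)) ?oppr0 ?form0r //.
    exact: (wt_mode 1 z2 y2).
  exact: (filt_mode_ge0 (n := 1) isT Fz Fy).
have [s [_ _ ->]] := component_support (par_direct V) x.
elim/big_rec: _ => [|b z _ Ez]; first by rewrite form0l.
rewrite formDl Ez addr0; apply: (parB b).
- by apply: graded_component x2; [exact: par_direct|exact: wt_par].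
- by apply: graded_component Fx; [exact: par_direct|exact: filt_par].
- exact: component_in (par_direct V) _ _.
Qed.

(** This is why the currents have charge exactly one. *)
Lemma weight_one_charge x : wt U 2 x -> F 2 x -> Rcharge U 2 x.
Proof.
move=> x2 Fx; split=> // y; rewrite subrr => Fy.
rewrite -(component_id (wt_direct U) x2) form_component_wt.
rewrite (filt0_wt1 (x := component _ 2 y)) ?form0r //.
  exact: component_in (wt_direct U) _ _.
exact: wt_filt_component.
Qed.

(** The adjoint of the zero mode is minus itself up to an additive scalar, so it
    preserves orthogonality to a filtration piece as well as the filtration. *)
Lemma zero_mode_charge x p y : par false x -> wt U 2 x -> F 2 x ->
  Rcharge U p y -> Rcharge U p (mode x 0 y).
Proof.
move=> x0 x2 Fx [Fy By]; split.
  by have := filt_mode_ge0 (n := 0) (lexx _) Fx Fy; rewrite (_ : 2 + p - 2 = p) //; lia.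
move=> z Fz; have [c Ec] := adjoint_weight_one 0 z x2.
have -> : B (mode x 0 y) z = B y (adjoint_mode U 2 x 0 z).
  apply: (@par_ind _ _ [set y | B (mode x 0 y) z = B y (adjoint_mode U 2 x 0 z)]).
    split=> [|a u v /= Eu Ev]; first by rewrite /= mode0r !form0l.
    by rewrite modeDr modeZr !formPl Eu Ev.
  move=> b u ub /=; have [_ _ H _] := form_inv U; rewrite (H _ _ _ _ _ _ _ x0 ub x2).
  by rewrite expr0 mul1r.
rewrite Ec By // eqxx oppr0.
have sF := filt_subspace (p - 2).
apply: subspaceN => //; apply: subspaceD => //; last exact: subspaceZ.
have := filt_mode_ge0 (n := 0) (lexx _) Fx Fz.
by rewrite (_ : 2 + (p - 2) - 2 = p - 2) //; lia.
Qed.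

End GradedUnitary.

(** * Currents in the matter vertex algebra *)

Section Matter.
Variables (R : realType) (g : reductiveLie R) (V : vertexAlgebra R).
Variables (U : gradedUnitary V) (D : internalGrading U).
Variables (H : hamiltonianAction g V).
Hypotheses (hCFT : CFT_type U) (hBPS : BPS_bound (trigrading_of D)).
Hypothesis hH : good_action U H.
Local Notation J := (current H).
Local Notation F := (filt U).
Local Notation piece := (tri_piece (trigrading_of D)).

Lemma intdeg_subspace d : subspace (intdeg D d).
Proof. by case: (intdeg_direct D). Qed.

Lemma Rcharge_intdeg p : graded_subspace (intdeg D) (Rcharge U p).
Proof.
have filtc q d x : F q x -> F q (component (intdeg D) d x).
  by apply: graded_component; [exact: intdeg_direct|exact: intdeg_filt].
move=> x d z [Fx Bx] /(component_uniq (intdeg_direct D)) <-; split.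
  exact: filtc.
move=> y Fy; rewrite (form_component (nu := -%R) (intdeg_direct D)).
- by apply: Bx; exact: filtc.
- exact: opprK.
- exact: formPl.
- exact: formPr.
- by move=> e e' u v; exact: intdeg_form.
Qed.

Lemma component_piece h d r x : wt U h x -> intdeg D d x ->
  piece h r d (component (Rcharge U) r x).
Proof.
move=> xh xd; have dR := Rcharge_direct U; split; [split|] => /=.
- by apply: component_graded => //; [exact: wt_direct|exact: Rcharge_wt].
- exact: component_in dR _ _.
- by apply: component_graded => //; [exact: intdeg_direct|exact: Rcharge_intdeg].
Qed.

Lemma BPS_HL h r d x : piece h r d x -> h = r - d -> x != 0 -> d <= 0.
Proof.
move=> px hE x0; rewrite leNgt; apply/negP => d0.
by move/eqP: x0; apply; apply: (hBPS _ px); rewrite hE; lia.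
Qed.

Lemma current_wt a : wt U 2 (J a).
Proof. by have [[_]] := hH a. Qed.

Lemma current_filt a : F 2 (J a).
Proof. by have [[]] := hH a. Qed.

Lemma current_par a : par false (J a).
Proof.
have [_ _ hp] := ham_hom H; apply: hp.
by have [[gp _] _] := affine_gen_spec H; apply: gp.
Qed.

Lemma current_charge a : Rcharge U 2 (J a).
Proof. exact: (weight_one_charge hCFT (current_wt a) (current_filt a)). Qed.

(** A current saturates the bound, which leaves it no internal degree. *)
Lemma current_intdeg a : intdeg D 0 (J a).
Proof.
apply: (homog_of_components (intdeg_direct D)) => d d0.
apply: (hBPS (h := 2) (r := 2) (d := d)); first by lia.
have di := intdeg_direct D; split; [split|] => /=.
- apply: (graded_component (S := intdeg D)) (current_wt a) => //; exact: intdeg_wt.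
- apply: (graded_component (S := intdeg D)) (current_charge a) => //; exact: Rcharge_intdeg.
- exact: component_in di _ _.
Qed.

Lemma current_bracket a b : mode (J a) 0 (J b) = \sum_c fC a b c *: J c.
Proof.
have [_ hm _] := ham_hom H; rewrite -hm.
have [_ /(_ a b)[-> _ _]] := affine_gen_spec H.
by rewrite linear_sum; apply: eq_bigr => c _; rewrite linearZ_LR.
Qed.

Lemma current0_charge a r x : Rcharge U r x -> Rcharge U r (mode (J a) 0 x).
Proof.
exact: (zero_mode_charge hCFT (current_par a) (current_wt a) (current_filt a)).
Qed.

Lemma current0_intdeg a d x : intdeg D d x -> intdeg D d (mode (J a) 0 x).
Proof. by move=> xd; have := intdeg_mode 0 (current_intdeg a) xd; rewrite add0r. Qed.

(** A mode J_n with n > 0 lowers the weight and keeps the degree d; at equal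
    charge this would violate the bound, which Hall-Littlewood vectors saturate. *)
Lemma current_pos_component a (n : int) r d x : 0 < n -> piece (r - d) r d x ->
  component (Rcharge U) r (mode (J a) n x) = 0.
Proof.
move=> n0 [[xh xr] xd]; set y := mode _ _ _.
have yw := wt_mode n (current_wt a) xh; have yd := intdeg_mode n (current_intdeg a) xd.
by apply: (hBPS _ (component_piece r yw yd)); lia.
Qed.

(** The product of the associated graded is commutative: the commutator of the
    (-1)-modes only involves the nonnegative modes. *)
Lemma current_product_sym a r d x : Rcharge U r x -> intdeg D d x ->
  component (Rcharge U) (r + 2) (mode (J a) (-1) x) =
  component (Rcharge U) (r + 2) (mode x (-1) (J a)).
Proof.
move=> [Fx _] xd; have dR := Rcharge_direct U.
apply/eqP; rewrite -subr_eq0 -componentB //; apply/eqP.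
apply: (@Rcharge_above _ _ _ r); last by lia.
have := commutator (vac V) (-1) (-1) (current_par a) (intdeg_par xd).
rewrite !mode_vac andFb expr0 scale1r => ->.
apply: subspace_fsum => [|j _]; first exact: filt_subspace.
apply: subspaceZ; first exact: filt_subspace.
have FJ : F r (mode (J a) j x).
  have := filt_mode_ge0 (n := j) isT (current_filt a) Fx.
  by rewrite (_ : 2 + r - 2 = r) //; lia.
by have := filt_mode (-1 + -1 - j%:Z) FJ (filt_vac U); rewrite addr0.
Qed.

Lemma product_lower r1 r2 x y (n : int) : 0 <= n ->
  Rcharge U r1 x -> Rcharge U r2 y ->
  component (Rcharge U) (r1 + r2) (mode x n y) = 0.
Proof.
move=> n0 [Fx _] [Fy _].
by apply: (@Rcharge_above _ _ _ (r1 + r2 - 2)); [exact: filt_mode_ge0|lia].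
Qed.

(** For the bracket the filtration is not enough: here it is the bound that
    excludes the modes beyond the zeroth. *)
Lemma bracket_lower r1 d1 r2 d2 x y (n : int) : 0 < n -> d1 <= 0 -> d2 <= 0 ->
  piece (r1 - d1) r1 d1 x -> piece (r2 - d2) r2 d2 y ->
  component (Rcharge U) (r1 + r2 - 2) (mode x n y) = 0.
Proof.
move=> n0 d10 d20 [[xh xr] xd] [[yh yr] yd].
have w := wt_mode n xh yh; have d := intdeg_mode n xd yd.
by apply: (hBPS _ (component_piece (r1 + r2 - 2) w d)); lia.
Qed.

End Matter.

(** * Symplectic fermions *)

Lemma creation_lt_trans (I : finType) : transitive (@creation_lt I).
Proof.
move=> [y l] [x k] [z m]; rewrite /creation_lt /=.
by lia.
Qed.

Lemma creation_lt_irr (I : finType) : irreflexive (@creation_lt I).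
Proof. by move=> [x k]; rewrite /creation_lt /= !ltnn andbF. Qed.

Lemma creation_le_total (I : finType) : total (@creation_le I).
Proof.
move=> [x k] [y l]; rewrite /creation_le /creation_lt /= !xpair_eqE.
case: (ltngtP k l) => _; rewrite ?orbT //= !andbT.
rewrite -(inj_eq enum_rank_inj x) -(inj_eq enum_rank_inj y) -!val_eqE /=.
by case: ltngtP.
Qed.

Lemma creation_le_trans (I : finType) : transitive (@creation_le I).
Proof.
move=> y x z /orP[/eqP -> //|xy] /orP[/eqP <-|yz]; first by rewrite /creation_le xy orbT.
by rewrite /creation_le (creation_lt_trans xy yz) orbT.
Qed.

Lemma sort_creation_lt (I : finType) (s : seq (I * nat)) : uniq s ->
  sorted (@creation_lt I) (sort (@creation_le I) s).
Proof.
move=> us; have := sort_sorted (@creation_le_total I) s.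
have : uniq (sort (@creation_le I) s) by rewrite sort_uniq.
rewrite (sorted_pairwise (@creation_le_trans I)) uniq_pairwise => u1 u2.
rewrite (sorted_pairwise (@creation_lt_trans I)).
have : pairwise [rel p q | [rel x y | x != y] p q && creation_le p q] (sort (@creation_le I) s).
  by rewrite pairwise_relI u1.
apply: sub_pairwise => p q /= /andP[/negbTE pq].
by rewrite /creation_le pq.
Qed.

Lemma sorted_creation_eq (I : finType) (s t : seq (I * nat)) :
  sorted (@creation_lt I) s -> sorted (@creation_lt I) t -> s =i t -> s = t.
Proof. exact: (irr_sorted_eq (@creation_lt_trans I) (@creation_lt_irr I)). Qed.

(** The sign by which a fermion of type b changes the internal degree. *)
Definition dsgn (b : bool) : int := if b then 1 else -1.

Section Fermions.
Variables (R : realType) (g : reductiveLie R) (S : vertexAlgebra R).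
Variables (eta : bool * 'I_(dimg g) -> S).
Hypothesis hS : is_symplectic_fermions eta.
Local Notation C := R[i].
Local Notation I := 'I_(dimg g).
Local Notation mono := (creation_monomial eta).
Implicit Types (s : seq ((bool * I) * nat)) (x y w : S).

Lemma fermion_anticomm i j (n m : int) x :
  mode (eta i) n (mode (eta j) m x) =
  - mode (eta j) m (mode (eta i) n x) +
  (if n + m == 0 then n%:~R * eps R i.1 j.1 * Kinv i.2 j.2 else 0) *: x.
Proof.
have [_ /(_ i.1 j.1 i.2 j.2 n m x)] := hS; rewrite -!surjective_pairing => <-.
by rewrite [_ + mode (eta j) _ _]addrC addKr.
Qed.

Lemma fermion_vac i (n : nat) : mode (eta i) n (vac S) = 0.
Proof. exact: mode_vac_ge0. Qed.

Lemma fermion_par i : par true (eta i).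
Proof. by have [[]] := hS. Qed.

Lemma creation_anticomm (p q : (bool * I) * nat) x :
  mode (eta p.1) (- p.2.+1%:Z) (mode (eta q.1) (- q.2.+1%:Z) x) =
  - mode (eta q.1) (- q.2.+1%:Z) (mode (eta p.1) (- p.2.+1%:Z) x).
Proof.
rewrite fermion_anticomm; case: eqP => [|_]; first by lia.
by rewrite scale0r addr0.
Qed.

Lemma creation_square (p : (bool * I) * nat) x :
  mode (eta p.1) (- p.2.+1%:Z) (mode (eta p.1) (- p.2.+1%:Z) x) = 0.
Proof.
have /eqP := creation_anticomm p p x; rewrite -addr_eq0 -mulr2n -scaler_nat.
by rewrite scaler_eq0 pnatr_eq0 => /eqP.
Qed.

Lemma mono_move p (s t : seq ((bool * I) * nat)) :
  mono (s ++ p :: t) = (-1) ^+ size s *: mono (p :: s ++ t).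
Proof.
elim: s => [|q s IH] /=; first by rewrite scale1r.
rewrite -/(mono _) IH modeZr /= creation_anticomm exprS mulN1r scaleNr scalerN.
by rewrite -/(mono _).
Qed.

(** Creation modes anticommute, so that only the sorted monomials matter. *)
Lemma mono_perm s t : perm_eq s t -> exists n : nat, mono s = (-1) ^+ n *: mono t.
Proof.
elim: s t => [|p s IH] t.
  by rewrite perm_sym => /perm_nilP ->; exists 0%N; rewrite scale1r.
move=> st; have pt : p \in t by rewrite -(perm_mem st) mem_head.
case/splitPr: pt st => t1 t2 st.
have [|n En] := IH (t1 ++ t2).
  by rewrite -(perm_cons p) (perm_trans st) // -cat1s perm_catCA.
exists (n + size t1)%N; rewrite mono_move /= -/(mono _) -/(mono _) En modeZr.
by rewrite scalerA exprD -mulrA -expr2 sqrr_sign mulr1.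
Qed.

Lemma mono_dup s : ~~ uniq s -> mono s = 0.
Proof.
elim: s => // p s IH /=; rewrite negb_and negbK => /orP[ps|/IH]; last first.
  by rewrite -/(mono _) => ->; rewrite mode0r.
have [n En] := mono_perm (perm_to_rem ps).
by rewrite -/(mono _) En modeZr /= creation_square scaler0.
Qed.

(** Coordinates of an arbitrary monomial: at a sorted list they vanish unless
    the monomial is a rearrangement of it. In particular they respect all
    gradings defined by counting. *)
Lemma fermion_coordinates :
  exists co : seq ((bool * I) * nat) -> {linear S -> C^o},
  [/\ forall s, sorted (@creation_lt _) s -> co s (mono s) = 1,
      forall s t, sorted (@creation_lt _) s -> ~~ perm_eq s t ->
        co s (mono t) = 0 &
      forall x, exists r, [/\ uniq r, all (sorted (@creation_lt _)) r,
        forall s, s \notin r -> co s x = 0 &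
        x = \sum_(s <- r) (co s x : C) *: mono s]].
Proof.
have [[_ bb] _] := hS; have [co [co1 coP]] := basis_coordinates bb.
exists co; split=> // [s ss|s t ss]; first by rewrite co1 // eqxx.
have [ut|nut] := boolP (uniq t); last by rewrite mono_dup // linear0.
move=> st; have pt : perm_eq t (sort (@creation_le _) t).
  by rewrite perm_sym perm_sort.
have [n ->] := mono_perm pt; rewrite linearZ_LR /= co1 ?sort_creation_lt //.
case: eqP => [E|_]; last by rewrite scaler0.
by move: st; rewrite E perm_sym pt.
Qed.

Definition hdeg s : int := \sum_(q <- s) 2 * q.2.+1%:Z.
Definition rdeg s : int := (size s)%:Z.
Definition ddeg s : int := \sum_(q <- s) (if q.1.1 then 1 else -1).

Lemma hdeg_perm s t : perm_eq s t -> hdeg s = hdeg t.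
Proof. exact: perm_big. Qed.
Lemma rdeg_perm s t : perm_eq s t -> rdeg s = rdeg t.
Proof. by move/perm_size => E; rewrite /rdeg E. Qed.
Lemma ddeg_perm s t : perm_eq s t -> ddeg s = ddeg t.
Proof. exact: perm_big. Qed.

(** The three gradings of the fermions, taken simultaneously. Spanning by
    arbitrary and not only sorted monomials makes the effect of a creation mode
    immediate. *)
Definition sf_piece (h r d : int) : set S :=
  lspan [set x | exists s, [/\ x = mono s, hdeg s = h, rdeg s = r & ddeg s = d]].

Lemma sf_piece_subspace h r d : subspace (sf_piece h r d).
Proof. exact: lspan_subspace. Qed.

Lemma sf_piece_mono s : sf_piece (hdeg s) (rdeg s) (ddeg s) (mono s).
Proof. by apply: lspan_gen; exists s. Qed.

Lemma sf_piece_create i (k : nat) h r d x : sf_piece h r d x ->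
  sf_piece (h + 2 * k.+1%:Z) (r + 1) (d + dsgn i.1) (mode (eta i) (- k.+1%:Z) x).
Proof.
move: x; apply: (lspan_min (subspace_preim (modeL (eta i) (- k.+1%:Z))
  (sf_piece_subspace (h + 2 * k.+1%:Z) (r + 1) (d + dsgn i.1)))).
move=> _ [s [-> <- <- <-]]; apply: lspan_gen; exists ((i, k) :: s); split=> //.
- by rewrite /hdeg big_cons addrC.
- by rewrite /rdeg /=; lia.
- by rewrite /ddeg big_cons addrC.
Qed.

Lemma sf_piece_annihilate i (n : nat) h r d x : sf_piece h r d x ->
  sf_piece (h - 2 * n%:Z) (r - 1) (d + dsgn i.1) (mode (eta i) n%:Z x).
Proof.
move: x; apply: (lspan_min (subspace_preim (modeL (eta i) n%:Z)
  (sf_piece_subspace (h - 2 * n%:Z) (r - 1) (d + dsgn i.1)))).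
move=> _ [s [-> <- <- <-]] /=; rewrite /modeL.
elim: s => [|[j k] s IH]; first by rewrite fermion_vac; apply: subspace0 (sf_piece_subspace _ _ _).
rewrite /= -/(mono _) fermion_anticomm; apply: (subspaceD (sf_piece_subspace _ _ _)).
  apply: (subspaceN (sf_piece_subspace _ _ _)).
  have := sf_piece_create j k IH.
  congr (sf_piece _ _ _ _).
  - by rewrite /hdeg big_cons /=; lia.
  - by rewrite /rdeg /=; lia.
  - by rewrite /ddeg big_cons /= -/(dsgn _); lia.
case: ifP => [/eqP nk|_]; last by rewrite scale0r; apply: subspace0 (sf_piece_subspace _ _ _).
rewrite /eps; case: (eqVneq i.1 j.1) => [_|ij].
  by rewrite mulr0 mul0r scale0r; apply: subspace0 (sf_piece_subspace _ _ _).
apply: (subspaceZ _ (sf_piece_subspace _ _ _)).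
have := sf_piece_mono s; congr (sf_piece _ _ _ _).
- by rewrite /hdeg big_cons /=; lia.
- by rewrite /rdeg /=; lia.
- by rewrite /ddeg big_cons /=; move: ij; case: (i.1); case: (j.1) => //= _; rewrite /dsgn; lia.
Qed.

(** The change of the doubled charge under a mode: creation or annihilation. *)
Definition sfchange (n : int) : int := if n < 0 then 1 else -1.

Lemma sf_piece_mode i (n : int) h r d x : sf_piece h r d x ->
  sf_piece (h - 2 * n) (r + sfchange n) (d + dsgn i.1) (mode (eta i) n x).
Proof.
case: n => n px; first exact: sf_piece_annihilate.
have := sf_piece_create i n px; rewrite NegzE.
by rewrite (_ : h - 2 * - n.+1%:Z = h + 2 * n.+1%:Z) //; lia.
Qed.

(** Each creation mode contributes 2n - 1 +- 1 to the doubled h - R + d/2. *)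
Lemma deg_excess s : 0 <= hdeg s - rdeg s + ddeg s.
Proof.
elim: s => [|[[b i] k] s]; first by rewrite /hdeg /ddeg /rdeg !big_nil.
by rewrite /hdeg /ddeg /rdeg !big_cons /=; case: b; lia.
Qed.

(** Equality in the bound singles out the generators eta^-_(-1). *)
Lemma deg_excess_eq s : hdeg s - rdeg s + ddeg s <= 0 ->
  all (fun q => (q.1.1 == false) && (q.2 == 0%N)) s.
Proof.
elim: s => [//|[[b i] k] s].
have := deg_excess s; rewrite /hdeg /ddeg /rdeg !big_cons /= => le IH.
by case: b => /= H; rewrite ?IH; lia.
Qed.

Lemma ddeg_minimal s : all (fun q => (q.1.1 == false) && (q.2 == 0%N)) s ->
  ddeg s = - rdeg s.
Proof.
elim: s => [|[[b i] k] s IH]; first by rewrite /ddeg /rdeg big_nil.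
by rewrite /= => /andP[/andP[/eqP/= -> _] /IH]; rewrite /ddeg /rdeg big_cons /=; lia.
Qed.

(** Degrees without monomials: negative excess, or zero excess with a degree d
    different from that of a product of eta^-_(-1). *)
Lemma sf_piece_empty h r d x : h - r + d <= 0 -> (h - r + d = 0 -> d <> - r) ->
  sf_piece h r d x -> x = 0.
Proof.
move=> le ne px; have s0 : subspace [set 0 : S].
  by split=> // a y z -> ->; rewrite scaler0 addr0.
apply: (lspan_min s0 _ px) => _ [s [-> hE rE dE]].
have hs : hdeg s - rdeg s + ddeg s <= 0 by rewrite hE rE dE.
have /ddeg_minimal := deg_excess_eq hs; rewrite rE dE => /ne [].
by have := deg_excess s; rewrite hE rE dE; lia.
Qed.

End Fermions.

Arguments hdeg {R g} s.
Arguments rdeg {R g} s.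
Arguments ddeg {R g} s.

(** * Invariant tensors of the Lie algebra *)

Section MetricFacts.
Variables (R : realType) (g : reductiveLie R).
Local Notation I := 'I_(dimg g).
Local Notation C := R[i].
Local Notation K := (Kmx g).

Lemma K_offdiag a b : a != b -> K a b = 0.
Proof. by have := K_diag (r := g) a b; case: ifP. Qed.

Lemma K_square a : K a a * K a a = 1.
Proof. by have := K_diag (r := g) a a; rewrite eqxx => -[] ->; rewrite ?mulrNN mulr1. Qed.

Lemma K_inv : invmx K = K.
Proof.
have KK : K *m K = 1%:M.
  apply/matrixP => a b; rewrite !mxE (bigD1 a) //= big1 ?addr0.
    case: eqP => [<-|/eqP ab]; first exact: K_square.
    by rewrite [K a b]K_offdiag ?mulr0.
  by move=> c ca; rewrite K_offdiag ?mul0r // eq_sym.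
have [uK _] := mulmx1_unit KK.
by rewrite -[LHS]mulmx1 -KK mulmxA mulVmx // mul1mx.
Qed.

Lemma KinvE a b : Kinv a b = (K a b)%:C%C.
Proof. by rewrite /Kinv K_inv. Qed.

Definition ksgn (a : I) : C := (K a a)%:C%C.

Lemma ksgn_sq a : ksgn a * ksgn a = 1.
Proof. by rewrite /ksgn -rmorphM /= K_square. Qed.

Lemma ksgn_Kinv a b : ksgn a * Kinv b a = (a == b)%:R.
Proof.
rewrite KinvE; case: eqP => [->|/eqP ab]; first exact: ksgn_sq.
by rewrite K_offdiag 1?eq_sym // mulr0.
Qed.

Let delta (a : I) : 'rV[R]_(dimg g) := delta_mx 0 a.

Lemma bracket_delta a b c : lie_bracket (@fstr R g) (delta a) (delta b) 0 c = fstr a b c.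
Proof.
rewrite mxE (bigD1 a) //= (bigD1 b) //= !mxE !eqxx !mul1r big1.
  rewrite addr0 big1 ?addr0 // => d da.
  by rewrite big1 // => e _; rewrite !mxE /= (negbTE da) !mul0r.
by move=> e eb; rewrite !mxE /= (negbTE eb) mulr0 mul0r.
Qed.

Lemma bilin_delta (x : 'rV[R]_(dimg g)) c : bilin K x (delta c) = \sum_d x 0 d * K d c.
Proof.
rewrite /bilin mxE (bigD1 c) //= big1 ?addr0.
  by rewrite !mxE !eqxx mulr1; apply: eq_bigr.
by move=> e ec; rewrite !mxE /= (negbTE ec) mulr0.
Qed.

Lemma bilin_delta_l (x : 'rV[R]_(dimg g)) a : bilin K (delta a) x = \sum_d K a d * x 0 d.
Proof.
rewrite /bilin mxE; apply: eq_bigr => d _; rewrite !mxE (bigD1 a) //= big1 ?addr0.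
  by rewrite !mxE !eqxx mul1r.
by move=> e ec; rewrite !mxE /= (negbTE ec) mul0r.
Qed.

Lemma K_invariant_basis a b c :
  \sum_d fstr a b d * K d c = \sum_d K a d * fstr b c d.
Proof.
have := K_invariant (r := g) (delta a) (delta b) (delta c).
rewrite bilin_delta bilin_delta_l.
under eq_bigr do rewrite bracket_delta.
by move=> ->; apply: eq_bigr => d _; rewrite bracket_delta.
Qed.

(** By invariance of the form, lowering an index turns the coadjoint matrices,
    by which the fermions transform, into the adjoint ones. *)
Lemma fC_lower a b c : fC a b c = - (ksgn b * fC a c b * ksgn c).
Proof.
have := K_invariant_basis b a c.
rewrite (bigD1 c) //= big1 ?addr0; last by move=> d dc; rewrite K_offdiag ?mulr0.
rewrite (bigD1 b) //= big1 ?addr0; last by move=> d db; rewrite K_offdiag ?mul0r // eq_sym.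
move=> E; rewrite /fC /ksgn -!rmorphM -rmorphN /=; congr (_%:C%C).
by rewrite -[LHS]mulr1 -(K_square c) mulrA f_anti mulNr E mulNr.
Qed.

Let brD x y z : lie_bracket (@fstr R g) (x + y) z = lie_bracket (@fstr R g) x z + lie_bracket (@fstr R g) y z.
Proof.
apply/rowP => c; rewrite !mxE -big_split; apply: eq_bigr => a _ /=.
by rewrite -big_split; apply: eq_bigr => b _; rewrite !mxE !mulrDl.
Qed.

Let brN x y : lie_bracket (@fstr R g) (- x) y = - lie_bracket (@fstr R g) x y.
Proof.
apply/rowP => c; rewrite !mxE -sumrN; apply: eq_bigr => a _ /=.
by rewrite -sumrN; apply: eq_bigr => b _; rewrite !mxE !mulNr.
Qed.

Let brC x y : lie_bracket (@fstr R g) x y = - lie_bracket (@fstr R g) y x.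
Proof.
apply/rowP => c; rewrite !mxE exchange_big -sumrN; apply: eq_bigr => a _ /=.
by rewrite -sumrN; apply: eq_bigr => b _; rewrite f_anti mulrN [y 0 a * _]mulrC.
Qed.

Let bilD x y z : bilin K (x + y) z = bilin K x z + bilin K y z.
Proof. by rewrite /bilin !mulmxDl mxE. Qed.

Let flow_bilin a b c : flow a b c = (bilin K (lie_bracket (@fstr R g) (delta a) (delta b)) (delta c))%:C%C.
Proof.
by rewrite /flow bilin_delta; congr (_%:C%C); apply: eq_bigr => d _; rewrite bracket_delta.
Qed.

Let delta_expand (x : 'rV[R]_(dimg g)) : x = \sum_d x 0 d *: delta d.
Proof. exact: row_sum_delta. Qed.

Let tri (x y z : 'rV[R]_(dimg g)) := bilin K (lie_bracket (@fstr R g) x y) z.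

(** Invariance of the cubic tensor K([x, y], z), from the Jacobi identity. *)
Let tri_invariant A x y z : tri (lie_bracket (@fstr R g) A x) y z +
  tri x (lie_bracket (@fstr R g) A y) z + tri x y (lie_bracket (@fstr R g) A z) = 0.
Proof.
rewrite /tri -K_invariant -!bilD.
have -> : lie_bracket (@fstr R g) x (lie_bracket (@fstr R g) A y) =
    lie_bracket (@fstr R g) (lie_bracket (@fstr R g) y A) x.
  by rewrite [LHS]brC -brN -brC.
rewrite addrAC f_jacobi /bilin !mul0mx mxE //.
Qed.

(** The same in the adapted basis: this is what makes the cubic part of Q^-
    invariant. *)
Lemma flow_invariant (A a b c : I) :
  \sum_(d : I) fC A a d * @flow R g d b c + \sum_(d : I) fC A b d * @flow R g a d c +
  \sum_(d : I) fC A c d * @flow R g a b d = 0.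
Proof.
have E a' b' : lie_bracket (@fstr R g) (delta a') (delta b') = \sum_d fstr a' b' d *: delta d.
  by rewrite [LHS]delta_expand; apply: eq_bigr => d _; rewrite bracket_delta.
have := tri_invariant (delta A) (delta a) (delta b) (delta c).
rewrite /tri !(E A) => /(congr1 (fun x : R => x%:C%C)); rewrite !rmorphD /=.
have br0 y : lie_bracket (@fstr R g) 0 y = 0.
  by apply/rowP => d; rewrite !mxE big1 // => i _; rewrite big1 // => j _; rewrite mxE !mul0r.
have brZ k x y : lie_bracket (@fstr R g) (k *: x) y = k *: lie_bracket (@fstr R g) x y.
  apply/rowP => d; rewrite !mxE mulr_sumr; apply: eq_bigr => i _.
  by rewrite mulr_sumr; apply: eq_bigr => j _; rewrite !mxE !mulrA.
have bilZ k x y : bilin K (k *: x) y = k * bilin K x y.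
  by rewrite /bilin -!scalemxAl mxE.
have bilZr k x y : bilin K x (k *: y) = k * bilin K x y.
  by rewrite /bilin linearZ_LR /= -!scalemxAr mxE.
have bil0 y : bilin K 0 y = 0 by rewrite /bilin !mul0mx mxE.
have bil0r y : bilin K y 0 = 0 by rewrite /bilin trmx0 mulmx0 mxE.
have bilDr x y z : bilin K x (y + z) = bilin K x y + bilin K x z.
  by rewrite /bilin linearD /= mulmxDr mxE.
move=> E0; rewrite -[RHS](rmorph0 (real_complex R)) -[RHS]E0; congr (_ + _ + _).
- rewrite (_ : lie_bracket _ (\sum_d _) _ = \sum_d fstr A a d *: lie_bracket (@fstr R g) (delta d) (delta b)).
    rewrite (big_morph (fun x => bilin K x (delta c)) (fun x y => bilD x y (delta c)) (bil0 _)).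
    rewrite rmorph_sum; apply: eq_bigr => d _ /=.
    by rewrite bilZ flow_bilin -rmorphM.
  rewrite (big_morph (fun x => lie_bracket (@fstr R g) x (delta b)) (fun x y => brD x y (delta b)) (br0 _)).
  by apply: eq_bigr => d _; rewrite brZ.
- rewrite (_ : lie_bracket _ _ (\sum_d _) = \sum_d fstr A b d *: lie_bracket (@fstr R g) (delta a) (delta d)).
    rewrite (big_morph (fun x => bilin K x (delta c)) (fun x y => bilD x y (delta c)) (bil0 _)).
    rewrite rmorph_sum; apply: eq_bigr => d _ /=.
    by rewrite bilZ flow_bilin -rmorphM.
  rewrite brC (big_morph (fun x => lie_bracket (@fstr R g) x (delta a)) (fun x y => brD x y (delta a)) (br0 _)).
  rewrite -sumrN; apply: eq_bigr => d _; rewrite brZ [in RHS]brC scalerN //.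
- rewrite (big_morph _ (bilDr _) (bil0r _)).
  rewrite rmorph_sum; apply: eq_bigr => d _ /=.
  by rewrite bilZr flow_bilin -rmorphM.
Qed.

End MetricFacts.

(** * The exterior algebra on the eta^-_(-1) *)

Section EnumOrd.
Variables (n : nat).
Let lto : rel 'I_n := fun i j => (i < j)%N.

Let lto_trans : transitive lto. Proof. by move=> j i k; apply: ltn_trans. Qed.
Let lto_irr : irreflexive lto. Proof. by move=> i; rewrite /lto ltnn. Qed.

Lemma enum_set_sorted (X : {set 'I_n}) : sorted (fun i j : 'I_n => (i < j)%N) (enum X).
Proof.
rewrite -/lto /enum_mem; apply: sorted_filter; first exact: lto_trans.
have : sorted ltn (map val (enum 'I_n)) by rewrite val_enum_ord iota_ltn_sorted.
by rewrite sorted_map enumT.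
Qed.

Let pairwise_enum (X : {set 'I_n}) : pairwise lto (enum X).
Proof. by rewrite -(sorted_pairwise lto_trans); exact: enum_set_sorted. Qed.

Lemma enum_set_insert (X : {set 'I_n}) b : b \notin X ->
  enum (b |: X)%SET = filter (fun d : 'I_n => (d < b)%N) (enum X) ++
    b :: filter (fun d : 'I_n => (b < d)%N) (enum X).
Proof.
move=> bX; apply: (irr_sorted_eq lto_trans lto_irr); first exact: enum_set_sorted.
  rewrite (sorted_pairwise lto_trans) pairwise_cat /=.
  rewrite !(pairwise_filter _ (pairwise_enum X)) andbT; apply/andP; split.
    apply/allrelP => i j; rewrite mem_filter => /andP[ib _].
    rewrite inE mem_filter => /orP[/eqP -> //|/andP[bj _]]; exact: lto_trans ib bj.
  by apply/allP => j; rewrite mem_filter => /andP[].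
move=> i; rewrite mem_enum in_setU1 mem_cat in_cons !(mem_filter _ i (enum X)) mem_enum.
case: (ltngtP i b) => [lt|gt|/val_inj ->]; rewrite ?eqxx ?orbT //=.
by rewrite orbF orbC.
Qed.

Lemma enum_set_split (X : {set 'I_n}) b : b \notin X ->
  filter (fun d : 'I_n => (d < b)%N) (enum X) ++
    filter (fun d : 'I_n => (b < d)%N) (enum X) = enum X.
Proof.
move=> bX; apply: (irr_sorted_eq lto_trans lto_irr); last 1 first.
- move=> i; rewrite mem_cat !(mem_filter _ i (enum X)) mem_enum.
  case: (ltngtP i b) => [lt|gt|/val_inj ->]; rewrite ?orbF //.
  by rewrite (negbTE bX).
- rewrite (sorted_pairwise lto_trans) pairwise_cat /=.
  rewrite !(pairwise_filter _ (pairwise_enum X)) !andbT.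
  apply/allrelP => i j; rewrite !mem_filter => /andP[ib _] /andP[bj _].
  exact: lto_trans ib bj.
- exact: enum_set_sorted.
Qed.

Lemma size_filter_enum (X : {set 'I_n}) (b : 'I_n) :
  size (filter (fun d : 'I_n => (d < b)%N) (enum X)) = #|[set d in X | (d < b)%N]%SET|.
Proof.
rewrite cardE; apply/perm_size/uniq_perm; last 1 first.
- move=> d.
  by rewrite (mem_filter _ d (enum X)) !mem_enum inE andbC.
- by apply: filter_uniq; exact: enum_uniq.
- exact: enum_uniq.
Qed.

End EnumOrd.

Section Exterior.
Variables (R : realType) (g : reductiveLie R) (S : vertexAlgebra R).
Variables (eta : bool * 'I_(dimg g) -> S).
Hypothesis hS : is_symplectic_fermions eta.
Local Notation C := R[i].
Local Notation I := 'I_(dimg g).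
Local Notation mono := (creation_monomial eta).
Implicit Types (l : seq I) (X Y : {set I}).

(** eta^- with its index lowered, so that it transforms like a basis of g. *)
Definition etaL (b : I) : S := ksgn b *: eta (false, b).

Lemma mode_etaL b n x : mode (etaL b) n x = ksgn b *: mode (eta (false, b)) n x.
Proof. exact: modeZl. Qed.

Lemma etaL_par b : par true (etaL b).
Proof. by apply: subspaceZ; [exact: par_sub|exact: fermion_par hS _]. Qed.

Lemma minus_anticomm a b n m x :
  mode (eta (false, a)) n (mode (eta (false, b)) m x) =
  - mode (eta (false, b)) m (mode (eta (false, a)) n x).
Proof.
rewrite (fermion_anticomm hS) /= /eps eqxx mulr0 mul0r.
by case: ifP; rewrite scale0r addr0.
Qed.

Lemma etaL_anticomm a b n m x :
  mode (etaL a) n (mode (etaL b) m x) = - mode (etaL b) m (mode (etaL a) n x).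
Proof.
by rewrite !mode_etaL !modeZr minus_anticomm !scalerN !scalerA [ksgn b * _]mulrC.
Qed.

Lemma etaL_square a n x : mode (etaL a) n (mode (etaL a) n x) = 0.
Proof.
have /eqP := etaL_anticomm a a n n x; rewrite -addr_eq0 -mulr2n -scaler_nat.
by rewrite scaler_eq0 pnatr_eq0 => /eqP.
Qed.

(** The modes eta^+_1 and eta^-_(-1) form a Clifford algebra: the former acts
    by contraction. *)
Lemma iota_etaL a b x :
  mode (eta (true, b)) 1 (mode (etaL a) (-1) x) =
  (a == b)%:R *: x - mode (etaL a) (-1) (mode (eta (true, b)) 1 x).
Proof.
rewrite !mode_etaL modeZr (fermion_anticomm hS) addrN eqxx /eps /= mulr1 mulr1z mul1r.
by rewrite scalerDr scalerN scalerA ksgn_Kinv addrC.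
Qed.

(** Products of creation modes of the eta^-, of any weight: closed under the
    modes of such products, unlike the exterior algebra itself. *)
Definition ext_piece (k : nat) : set S := lspan [set x | exists s,
  [/\ x = mono s, size s = k & all (fun q => q.1.1 == false) s]].

Lemma ext_piece_sub k : subspace (ext_piece k).
Proof. exact: lspan_subspace. Qed.

Lemma ext_annihilate k b (n : nat) x : ext_piece k x -> mode (etaL b) n%:Z x = 0.
Proof.
move=> px; rewrite mode_etaL.
suff -> : mode (eta (false, b)) n%:Z x = 0 by rewrite scaler0.
pose f := modeL (eta (false, b)) n%:Z.
have s0 : subspace [set 0 : S] by split=> // a y z -> ->; rewrite scaler0 addr0.
apply: (lspan_min (subspace_preim f s0) _ px) => _ [s [-> _ hs]] /=.
rewrite /f /modeL; elim: s hs => [_|[[c a] j] s IH /=]; first exact: mode_vac_ge0.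
move=> /andP[/eqP -> /IH]; rewrite -/(mono _) minus_anticomm => ->.
by rewrite mode0r oppr0.
Qed.

Lemma ext_create k b (n : nat) x : ext_piece k x ->
  ext_piece k.+1 (mode (etaL b) (- n.+1%:Z) x).
Proof.
move=> px; rewrite mode_etaL; apply: subspaceZ; first exact: ext_piece_sub.
pose f := modeL (eta (false, b)) (- n.+1%:Z).
apply: (lspan_min (subspace_preim f (ext_piece_sub k.+1)) _ px) => _ [s [-> hk hs]] /=.
by apply: lspan_gen; exists ((false, b, n) :: s); rewrite /= hk hs.
Qed.

Definition ext_list l : S := foldr (fun b w => mode (etaL b) (-1) w) (vac S) l.

Definition ext_mono X : S := ext_list (enum X).

Lemma ext_list_piece l : ext_piece (size l) (ext_list l).
Proof.
elim: l => [|b l IH] /=; first by apply: lspan_gen; exists [::].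
exact: (ext_create b 0).
Qed.

Lemma ext_list_sf_piece l : sf_piece eta (2 * (size l)%:Z) (size l)%:Z (- (size l)%:Z) (ext_list l).
Proof.
elim: l => [|b l IH] /=; first by have := sf_piece_mono eta [::]; rewrite /hdeg /ddeg !big_nil.
rewrite mode_etaL; apply: subspaceZ; first exact: sf_piece_subspace.
have := sf_piece_create (false, b) 0 IH.
congr (sf_piece _ _ _ _ _); rewrite /dsgn /=; lia.
Qed.

Lemma ext_list_par l : par (odd (size l)) (ext_list l).
Proof.
elim: l => [|b l IH] /=; first exact: par_vac.
exact: (par_mode (-1) (etaL_par b) IH).
Qed.

Lemma ext_list_move l1 b l2 :
  ext_list (l1 ++ b :: l2) = (-1) ^+ size l1 *: ext_list (b :: l1 ++ l2).
Proof.
elim: l1 => [|q l1 IH] /=; first by rewrite scale1r.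
rewrite IH modeZr /= etaL_anticomm exprS mulN1r scaleNr scalerN //.
Qed.

(** Moving the new factor to its place costs one sign for each smaller index. *)
Lemma ext_mono_wedge b X : mode (etaL b) (-1) (ext_mono X) =
  if b \in X then 0 else (-1) ^+ below b X *: ext_mono (b |: X)%SET.
Proof.
case: ifPn => [bX|bX].
  have : b \in enum X by rewrite mem_enum.
  rewrite /ext_mono; case/splitPr => l1 l2.
  by rewrite ext_list_move modeZr /= etaL_square scaler0.
rewrite /ext_mono enum_set_insert // ext_list_move size_filter_enum.
rewrite scalerA -expr2 sqrr_sign scale1r /=; congr (mode _ _ (ext_list _)).
by rewrite enum_set_split.
Qed.

Lemma iota_ext_list b l : b \notin l -> mode (eta (true, b)) 1 (ext_list l) = 0.
Proof.
elim: l => [_|a l IH]; first exact: (mode_vac_ge0 _ 1).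
rewrite inE negb_or => /andP[ba /IH] /= E.
by rewrite iota_etaL E mode0r subr0 eq_sym (negbTE ba) scale0r.
Qed.

Lemma below_setD1 b X : below b (X :\ b)%SET = below b X.
Proof.
rewrite /below; congr (#|pred_of_set _|); apply/setP => d; rewrite !inE.
by case: (eqVneq d b) => [->|//]; rewrite ltnn !andbF.
Qed.

Lemma ext_mono_iota b X : mode (eta (true, b)) 1 (ext_mono X) =
  if b \in X then (-1) ^+ below b X *: ext_mono (X :\ b)%SET else 0.
Proof.
case: ifPn => bX; last by rewrite iota_ext_list // mem_enum.
have := ext_mono_wedge b (X :\ b)%SET; rewrite finset.setD11 finset.setD1K // below_setD1 => E.
have -> : ext_mono X = (-1) ^+ below b X *: mode (etaL b) (-1) (ext_mono (X :\ b)%SET).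
  by rewrite E scalerA -expr2 sqrr_sign scale1r.
rewrite modeZr iota_etaL eqxx scale1r iota_ext_list ?mode0r ?subr0 //.
by rewrite mem_enum finset.setD11.
Qed.

(** Modes among the eta^- creation monomials: there are no contractions, so
    only the (-1)-mode and below survive, and the former is the exterior
    product. *)
Lemma ext_list_mode l k (n : int) x : ext_piece k x ->
  [/\ ext_piece (size l + k) (mode (ext_list l) n x),
      0 <= n -> mode (ext_list l) n x = 0 &
      mode (ext_list l) (-1) x = foldr (fun b w => mode (etaL b) (-1) w) x l].
Proof.
move=> px; elim: l n => [|b l IH] n /=.
  rewrite !vac_mode eqxx; split=> //.
    by case: ifP => // _; apply: subspace0; exact: ext_piece_sub.
  by move=> n0; case: eqP => // E; move: n0; rewrite E.
have E m : mode (mode (etaL b) (-1) (ext_list l)) m x =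
    \sum_(j \in [set: nat]) mode (etaL b) (- j.+1%:Z) (mode (ext_list l) (m + j%:Z) x).
  rewrite (iterate x m (etaL_par b) (ext_list_par l)).
  by apply: fsum_ext => j _; rewrite (ext_annihilate b j px) mode0r scaler0 addr0.
split.
- rewrite E; apply: subspace_fsum => [|j _]; first exact: ext_piece_sub.
  by apply: ext_create; case: (IH (n + j%:Z)).
- move=> n0; rewrite E fsbig1 // => j _; have [_ -> //] := IH (n + j%:Z).
    by rewrite mode0r.
  by apply: addr_ge0.
- rewrite E (@fsum_single _ _ 0%N) ?addr0; first by have [_ _ ->] := IH 0.
  move=> [|j] // _; have [_ -> ] := IH (-1 + j.+1%:Z); first by rewrite mode0r.
  by lia.
Qed.

Lemma ext_mono_product X Y : mode (ext_mono X) (-1) (ext_mono Y) =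
  if [disjoint X & Y]%B then shuffle_sign X Y *: ext_mono (X :|: Y)%SET else 0.
Proof.
have [_ _ ->] := ext_list_mode (enum X) 0 (ext_list_piece (enum Y)).
have H l : sorted (fun i j : I => (i < j)%N) l ->
    foldr (fun b w => mode (etaL b) (-1) w) (ext_list (enum Y)) l =
    if has (mem Y) l then 0 else
    (-1) ^+ (\sum_(x <- l) below x Y)%N *: ext_mono ([set x in l] :|: Y)%SET.
  elim: l => [_|b l IH] /=.
    rewrite big_nil scale1r; congr (ext_mono _); apply/setP => d.
    by rewrite !inE.
  rewrite (path_sortedE (fun _ _ _ => @ltn_trans _ _ _)) => /andP[/allP bl /IH ->].
  case: ifP => hl; first by rewrite orbT mode0r.
  have bl0 : b \notin l by apply/negP => /bl; rewrite ltnn.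
  rewrite orbF modeZr ext_mono_wedge !inE (negbTE bl0) /=.
  case: ifP => bY; first by rewrite scaler0.
  rewrite scalerA -exprD big_cons addnC.
  have -> : below b ([set x in l] :|: Y)%SET = below b Y.
    rewrite /below; congr (#|pred_of_set _|); apply/setP => d; rewrite !inE.
    by case dl: (d \in l) => //=; have := bl d dl; case: ltngtP; rewrite ?andbF.
  by congr (_ *: ext_mono _); apply/setP => d; rewrite !inE orbA.
rewrite H; last exact: enum_set_sorted.
have -> : has (mem Y) (enum X) = ~~ [disjoint X & Y]%B.
  apply/hasP/pred0Pn => [[d]|[d /andP[dX dY]]].
    by rewrite mem_enum => dX dY; exists d; rewrite /= dX.
  by exists d; rewrite ?mem_enum.
case: [disjoint X & Y]%B => //=; rewrite /shuffle_sign -big_enum; congr (_ *: ext_mono _).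
by apply/setP => d; rewrite !inE mem_enum.
Qed.

Definition ext_seq X : seq ((bool * I) * nat) :=
  sort (@creation_le _) [seq ((false, a), 0%N) | a <- enum X].

Lemma mem_ext_seq X q :
  (q \in ext_seq X) = [&& q.1.1 == false, q.2 == 0%N & q.1.2 \in X].
Proof.
rewrite mem_sort; case: q => [[b a] k] /=; apply/mapP/and3P.
  by move=> [c]; rewrite mem_enum => cX [-> -> ->]; rewrite !eqxx cX.
by move=> [/eqP -> /eqP -> aX]; exists a; rewrite ?mem_enum.
Qed.

Lemma ext_seq_sorted X : sorted (@creation_lt _) (ext_seq X).
Proof.
by apply: sort_creation_lt; rewrite map_inj_uniq ?enum_uniq // => a b [].
Qed.

(** The ascending order of [ext_mono] need not be the order used to sort
    monomials, whence an unspecified nonzero scalar, which also contains the signs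
    of the metric. *)
Lemma ext_seqE X : exists2 c : C, c != 0 & ext_mono X = c *: mono (ext_seq X).
Proof.
have k0 a : ksgn a != 0 :> C.
  by apply/eqP => E; have := ksgn_sq a; rewrite E mul0r => /esym/eqP; rewrite oner_eq0.
have [c c0 E] : exists2 c : C, c != 0 &
    ext_mono X = c *: mono [seq ((false, a), 0%N) | a <- enum X].
  rewrite /ext_mono; elim: (enum X) => [|a l [c c0 E]] /=.
    by exists 1; rewrite ?oner_eq0 ?scale1r.
  exists (ksgn a * c); first by rewrite mulf_neq0.
  by rewrite E mode_etaL modeZr scalerA.
have [n En] := mono_perm hS (permEl (perm_sort (@creation_le _) _) :
  perm_eq (ext_seq X) [seq ((false, a), 0%N) | a <- enum X]).
exists (c * (-1) ^+ n); first by rewrite mulf_neq0 // signr_eq0.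
by rewrite E En scalerA -mulrA -expr2 sqrr_sign mulr1.
Qed.

Lemma ext_seq_inj : injective ext_seq.
Proof.
move=> X Y E; apply/setP => a.
by have := mem_ext_seq Y ((false, a), 0%N); rewrite -E mem_ext_seq.
Qed.

Lemma minimal_sorted_ext s : sorted (@creation_lt _) s ->
  all (fun q => (q.1.1 == false) && (q.2 == 0%N)) s -> exists X, s = ext_seq X.
Proof.
move=> ss hs; exists [set a | ((false, a), 0%N) \in s]%SET.
apply: sorted_creation_eq => // [|q]; first exact: ext_seq_sorted.
rewrite mem_ext_seq inE; case: q => [[b a] k] /=; apply/idP/and3P.
  by move=> qs; have /= /andP[/eqP E1 /eqP E2] := allP hs _ qs; subst; rewrite qs.
by move=> [/eqP -> /eqP ->].
Qed.

Lemma size_ext_seq X : size (ext_seq X) = #|X|.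
Proof. by rewrite size_sort size_map -cardE. Qed.

End Exterior.

(** * Gradings and derivations of the tensor product *)

Section TensorVA.
Variables (R : realType) (g : reductiveLie R) (V S T : vertexAlgebra R).
Variables (tens : V -> S -> T) (eta : bool * 'I_(dimg g) -> S).
Hypotheses (hS : is_symplectic_fermions eta) (hT : is_tensor_va tens).
Local Notation C := R[i].
Local Notation I := 'I_(dimg g).
Local Notation mono := (creation_monomial eta).
Local Notation dseq := (seq ((bool * I) * nat)).

Lemma va_tensor : is_tensor_product tens. Proof. by case: hT. Qed.

Lemma tensor_par a b x y : par a x -> par b y -> par (a (+) b) (tens x y).
Proof. by case: hT => _ _ H _; apply: H. Qed.

Lemma tensor_mode_sum a b x y u v n : par a y -> par b u ->
  mode (tens x u) n (tens y v) = (-1) ^+ (a && b) *: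
     \sum_(k \in [set: int]) tens (mode x k y) (mode u (n - k - 1) v).
Proof. by case: hT => _ _ _ H; apply: H. Qed.

Lemma tensor_mode_left x n y w :
  mode (tens x (vac S)) n (tens y w) = tens (mode x n y) w.
Proof.
have hTT := va_tensor.
apply: (@par_ind _ _ [set y | mode (tens x (vac S)) n (tens y w) = tens (mode x n y) w]).
  split=> [|a u v /= Eu Ev]; first by rewrite /= (tensor0l hTT) !mode0r (tensor0l hTT).
  by rewrite (tensorDl hTT) (tensorZl hTT) !(modeDr, modeZr) Eu Ev (tensorDl hTT) (tensorZl hTT).
move=> b {}y yb /=; rewrite (tensor_mode_sum _ _ _ yb (par_vac S)) andbF scale1r.
rewrite (fsum_single (i0 := n)) => [|k kn].
  by rewrite vac_mode subrr sub0r eqxx.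
rewrite vac_mode ifF ?(tensor0r hTT) //; apply/eqP => E; case/eqP: kn; lia.
Qed.

Lemma tensor_mode_right a b u n y w : par a y -> par b u ->
  mode (tens (vac V) u) n (tens y w) = (-1) ^+ (a && b) *: tens y (mode u n w).
Proof.
move=> ya ub; rewrite (tensor_mode_sum _ _ _ ya ub); congr (_ *: _).
rewrite (fsum_single (i0 := -1)) => [|k /negbTE kn].
  by rewrite vac_mode eqxx opprK addrK.
by rewrite vac_mode kn (tensor0l va_tensor).
Qed.

Lemma tensor_coordinates_exist : exists G : dseq -> {linear T -> V},
  [/\ forall s v, sorted (@creation_lt _) s -> G s (tens v (mono s)) = v,
      forall s t v, ~~ perm_eq s t -> G s (tens v (mono t)) = 0,
      forall s v w, exists c : C, G s (tens v w) = c *: v &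
      forall z, exists r : seq dseq, [/\ uniq r, all (sorted (@creation_lt _)) r,
        forall s, s \notin r -> G s z = 0 &
        z = \sum_(s <- r) tens (G s z) (mono s)]].
Proof.
have hTT := va_tensor.
have [co [co1 co0 coP]] := fermion_coordinates hS.
have [G GP] := choice (fun s => tensor_lin hTT (co s)).
have nsort s : ~~ sorted (@creation_lt _) s -> forall x, co s x = 0.
  move=> ns x; have [r [_ /allP rs r0 _]] := coP x; apply: r0.
  by apply: contra ns => /rs.
exists G; split.
- by move=> s v ss; rewrite GP co1 // scale1r.
- move=> s t v st; rewrite GP; have [ss|ns] := boolP (sorted (@creation_lt _) s).
    by rewrite co0 // scale0r.
  by rewrite nsort // scale0r.
- by move=> s v w; exists (co s w); rewrite GP.
have hP : subspace [set z | exists r : seq dseq, [/\ uniq r,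
    all (sorted (@creation_lt _)) r, forall s, s \notin r -> G s z = 0 &
        z = \sum_(s <- r) tens (G s z) (mono s)]].
  split; first by exists [::]; rewrite big_nil; split=> // s _; rewrite linear0.
  move=> a x y [r [ur sr r0 Ex]] [q [uq sq q0 Ey]].
  exists (undup (r ++ q)); split; first exact: undup_uniq.
  - by apply/allP => s; rewrite mem_undup mem_cat => /orP[/(allP sr)|/(allP sq)].
  - move=> s; rewrite mem_undup mem_cat negb_or => /andP[/r0 Er /q0 Eq].
    by rewrite linearP /= Er Eq scaler0 addr0.
  under eq_bigr do rewrite linearP /= (tensorDl hTT) (tensorZl hTT).
  rewrite big_split -scaler_sumr /=.
  have uu := undup_uniq (r ++ q).
  have rs : {subset r <= undup (r ++ q)} by move=> s sr'; rewrite mem_undup mem_cat sr'.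
  have qs : {subset q <= undup (r ++ q)}.
    by move=> s sq'; rewrite mem_undup mem_cat sq' orbT.
  have r0' s : s \notin r -> tens (G s x) (mono s) = 0.
    by move=> /r0 ->; rewrite (tensor0l hTT).
  have q0' s : s \notin q -> tens (G s y) (mono s) = 0.
    by move=> /q0 ->; rewrite (tensor0l hTT).
  by rewrite (sum_widen ur uu rs r0') (sum_widen uq uu qs q0') -Ex -Ey.
apply: (tensor_ind hTT hP) => v w; have [r [ur sr r0 Ew]] := coP w.
exists r; split=> // [s sr'|]; first by rewrite GP r0 // scale0r.
rewrite {1}Ew (tensor_sumr hTT); apply: eq_bigr => s _.
by rewrite GP (tensorZl hTT) (tensorZr hTT).
Qed.

(** The tensor product is a direct sum of copies of the matter algebra, one for
    each sorted monomial; [tcoef s] is the projection to the copy of [s], and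
    zero for unsorted [s]. *)
Definition tcoef : dseq -> {linear T -> V} := sval (cid tensor_coordinates_exist).

Lemma tcoef_id s v : sorted (@creation_lt _) s -> tcoef s (tens v (mono s)) = v.
Proof. by rewrite /tcoef; case: cid => G /= [H _ _ _]; apply: H. Qed.

Lemma tcoef_nperm s t v : ~~ perm_eq s t -> tcoef s (tens v (mono t)) = 0.
Proof. by rewrite /tcoef; case: cid => G /= [_ H _ _]; apply: H. Qed.

Lemma tcoef_scale s v w : exists c : C, tcoef s (tens v w) = c *: v.
Proof. by rewrite /tcoef; case: cid => G /= [_ _ H _]; apply: H. Qed.

Lemma tcoef_expand z : exists r : seq dseq, [/\ uniq r,
  all (sorted (@creation_lt _)) r, forall s, s \notin r -> tcoef s z = 0 &
  z = \sum_(s <- r) tens (tcoef s z) (mono s)].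
Proof. by rewrite /tcoef; case: cid => G /= [_ _ _ H]; apply: H. Qed.

Lemma tcoef_eq0 z : (forall s, tcoef s z = 0) -> z = 0.
Proof.
move=> z0; have [r [_ _ _ ->]] := tcoef_expand z.
by rewrite big1 // => s _; rewrite z0 (tensor0l va_tensor).
Qed.

Section Grading.
Variables (A : int -> set V) (deg : dseq -> int).
Hypothesis dA : direct_sum A.
Hypothesis degP : forall s t, perm_eq s t -> deg s = deg t.

Definition sf_grading (k : int) : set S :=
  lspan [set x | exists s, x = mono s /\ k = deg s].

Local Notation AT := (tensor_grading tens A sf_grading).

Let sA k : subspace (A k). Proof. by case: dA. Qed.

Lemma tensor_grading_subspace k : subspace (AT k).
Proof. exact: lspan_subspace. Qed.

Lemma tensor_grading_gen i s v : A i v -> AT (i + deg s) (tens v (mono s)).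
Proof.
move=> Av; apply: lspan_gen; exists i, (deg s), v, (mono s); split=> //.
by apply: lspan_gen; exists s.
Qed.

(** Coefficients turn the diagonal grading into a shifted grading of the matter
    algebra. *)
Lemma tensor_gradingP k z : AT k z <-> forall s, A (k - deg s) (tcoef s z).
Proof.
have hTT := va_tensor; split=> [zk s|zs]; last first.
  have [r [_ _ _ ->]] := tcoef_expand z.
  apply: subspace_sum => [|s _]; first exact: lspan_subspace.
  by rewrite -[k](subrK (deg s)); apply: tensor_grading_gen.
apply: (lspan_min (subspace_preim (tcoef s) (sA (k - deg s))) _ zk).
move=> _ [i [j [v [w [Av Sw <- ->]]]]] /=.
have sP : subspace [set w | A (i + j - deg s) (tcoef s (tens v w))].
  split=> [|a x y /= Ax Ay]; first by rewrite /= (tensor0r hTT) linear0; apply: subspace0.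
  by rewrite (tensorDr hTT) (tensorZr hTT) linearP; have [_] := sA (i + j - deg s); apply.
apply: (lspan_min sP _ Sw) => _ [t [-> ->]] /=.
have [st|nst] := boolP (perm_eq s t).
  rewrite (degP st) addrK; have [c ->] := tcoef_scale s v (mono t).
  exact: subspaceZ.
by rewrite tcoef_nperm //; apply: subspace0.
Qed.

Lemma tensor_grading_direct : direct_sum AT.
Proof.
have hTT := va_tensor; apply: direct_sum_intro.
- exact: tensor_grading_subspace.
- move=> z; have [r [_ _ _ ->]] := tcoef_expand z.
  apply: subspace_sum => [|s _]; first exact: lspan_subspace.
  have [q [_ _ ->]] := component_support dA (tcoef s z).
  rewrite (tensor_suml hTT); apply: subspace_sum => [|i _]; first exact: lspan_subspace.
  apply: lspan_gen; exists (i + deg s); apply: tensor_grading_gen.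
  exact: component_in dA _ _.
move=> r c ur Tc c0 k rk; apply: tcoef_eq0 => s.
have [_ _ /(_ (map (fun k => k - deg s) r) (fun j => tcoef s (c (j + deg s))))] := dA.
rewrite map_inj_uniq ?ur; last by move=> x y /addIr.
move=> /(_ isT) H; have := H _ _ (k - deg s).
rewrite subrK; apply.
- by move=> j; have /tensor_gradingP /(_ s) := Tc (j + deg s); rewrite addrK.
- rewrite big_map; under eq_bigr do rewrite subrK.
  by rewrite -linear_sum c0 linear0.
- by apply/mapP; exists k.
Qed.

End Grading.

(** Even derivations of the tensor product that kill the matter factor act on
    the fermionic factor alone. *)
Section Derivation.
Variables (delta : {linear T -> T}) (deta : bool * I -> S) (e : int).
Hypothesis dd : even_derivation delta.
Hypothesis d0 : forall x, delta (tens x (vac S)) = 0.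
Hypothesis dE : forall i, delta (tens (vac V) (eta i)) = tens (vac V) (deta i).
Hypothesis detaP : forall i, par true (deta i).
Hypothesis detaG : forall i (k : nat) h r d x, sf_piece eta h r d x ->
  sf_piece eta (h + 2 * k.+1%:Z) (r + 1) (d + dsgn i.1 + e)
    (mode (deta i) (- k.+1%:Z) x).

Fixpoint dmono (s : dseq) : S :=
  if s is q :: s' then
    mode (deta q.1) (- q.2.+1%:Z) (mono s') +
    mode (eta q.1) (- q.2.+1%:Z) (dmono s')
  else 0.

Lemma derivation_right a b v n u du w dw : par a v -> par b u -> par b du ->
  delta (tens (vac V) u) = tens (vac V) du ->
  delta (tens v w) = tens v dw ->
  delta (tens v (mode u n w)) = tens v (mode du n w + mode u n dw).
Proof.
move=> va ub dub Eu Ew; have hTT := va_tensor.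
have [_ dm] := dd.
have sg (x : T) : x = (-1) ^+ (a && b) *: ((-1) ^+ (a && b) *: x).
  by rewrite scalerA -expr2 sqrr_sign scale1r.
rewrite [tens v _]sg -(tensor_mode_right n w va ub) linearZ_LR /= dm Eu Ew.
rewrite (tensor_mode_right n w va dub) (tensor_mode_right n dw va ub).
by rewrite -scalerDr -sg (tensorDr hTT).
Qed.

Lemma derivation_mono v s : delta (tens v (mono s)) = tens v (dmono s).
Proof.
have hTT := va_tensor.
apply: (@par_ind _ _ [set v | delta (tens v (mono s)) = tens v (dmono s)]) => [|a {}v va].
  split=> [|a u w /= Eu Ew]; first by rewrite /= !(tensor0l hTT) linear0.
  by rewrite !(tensorDl hTT) !(tensorZl hTT) linearP /= Eu Ew.
rewrite /=; elim: s => [|[i k] s IH]; first by rewrite d0 (tensor0r hTT).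
exact: (derivation_right _ va (fermion_par hS i) (detaP i) (dE i) IH).
Qed.

Lemma dmono_piece s : sf_piece eta (hdeg s) (rdeg s) (ddeg s + e) (dmono s).
Proof.
elim: s => [|[i k] s IH] /=; first by apply: subspace0; exact: sf_piece_subspace.
apply: subspaceD; first exact: sf_piece_subspace.
  have := detaG i k (sf_piece_mono eta s); congr (sf_piece _ _ _ _ _).
  - by rewrite /hdeg big_cons /=; lia.
  - by rewrite /rdeg /=; lia.
  - by rewrite /ddeg big_cons /= -/(dsgn _); lia.
have := sf_piece_create i k IH; congr (sf_piece _ _ _ _ _).
- by rewrite /hdeg big_cons /=; lia.
- by rewrite /rdeg /=; lia.
- by rewrite /ddeg big_cons /= -/(dsgn _); lia.
Qed.

Lemma derivation_grading (A : int -> set V) (deg : dseq -> int) (c : int) :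
  (forall h r d x, sf_piece eta h r d x -> forall s, h = hdeg s -> r = rdeg s ->
     d = ddeg s + e -> sf_grading deg (deg s + c) x) ->
  forall k z, tensor_grading tens A (sf_grading deg) k z ->
     tensor_grading tens A (sf_grading deg) (k + c) (delta z).
Proof.
move=> Hdeg k z zk; have hTT := va_tensor.
have sG : subspace (tensor_grading tens A (sf_grading deg) (k + c)) by exact: lspan_subspace.
apply: (lspan_min (subspace_preim delta sG) _ zk).
move=> _ [i [j [v [w [Av Sw <- ->]]]]] /=.
have sP : subspace [set w | tensor_grading tens A (sf_grading deg) (i + j + c) (delta (tens v w))].
  split=> [|a x y /= Ax Ay].
    by rewrite /= (tensor0r hTT) linear0; apply: subspace0; exact: lspan_subspace.
  rewrite (tensorDr hTT) (tensorZr hTT) linearP.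
  apply: subspaceD; [exact: lspan_subspace| |exact: Ay].
  by apply: subspaceZ; [exact: lspan_subspace|].
apply: (lspan_min sP _ Sw) => _ [s [-> ->]] /=; rewrite derivation_mono -addrA.
apply: lspan_gen; exists i, (deg s + c), v, (dmono s); split=> //.
exact: (Hdeg _ _ _ _ (dmono_piece s)).
Qed.

End Derivation.

End TensorVA.

(** * The adjoint action and Lambda *)

Lemma sum_over_insert (n : nat) (M : nmodType) (b : 'I_n) (F : {set 'I_n} -> M) :
  \sum_(X : {set 'I_n} | b \in X) F X =
  \sum_(Y : {set 'I_n} | b \notin Y) F (b |: Y)%SET.
Proof.
rewrite (reindex_onto (fun Y : {set 'I_n} => (b |: Y)%SET) (fun X => (X :\ b)%SET)) /=.
  apply: eq_bigl => Y; rewrite setU11 /=; apply/eqP/idP => [<-|bY].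
    by rewrite finset.setD11.
  by rewrite finset.setU1K.
by move=> X bX; rewrite finset.setD1K.
Qed.

Section Adjoint.
Variables (R : realType) (g : reductiveLie R) (V S T : vertexAlgebra R).
Variables (tens : V -> S -> T) (eta : bool * 'I_(dimg g) -> S).
Hypotheses (hS : is_symplectic_fermions eta) (hT : is_tensor_va tens).
Variables (theta : 'I_(dimg g) -> {linear T -> T}) (Lam : {linear T -> T}).
Hypotheses (htheta : is_theta tens eta theta) (hLam : is_Lambda tens eta Lam).
Local Notation I := 'I_(dimg g).
Let hTT := va_tensor hT.

Definition theta_gen (a : I) (i : bool * I) : S :=
  - \sum_c fC a c i.2 *: eta (i.1, c).

Definition Lambda_gen (i : bool * I) : S := if i.1 then 0 else eta (true, i.2).

Lemma theta_genE a i : theta a (tens (vac V) (eta i)) = tens (vac V) (theta_gen a i).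
Proof.
have [_ _ H] := htheta a; case: i => s b.
have := H s b; rewrite /right_fermion => ->; rewrite /theta_gen -scaleN1r.
rewrite -[in RHS]scaleN1r (tensorZr hTT) (tensor_sumr hTT); congr (_ *: _).
by apply: eq_bigr => c _; rewrite (tensorZr hTT).
Qed.

Lemma theta_gen_par a i : par true (theta_gen a i).
Proof.
have sP := @par_sub R S true; apply: (subspaceN sP); apply: (subspace_sum _ sP) => c _.
by apply: (subspaceZ _ sP); exact: fermion_par hS _.
Qed.

Lemma theta_gen_piece a i (k : nat) h r d x : sf_piece eta h r d x ->
  sf_piece eta (h + 2 * k.+1%:Z) (r + 1) (d + dsgn i.1 + 0)
    (mode (theta_gen a i) (- k.+1%:Z) x).
Proof.
move=> px; rewrite addr0.
have sG := sf_piece_subspace eta (h + 2 * k.+1%:Z) (r + 1) (d + dsgn i.1).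
rewrite modeNl mode_suml; apply: (subspaceN sG); apply: (subspace_sum _ sG) => c _.
rewrite modeZl; apply: (subspaceZ _ sG); exact: (sf_piece_create (i.1, c) k px).
Qed.

Lemma Lambda_genE i : Lam (tens (vac V) (eta i)) = tens (vac V) (Lambda_gen i).
Proof.
have [_ _ H] := hLam; case: i => -[] b; have [Hf Ht] := H b; rewrite /Lambda_gen /=.
  by rewrite [LHS]Ht (tensor0r hTT).
exact: Hf.
Qed.

Lemma Lambda_gen_par i : par true (Lambda_gen i).
Proof.
rewrite /Lambda_gen; case: ifP => _; last exact: fermion_par hS _.
by apply: subspace0; exact: par_sub.
Qed.

Lemma Lambda_gen_piece i (k : nat) h r d x : sf_piece eta h r d x ->
  sf_piece eta (h + 2 * k.+1%:Z) (r + 1) (d + dsgn i.1 + 2)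
    (mode (Lambda_gen i) (- k.+1%:Z) x).
Proof.
move=> px; rewrite /Lambda_gen; case: i => -[] b /=.
  by rewrite mode0l; apply: subspace0; exact: sf_piece_subspace.
by have := sf_piece_create (true, b) k px; rewrite -addrA.
Qed.

Lemma theta_derivation a : even_derivation (theta a).
Proof. by have [] := htheta a. Qed.

Lemma Lambda_derivation : even_derivation Lam.
Proof. by have [] := hLam. Qed.

Lemma theta_left a x : theta a (tens x (vac S)) = 0.
Proof. by have [] := htheta a. Qed.

Lemma Lambda_left x : Lam (tens x (vac S)) = 0.
Proof. by have [] := hLam. Qed.

Lemma theta_grading_R a (A : int -> set V) k z :
  tensor_grading tens A (sf_grading eta rdeg) k z ->
  tensor_grading tens A (sf_grading eta rdeg) k (theta a z).
Proof.
rewrite -{2}[k]addr0.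
apply: (derivation_grading hS hT (theta_derivation a) (theta_left a)
  (theta_genE a) (theta_gen_par a) (theta_gen_piece a)).
move=> h r d x px s _ Er _; rewrite addr0.
by apply: lspan_mono px => y [t [-> _ E _]]; exists t; rewrite E Er.
Qed.

Lemma theta_grading_d a (A : int -> set V) k z :
  tensor_grading tens A (sf_grading eta ddeg) k z ->
  tensor_grading tens A (sf_grading eta ddeg) k (theta a z).
Proof.
rewrite -{2}[k]addr0.
apply: (derivation_grading hS hT (theta_derivation a) (theta_left a)
  (theta_genE a) (theta_gen_par a) (theta_gen_piece a)).
move=> h r d x px s _ _ Ed; rewrite addr0.
by apply: lspan_mono px => y [t [-> _ _ E]]; exists t; rewrite E Ed addr0.
Qed.

Lemma Lambda_grading_R (A : int -> set V) k z :
  tensor_grading tens A (sf_grading eta rdeg) k z ->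
  tensor_grading tens A (sf_grading eta rdeg) k (Lam z).
Proof.
rewrite -{2}[k]addr0.
apply: (derivation_grading hS hT Lambda_derivation Lambda_left
  Lambda_genE Lambda_gen_par Lambda_gen_piece).
move=> h r d x px s _ Er _; rewrite addr0.
by apply: lspan_mono px => y [t [-> _ E _]]; exists t; rewrite E Er.
Qed.

(** On the exterior algebra the adjoint action is the operator of second
    quantization, sum f_ab^c eta_c iota_b: both are derivations for multiplication
    by the generators. *)
Lemma theta_ext_list a v l : theta a (tens v (ext_list eta l)) =
  tens v (\sum_b \sum_c fC a b c *: mode (etaL eta c) (-1)
            (mode (eta (true, b)) 1 (ext_list eta l))).
Proof.
pose N w := \sum_b \sum_c fC a b c *: mode (etaL eta c) (-1) (mode (eta (true, b)) 1 w).
apply: (@par_ind _ _ [set v | theta a (tens v (ext_list eta l)) =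
    tens v (N (ext_list eta l))]) => [|p {}v vp].
  split=> [|k u w /= Eu Ew]; first by rewrite /= !(tensor0l hTT) linear0.
  by rewrite !(tensorDl hTT) !(tensorZl hTT) linearP /= Eu Ew.
rewrite /=; elim: l => [|b0 l IH].
  rewrite theta_left /N big1 ?(tensor0r hTT) // => b _; rewrite big1 // => c _.
  by rewrite /= (mode_vac_ge0 _ 1) mode0r scaler0.
have E : theta a (tens (vac V) (etaL eta b0)) =
    tens (vac V) (\sum_c fC a b0 c *: etaL eta c).
  rewrite (tensorZr hTT) linearZ_LR /= theta_genE -(tensorZr hTT); congr tens.
  rewrite /theta_gen /= scalerN -scaleNr scaler_sumr; apply: eq_bigr => c _.
  rewrite /etaL !scalerA; congr (_ *: _).
  rewrite [in RHS]fC_lower !mulNr -!mulrA [ksgn c * ksgn c]ksgn_sq mulr1 //.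
have parE : par true (\sum_c fC a b0 c *: etaL eta c).
  have sP := @par_sub R S true; apply: (subspace_sum _ sP) => c _.
  by apply: (subspaceZ _ sP); exact: (etaL_par hS).
rewrite /= (derivation_right hT (theta_derivation a) (-1) vp (etaL_par hS b0) parE E IH).
congr tens; rewrite /N mode_suml mode_sumr.
under [RHS]eq_bigr do under eq_bigr do rewrite (iota_etaL hS) modeBr modeZr scalerBr.
rewrite [RHS](eq_bigr (fun b => (b0 == b)%:R *: \sum_c fC a b c *: mode (etaL eta c) (-1) (ext_list eta l)
   + \sum_c fC a b c *: mode (etaL eta b0) (-1) (mode (etaL eta c) (-1)
        (mode (eta (true, b)) 1 (ext_list eta l))))); last first.
  move=> b _; rewrite scaler_sumr -big_split; apply: eq_bigr => c _ /=.
  by rewrite (etaL_anticomm hS c) scalerN opprK !scalerA mulrC.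
rewrite big_split /=; congr (_ + _).
  rewrite [RHS](bigD1 b0) //= eqxx scale1r [X in _ = _ + X]big1 ?addr0.
    by apply: eq_bigr => c _; rewrite modeZl.
  by move=> b; rewrite eq_sym => /negbTE ->; rewrite scale0r.
apply: eq_bigr => b _; rewrite mode_sumr; apply: eq_bigr => c _.
by rewrite modeZr.
Qed.

Lemma theta_ext_mono a v X : theta a (tens v (ext_mono eta X)) =
  \sum_b \sum_c fC a b c *: tens v (mode (etaL eta c) (-1)
            (mode (eta (true, b)) 1 (ext_mono eta X))).
Proof.
rewrite theta_ext_list (tensor_sumr hTT); apply: eq_bigr => b _.
by rewrite (tensor_sumr hTT); apply: eq_bigr => c _; rewrite (tensorZr hTT).
Qed.

End Adjoint.

(** * The comparison map on exterior forms *)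

Section ExteriorTensor.
Variables (R : realType) (g : reductiveLie R) (A : poissonData R).
Variables (S : vertexAlgebra R) (T : lmodType R[i]).
Variables (tens : A -> S -> T) (eta : bool * 'I_(dimg g) -> S).
Hypotheses (hS : is_symplectic_fermions eta) (hTT : is_tensor_product tens).
Local Notation C := R[i].
Local Notation I := 'I_(dimg g).
Local Notation ext := {ffun {set I} -> A}.
Implicit Types (u v : ext) (f : {linear S -> S}) (X Y Z : {set I}).

(** For [f] the identity this is the comparison map. A general [f] lets exterior
    multiplication and contraction be moved to the fermionic factor one at a time.
    The sign (-1)^|X| cancels the sign between Q^+ and the Koszul differential. *)
Definition Psi (f : S -> S) u : T :=
  \sum_(X : {set I}) (-1) ^+ #|X| *: tens (u X) (f (ext_mono eta X)).

Lemma Psi_linear f : linear (Psi f).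
Proof.
move=> a u v; rewrite /Psi scaler_sumr -big_split; apply: eq_bigr => X _ /=.
by rewrite !ffunE (tensorDl hTT) (tensorZl hTT) scalerDr !scalerA mulrC.
Qed.

Lemma wedgeE b u X :
  wedge b u X = (if b \in X then (-1) ^+ below b X *: u (X :\ b)%SET else 0).
Proof. by rewrite ffunE. Qed.

Lemma contractE b u X : contract b u X =
  (if b \in X then 0 else (-1) ^+ below b X *: u (b |: X)%SET).
Proof. by rewrite ffunE. Qed.

Lemma below_setU1 b X : b \notin X -> below b (b |: X)%SET = below b X.
Proof. by move=> bX; rewrite -[RHS]/(below b X) -(below_setD1 b (b |: X)%SET) finset.setU1K. Qed.

Lemma Psi_wedge f b u :
  Psi f (wedge b u) = - Psi (fun w => f (mode (etaL eta b) (-1) w)) u.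
Proof.
rewrite /Psi (bigID (fun X : {set I} => b \in X)) /= [X in _ + X]big1 ?addr0; last first.
  by move=> X /negbTE bX; rewrite wedgeE bX (tensor0l hTT) scaler0.
rewrite [in RHS](bigID (fun X : {set I} => b \in X)) /= [X in - (X + _)]big1 ?add0r; last first.
  by move=> X bX; rewrite (ext_mono_wedge hS) bX linear0 (tensor0r hTT) scaler0.
rewrite sum_over_insert -sumrN; apply: eq_bigr => Y bY.
rewrite wedgeE setU11 finset.setU1K // below_setU1 // (ext_mono_wedge hS) (negbTE bY).
rewrite (linearZ_LR f) (tensorZl hTT) (tensorZr hTT) cardsU1 bY exprS mulN1r.
by rewrite scaleNr.
Qed.

Lemma Psi_contract f b u :
  Psi f (contract b u) = - Psi (fun w => f (mode (eta (true, b)) 1 w)) u.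
Proof.
rewrite /Psi (bigID (fun X : {set I} => b \in X)) /= [X in X + _]big1 ?add0r; last first.
  by move=> X bX; rewrite contractE bX (tensor0l hTT) scaler0.
rewrite [in RHS](bigID (fun X : {set I} => b \in X)) /= [X in - (_ + X)]big1 ?addr0; last first.
  by move=> X /negbTE bX; rewrite (ext_mono_iota hS) bX linear0 (tensor0r hTT) scaler0.
rewrite sum_over_insert -sumrN; apply: eq_bigr => Y bY.
rewrite contractE (negbTE bY) (ext_mono_iota hS) setU11 finset.setU1K // below_setU1 //.
rewrite (linearZ_LR f) (tensorZl hTT) (tensorZr hTT) cardsU1 bY exprS mulN1r.
by rewrite scaleNr opprK.
Qed.

Lemma Psi_adjoint a u : Psi idfun (ext_adjoint a u) =
  \sum_b \sum_c fC a b c *: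
    Psi (fun w => mode (etaL eta c) (-1) (mode (eta (true, b)) 1 w)) u.
Proof.
pose h := GRing.isLinear.Build C ext T *:%R (Psi idfun) (Psi_linear idfun).
pose P : {linear ext -> T} := HB.pack (Psi idfun) h.
rewrite -[LHS]/(P _) linear_sum; apply: eq_bigr => b _.
rewrite linear_sum; apply: eq_bigr => c _; rewrite linearZ_LR; congr (_ *: _).
rewrite -[LHS]/(Psi idfun _) (Psi_wedge idfun) /=.
by rewrite (Psi_contract (modeL (etaL eta c) (-1))) opprK.
Qed.

(** Regrouping the pairs of disjoint subsets by their union, an operation that is
    exterior multiplication on the second factor becomes the extended operation on
    forms. *)
Lemma Psi_product (op : A -> A -> A) (opT : T -> T -> T) u v :
  (forall a x y z, opT (a *: x + y) z = a *: opT x z + opT y z) ->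
  (forall a x y z, opT z (a *: x + y) = a *: opT z x + opT z y) ->
  (forall X Y, opT (tens (u X) (ext_mono eta X)) (tens (v Y) (ext_mono eta Y)) =
     tens (op (u X) (iter #|X| (@pois_sgn R A) (v Y)))
          (mode (ext_mono eta X) (-1) (ext_mono eta Y))) ->
  opT (Psi idfun u) (Psi idfun v) = Psi idfun (ext_op op u v).
Proof.
move=> opl opr opE.
have op0l z : opT 0 z = 0.
  by apply: (addrI (opT 0 z)); rewrite -[X in X + _ = _]scale1r -opl scaler0 !addr0.
have op0r z : opT z 0 = 0.
  by apply: (addrI (opT z 0)); rewrite -[X in X + _ = _]scale1r -opr scaler0 !addr0.
have opsl (J : finType) (k : J -> C) F z : opT (\sum_j k j *: F j) z = \sum_j k j *: opT (F j) z.
  by elim/big_rec2: _ => // j a b _ <-; rewrite opl.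
have opsr (J : finType) (k : J -> C) F z : opT z (\sum_j k j *: F j) = \sum_j k j *: opT z (F j).
  by elim/big_rec2: _ => // j a b _ <-; rewrite opr.
rewrite /Psi opsl; under eq_bigr do rewrite opsr scaler_sumr.
pose t X Y := op (u X) (iter #|X| (@pois_sgn R A) (v Y)).
transitivity (\sum_(X : {set I}) \sum_(Y : {set I} | [disjoint X & Y]%B) (-1) ^+ #|(X :|: Y)%SET| *:
    (shuffle_sign X Y *: tens (t X Y) (ext_mono eta (X :|: Y)%SET))).
  apply: eq_bigr => X _; rewrite [RHS]big_mkcond /=; apply: eq_bigr => Y _.
  rewrite opE (ext_mono_product hS); case: ifP => dXY; last by rewrite (tensor0r hTT) !scaler0.
  rewrite (tensorZr hTT) scalerA -exprD; congr (_ ^+ _ *: _).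
  by have := leq_card_setU X Y => -[_]; rewrite dXY => /eqP ->.
rewrite [RHS](eq_bigr (fun Z => \sum_(X : {set I} | X \subset Z) (-1) ^+ #|Z| *:
    (shuffle_sign X (Z :\: X)%SET *: tens (t X (Z :\: X)%SET) (ext_mono eta Z)))); last first.
  move=> Z _; rewrite ffunE (tensor_suml hTT) scaler_sumr; apply: eq_bigr => X _.
  by rewrite (tensorZl hTT).
rewrite [RHS](exchange_big_dep xpredT) //=; apply: eq_bigr => X _.
rewrite (reindex_onto (fun Z : {set I} => (Z :\: X)%SET) (fun Y => (X :|: Y)%SET)) /=.
  apply: eq_big => Z.
    have -> : [disjoint X & (Z :\: X)%SET]%B.
      by rewrite -finset.setI_eq0; apply/eqP/setP => d; rewrite !inE; case: (d \in X).
    apply/eqP/idP => [<-|/fintype.subsetP XZ]; first exact: finset.subsetUl.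
    apply/setP => d; rewrite !inE; case dX: (d \in X) => //=.
    by rewrite (XZ d).
  by move=> /andP[_ /eqP E]; rewrite E.
move=> Y; rewrite -finset.setI_eq0 => /eqP/setP E.
apply/setP => d; have := E d; rewrite !inE.
by case: (d \in X); case: (d \in Y).
Qed.

End ExteriorTensor.

(** * Parity signs and normally ordered products *)

Section Parity.
Variables (R : realType) (V : vertexAlgebra R).

Lemma parity_sign_linear : linear (@parity_sign R V).
Proof.
move=> a x y; have dP := par_direct V; rewrite /parity_sign.
rewrite !(componentD dP, componentZ dP) scalerBr opprD !addrA.
by congr (_ + _); rewrite -!addrA; congr (_ + _); rewrite addrC.
Qed.

Lemma parity_sign_homog b x : @par R V b x -> parity_sign x = (-1) ^+ b *: x.
Proof.
move=> xb; have dP := par_direct V; rewrite /parity_sign.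
rewrite !(component_homog dP _ xb); case: b {xb} => /=.
  by rewrite sub0r expr1 scaleN1r.
by rewrite subr0 scale1r.
Qed.

Lemma iter_parity_linear m : linear (iter m (@parity_sign R V)).
Proof. by elim: m => [|m IH] a x y //=; rewrite IH parity_sign_linear. Qed.

Lemma iter_parity_homog m b x : @par R V b x ->
  iter m (@parity_sign R V) x = (-1) ^+ (b && odd m) *: x.
Proof.
move=> xb; elim: m => [|m IH] /=; first by rewrite andbF scale1r.
have sP := @par_sub R V b.
rewrite IH (parity_sign_homog (b := b)); last exact: subspaceZ.
rewrite scalerA; congr (_ *: _); case: b {xb sP IH} => /=; last by rewrite mulr1.
by case: (odd m); rewrite /= ?expr1 ?expr0 ?mulr1 // mulrNN mulr1.
Qed.

End Parity.

Section NormalOrdering.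
Variables (R : realType) (V : vertexAlgebra R).
Local Notation C := R[i].
Implicit Types (s : seq (V * int)).

Lemma normal_ordered_linear s : linear (normal_ordered s).
Proof.
elim: s => [|p s IH] a x y //=; case: ifP => _; first by rewrite IH modeDr modeZr.
by rewrite modeDr modeZr IH scalerDr !scalerA mulrC.
Qed.

Lemma normal_ordered_slot s1 s2 n a x y z :
  normal_ordered (s1 ++ (a *: x + y, n) :: s2) z =
  a *: normal_ordered (s1 ++ (x, n) :: s2) z + normal_ordered (s1 ++ (y, n) :: s2) z.
Proof.
elim: s1 z => [|p s1 IH] z /=.
  case: ifP => _; first by rewrite modeDl modeZl.
  by rewrite modeDl modeZl normal_ordered_linear scalerDr !scalerA mulrC.
rewrite !size_cat; case: ifP => _; first by rewrite IH modeDr modeZr.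
by rewrite IH scalerDr !scalerA mulrC.
Qed.

Lemma normal_ordered_slot_sum s1 s2 n (J : finType) (c : J -> C) (x : J -> V) z :
  normal_ordered (s1 ++ (- \sum_j c j *: x j, n) :: s2) z =
  - \sum_j c j *: normal_ordered (s1 ++ (x j, n) :: s2) z.
Proof.
have N0 : normal_ordered (s1 ++ (0, n) :: s2) z = 0.
  have := normal_ordered_slot s1 s2 n (-1) 0 0 z.
  by rewrite scaler0 addr0 scaleN1r addNr.
have := normal_ordered_slot s1 s2 n (-1) (\sum_j c j *: x j) 0 z.
rewrite addr0 N0 addr0 !scaleN1r => ->; congr (- _).
elim/big_rec2: _ => // j u v _ <-; by rewrite normal_ordered_slot.
Qed.

(** The Leibniz rule survives normal ordering because the order of the modes
    depends only on their indices. *)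
Lemma derivation_normal_ordered3 (d : {linear V -> V}) x1 x2 x3 n1 n2 n3 z :
  (forall x n y, d (mode x n y) = mode (d x) n y + mode x n (d y)) ->
  d (normal_ordered [:: (x1, n1); (x2, n2); (x3, n3)] z) =
  normal_ordered [:: (x1, n1); (x2, n2); (x3, n3)] (d z) +
  (normal_ordered [:: (d x1, n1); (x2, n2); (x3, n3)] z +
   (normal_ordered [:: (x1, n1); (d x2, n2); (x3, n3)] z +
    normal_ordered [:: (x1, n1); (x2, n2); (d x3, n3)] z)).
Proof.
move=> dm.
have step p s E : (forall w, d (normal_ordered s w) = normal_ordered s (d w) + E w) ->
  forall w, d (normal_ordered (p :: s) w) = normal_ordered (p :: s) (d w) +
    (normal_ordered ((d p.1, p.2) :: s) w +
     (if p.2 < 0 then mode p.1 p.2 (E w) else (-1) ^+ size s *: E (mode p.1 p.2 w))).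
  move=> dE w /=; case: ifP => _.
    by rewrite dm dE modeDr addrCA.
  rewrite linearZ_LR /= dE dm -scalerDr -scalerDr; congr (_ *: _).
  have := normal_ordered_linear s 1 (mode (d p.1) p.2 w) (mode p.1 p.2 (d w)).
  by rewrite !scale1r => ->; rewrite -!addrA addrCA.
have d1 w : d (normal_ordered [:: (x3, n3)] w) =
    normal_ordered [:: (x3, n3)] (d w) + normal_ordered [:: (d x3, n3)] w.
  rewrite (step (x3, n3) [::] (fun=> 0)) /=; last by move=> ?; rewrite addr0.
  by case: ifP => _; rewrite ?mode0r ?scaler0 addr0.
have d2 := step (x2, n2) _ _ d1.
rewrite (step (x1, n1) _ _ d2); congr (_ + (_ + _)) => /=.
by case: ifP => _; rewrite ?modeDr ?scalerDr.
Qed.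

End NormalOrdering.

Lemma leibniz_commutator (M : zmodType) (a b c d a' d' : M) :
  (a + b + (c + d)) - (a' + c + (b + d')) = (a - a') + (d - d').
Proof.
rewrite opprD addrACA (opprD a' c) (opprD b d') (addrACA a) (addrACA c) -addrA.
by rewrite (addrA (b - c)) -[b - c]opprB addNr add0r.
Qed.

Lemma sum_index_swap (K : fieldType) (M : lmodType K) (J : finType)
    (k : J -> K) (f : J -> J -> K) (x : J -> M) :
  \sum_c k c *: (- \sum_e f e c *: x e) = - \sum_c (\sum_e f c e * k e) *: x c.
Proof.
under [LHS]eq_bigr do rewrite scalerN scaler_sumr -sumrN.
rewrite exchange_big -sumrN; apply: eq_bigr => e _ /=.
rewrite scaler_suml -sumrN; apply: eq_bigr => c _.
by rewrite scalerA mulrC.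
Qed.

(** * Invariants and Hall-Littlewood vectors *)

Section Comparison.
Variables (R : realType) (g : reductiveLie R) (V S T : vertexAlgebra R).
Variables (U : gradedUnitary V) (D : internalGrading U).
Variables (H : hamiltonianAction g V).
Hypotheses (hCFT : CFT_type U) (hBPS : BPS_bound (trigrading_of D)).
Hypothesis hH : good_action U H.
Variables (tens : V -> S -> T) (eta : bool * 'I_(dimg g) -> S).
Hypotheses (hS : is_symplectic_fermions eta) (hT : is_tensor_va tens).
Variables (theta : 'I_(dimg g) -> {linear T -> T}) (Lam : {linear T -> T}).
Hypotheses (htheta : is_theta tens eta theta) (hLam : is_Lambda tens eta Lam).
Local Notation C := R[i].
Local Notation I := 'I_(dimg g).
Local Notation mono := (creation_monomial eta).
Local Notation J := (current H).
Local Notation t := (trigrading_of D).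
Local Notation A := (HL_poisson (trigrading_of D)).
Local Notation ext := {ffun {set I} -> A}.
Local Notation lc := (left_current tens J).
Local Notation rf := (right_fermion tens eta).
Local Notation Ps := (@Psi R g A S T tens eta).
Let hTT := va_tensor hT.
Let hTA : @is_tensor_product _ A S T tens := hTT.
Let PsL : linear (Ps idfun) := @Psi_linear R g A S T tens eta hTA idfun.
Let dR : direct_sum (tri_R t) := Rcharge_direct U.

(** Gradings are first studied on the whole tensor product, where they are direct
    sum decompositions, and then restricted to the invariants. *)
Definition tensor_tri : trigrading T := tensor_trigrading tens t (sf_trigrading eta).
Definition inv_tri : trigrading T :=
  restrict_trigrading tensor_tri (invariants tens J theta).
Local Notation tT := tensor_tri.
Local Notation tV := inv_tri.
Local Notation Inv := (invariants tens J theta).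

Lemma tensor_triR k : tri_R tT k = tensor_grading tens (Rcharge U) (sf_grading eta rdeg) k.
Proof. by []. Qed.

Lemma tensor_trid k : tri_d tT k = tensor_grading tens (intdeg D) (sf_grading eta ddeg) k.
Proof. by []. Qed.

Lemma tensor_triR_direct : direct_sum (tri_R tT).
Proof. exact: (tensor_grading_direct hS hT (Rcharge_direct U) (@rdeg_perm R g)). Qed.

Lemma tensor_trid_direct : direct_sum (tri_d tT).
Proof. exact: (tensor_grading_direct hS hT (intdeg_direct D) (@ddeg_perm R g)). Qed.

Let dRT := tensor_triR_direct.
Let ddT := tensor_trid_direct.

Definition adj (a : I) : {linear T -> T} := modeL (lc a) 0 \+ theta a.

Lemma adjE a z : adj a z = mode (lc a) 0 z + theta a z. Proof. by []. Qed.

Lemma invariantsP z : Inv z <-> forall a, adj a z = 0. Proof. by []. Qed.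

Lemma left_current_mode a n v w : mode (lc a) n (tens v w) = tens (mode (J a) n v) w.
Proof. exact: tensor_mode_left. Qed.

Lemma left_current_par a : par false (lc a).
Proof. exact: (tensor_par hT (current_par H a) (par_vac S)). Qed.

Lemma adj_mode a x n y : adj a (mode x n y) = mode (adj a x) n y + mode x n (adj a y).
Proof.
rewrite !adjE (even_zero_mode _ _ _ (left_current_par a)).
have [_ ->] := theta_derivation htheta a.
by rewrite modeDl modeDr addrACA.
Qed.

Lemma adj_left_current a b : adj a (lc b) = \sum_c fC a b c *: lc c.
Proof.
rewrite adjE left_current_mode (theta_left htheta) addr0 current_bracket.
by rewrite (tensor_suml hTT); apply: eq_bigr => c _; rewrite (tensorZl hTT).
Qed.

Lemma adj_right_fermion a s b : adj a (rf (s, b)) = - \sum_c fC a c b *: rf (s, c).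
Proof.
rewrite adjE [mode _ _ _]left_current_mode (mode_vac_ge0 _ 0) (tensor0l hTT) add0r.
by have [_ _ ->] := htheta a.
Qed.

Lemma left_current0_grading (B : int -> set V) (deg : seq ((bool * I) * nat) -> int) a k z :
  (forall i, B i `<=` [set x | B i (mode (J a) 0 x)]) ->
  tensor_grading tens B (sf_grading eta deg) k z ->
  tensor_grading tens B (sf_grading eta deg) k (mode (lc a) 0 z).
Proof.
move=> BJ; have sG := lspan_subspace.
apply: (lspan_min (subspace_preim (modeL (lc a) 0) (sG _ _ _))).
move=> _ [i [j [v [w [Bv Sw <- ->]]]]] /=; rewrite /modeL left_current_mode.
apply: lspan_gen; exists i, j, (mode (J a) 0 v), w; split=> //; exact: BJ.
Qed.

Lemma adj_R a k z : tri_R tT k z -> tri_R tT k (adj a z).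
Proof.
rewrite tensor_triR => zk; apply: subspaceD; first exact: lspan_subspace.
  by apply: left_current0_grading zk => i x; exact: current0_charge.
exact: (theta_grading_R hS hT htheta).
Qed.

Lemma adj_d a k z : tri_d tT k z -> tri_d tT k (adj a z).
Proof.
rewrite tensor_trid => zk; apply: subspaceD; first exact: lspan_subspace.
  by apply: left_current0_grading zk => i x; exact: current0_intdeg.
exact: (theta_grading_d hS hT htheta).
Qed.

Lemma invariants_subspace : subspace Inv.
Proof.
split; first by move=> a; rewrite -adjE linear0.
move=> a x y /invariantsP Ix /invariantsP Iy; apply/invariantsP => b.
by rewrite linearP Ix Iy scaler0 addr0.
Qed.

Lemma invariants_mode x n y : Inv x -> Inv y -> Inv (mode x n y).
Proof.
by move=> /invariantsP Ix /invariantsP Iy a; rewrite -adjE adj_mode Ix Iy mode0l mode0r addr0.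
Qed.

Lemma invariants_componentR k z : Inv z -> Inv (component (tri_R tT) k z).
Proof.
move=> /invariantsP Iz; apply/invariantsP => a.
by rewrite -(component_commute dRT (adj_R a)) Iz component0.
Qed.

Lemma invariants_componentd k z : Inv z -> Inv (component (tri_d tT) k z).
Proof.
move=> /invariantsP Iz; apply/invariantsP => a.
by rewrite -(component_commute ddT (adj_d a)) Iz component0.
Qed.

(** Since the invariants are a graded subspace, components computed among
    invariants agree with those computed in the whole tensor product. *)
Lemma inv_componentE k z : Inv z -> component (tri_R tV) k z = component (tri_R tT) k z.
Proof.
move=> Iz; have [s [us s0 E]] := component_support dRT z.
have : is_component (tri_R tV) k z (component (tri_R tT) k z).
  split; first by split; [exact: component_in dRT _ _|exact: invariants_componentR].
  exists (rem k s), (fun i => component (tri_R tT) i z); split.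
  - by rewrite mem_rem_uniq // inE eqxx.
  - by move=> i; split; [exact: component_in dRT _ _|exact: invariants_componentR].
  case sk: (k \in s); first by rewrite {1}E (big_rem _ sk).
  by rewrite s0 ?sk // add0r rem_id ?sk.
rewrite {2}/component; case: xgetP => [y _ Hy _|/(_ (component (tri_R tT) k z)) //].
apply/esym/(component_uniq dRT).
have [Hy1 [r [c [kr Rc Ez]]]] := Hy.
have [yR _] : tri_R tT k y /\ Inv y := Hy1.
split; first exact: yR.
exists r, c; split=> // i.
by have [] : tri_R tT i (c i) /\ Inv (c i) := Rc i.
Qed.

Lemma inv_gr_mode n k x y : Inv x -> Inv y -> gr_mode tV n k x y = gr_mode tT n k x y.
Proof.
move=> Ix Iy; apply: fsum_ext => p _; rewrite !(inv_componentE _ Ix) !(inv_componentE _ Iy).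
by apply: inv_componentE; apply: invariants_mode; apply: invariants_componentR.
Qed.

Lemma inv_gr_operator k (Q : T -> T) x : (forall z, Inv z -> Inv (Q z)) -> Inv x ->
  gr_operator tV k Q x = gr_operator tT k Q x.
Proof.
move=> IQ Ix; apply: fsum_ext => p _; rewrite !(inv_componentE _ Ix).
by apply: inv_componentE; apply: IQ; apply: invariants_componentR.
Qed.

Definition HL_valued (u : ext) : Prop := forall X, HL t (u X).

Lemma HL_subspace : subspace (HL t). Proof. exact: lspan_subspace. Qed.

Lemma HL_ind (P : set V) : subspace P ->
  (forall r d x, d <= 0 -> tri_piece t (r - d) r d x -> P x) ->
  forall x, HL t x -> P x.
Proof.
by move=> sP PP; apply: lspan_min => // x [r [d [d0 px]]]; exact: PP px.
Qed.

Lemma current_pois_br a x : HL t x -> gr_mode t 0 (-2) (J a) x = mode (J a) 0 x.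
Proof.
apply: (@HL_ind [set x | gr_mode t 0 (-2) (J a) x = mode (J a) 0 x]) => [|r d y d0 [[yw yr] yd]].
  split=> [|k y z /= Ey Ez].
    rewrite /= mode0r; have := gr_mode_linearr dR 0 (-2) (J a) (-1) 0 0.
    by rewrite scaler0 addr0 scaleN1r addrC subrr.
  by rewrite gr_mode_linearr // Ey Ez modeDr modeZr.
rewrite /= (gr_mode_homog dR _ _ (current_charge hCFT hH a) yr).
have -> : 2 + r + -2 = r by lia.
by apply: (component_id dR); exact: current0_charge.
Qed.

Lemma adj_Psi a u : HL_valued u -> adj a (Ps idfun u) = Ps idfun (@ext_action R g A J a u).
Proof.
move=> uHL; rewrite /ext_action.
have -> : Ps idfun (([ffun X => pois_br (J a : A) (u X)] : ext) + ext_adjoint a u) =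
    Ps idfun [ffun X => pois_br (J a : A) (u X)] + Ps idfun (ext_adjoint a u).
  by have := PsL 1 [ffun X => pois_br (J a : A) (u X)] (ext_adjoint a u); rewrite !scale1r.
rewrite adjE; congr (_ + _).
  rewrite /Psi mode_sumr; apply: eq_bigr => X _; rewrite modeZr left_current_mode ffunE.
  by rewrite /= -current_pois_br.
rewrite (@Psi_adjoint R g A S T tens eta hS hTA) /Psi linear_sum.
under eq_bigr do rewrite linearZ_LR /= (theta_ext_mono hS hT htheta) scaler_sumr.
rewrite exchange_big /=; apply: eq_bigr => b _.
under eq_bigr do rewrite scaler_sumr.
rewrite exchange_big /=; apply: eq_bigr => c _.
by rewrite scaler_sumr; apply: eq_bigr => X _; rewrite !scalerA mulrC.
Qed.

(** The values of a form are recovered from its image, up to scalars. *)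
Lemma Psi_tcoef (X : {set I}) : exists2 c : C, c != 0 &
  forall w : ext, tcoef hS hT (ext_seq X) (Ps idfun w) = c *: (w X : V).
Proof.
have [c c0 Ec] := ext_seqE hS X; exists ((-1) ^+ #|X| * c).
  by rewrite mulf_neq0 // signr_eq0.
move=> w; rewrite /Psi linear_sum (bigD1 X) //= big1 ?addr0.
  by rewrite linearZ_LR /= Ec (tensorZr hTT) linearZ_LR /= tcoef_id ?ext_seq_sorted // scalerA.
move=> Y YX; rewrite linearZ_LR /=; have [k _ ->] := ext_seqE hS Y.
rewrite (tensorZr hTT) linearZ_LR /= tcoef_nperm ?scaler0 //.
apply: contra YX => /perm_mem E'; apply/eqP/(@ext_seq_inj R g).
by apply: sorted_creation_eq => [||q]; rewrite ?ext_seq_sorted ?E'.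
Qed.

Lemma Psi_inj u v : Ps idfun u = Ps idfun v -> u = v.
Proof.
move=> E; apply/ffunP => X; have [c c0 Ec] := Psi_tcoef X.
have := congr1 (tcoef hS hT (ext_seq X)) E; rewrite !Ec.
by move/(congr1 (fun x => c^-1 *: x)); rewrite !scalerA mulVf // !scale1r.
Qed.

Let Ps0 : Ps idfun 0 = 0.
Proof. by have := PsL (-1) 0 0; rewrite scaler0 addr0 scaleN1r addrC subrr. Qed.

Lemma ext_mono_sf_grading (X : {set I}) :
  [/\ sf_grading eta hdeg (2 * #|X|%:Z) (ext_mono eta X),
      sf_grading eta rdeg #|X|%:Z (ext_mono eta X) &
      sf_grading eta ddeg (- #|X|%:Z) (ext_mono eta X)].
Proof.
have := ext_list_sf_piece eta (enum X); rewrite -cardE => px.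
by split; apply: lspan_mono px => y [s [-> E1 E2 E3]]; exists s; rewrite ?E1 ?E2 ?E3.
Qed.

Lemma tensor_piece h r d x (X : {set I}) : tri_piece t h r d x ->
  tri_piece tT (h + 2 * #|X|%:Z) (r + #|X|%:Z) (d - #|X|%:Z) (tens x (ext_mono eta X)).
Proof.
move=> [[xh xr] xd]; have [mh mr md] := ext_mono_sf_grading X.
split; [split|]; apply: lspan_gen.
- by exists h, (2 * #|X|%:Z), x, (ext_mono eta X).
- by exists r, #|X|%:Z, x, (ext_mono eta X).
- by exists d, (- #|X|%:Z), x, (ext_mono eta X).
Qed.

Lemma hdeg_minimal (s : seq ((bool * I) * nat)) :
  all (fun q => (q.1.1 == false) && (q.2 == 0%N)) s -> hdeg s = 2 * rdeg s.
Proof.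
elim: s => [|[[b i] k] s IH]; first by rewrite /hdeg /rdeg big_nil.
by rewrite /= => /andP[/andP[/eqP/= -> /eqP ->] /IH]; rewrite /hdeg /rdeg big_cons /=; lia.
Qed.

Lemma ext_seq_minimal (X : {set I}) : all (fun q => (q.1.1 == false) && (q.2 == 0%N)) (ext_seq X).
Proof. by apply/allP => q; rewrite mem_ext_seq => /and3P[-> ->]. Qed.

Lemma HL_valued_linear a (u v : ext) : HL_valued u -> HL_valued v -> HL_valued (a *: u + v).
Proof.
move=> uH vH X; rewrite !ffunE; have [_] := HL_subspace; apply; [exact: uH|exact: vH].
Qed.

(** The bound forces the fermionic factor of a Hall-Littlewood vector into the
    exterior algebra on the eta^-_(-1). *)
Lemma HL_piece_ext r d x : d <= 0 -> tri_piece tT (r - d) r d x ->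
  exists2 u : ext, HL_valued u & x = Ps idfun u.
Proof.
move=> d0 [[xh xr] xd].
have hw := (proj1 (tensor_gradingP hS hT (wt_direct U) (@hdeg_perm R g) _ _)) xh.
have hr := (proj1 (tensor_gradingP hS hT (Rcharge_direct U) (@rdeg_perm R g) _ _)) xr.
have hd := (proj1 (tensor_gradingP hS hT (intdeg_direct D) (@ddeg_perm R g) _ _)) xd.
pose f s := tcoef hS hT s x.
have pf s : tri_piece t (r - d - hdeg s) (r - rdeg s) (d - ddeg s) (f s).
  by split; [split; [exact: hw|exact: hr]|exact: hd].
have f0 s : f s != 0 -> all (fun q => (q.1.1 == false) && (q.2 == 0%N)) s.
  move=> fs; apply: deg_excess_eq; rewrite leNgt; apply/negP => lt.
  by move/eqP: fs; apply; apply: (hBPS _ (pf s)); lia.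
have cX (X : {set I}) : exists c : C, c != 0 /\ ext_mono eta X = c *: mono (ext_seq X).
  by have [c] := ext_seqE hS X; exists c.
have [c cP] := choice cX.
have c0 X : c X != 0 by case: (cP X).
have cE X : ext_mono eta X = c X *: mono (ext_seq X) by case: (cP X).
pose u : ext := [ffun X : {set I} => ((-1) ^+ #|X| * (c X)^-1) *: f (ext_seq X)].
exists u.
  move=> X; rewrite ffunE; apply: subspaceZ; first exact: HL_subspace.
  case: (eqVneq (f (ext_seq X)) 0) => [->|fX]; first exact: subspace0 (HL_subspace).
  have pX := pf (ext_seq X).
  have E : r - d - hdeg (ext_seq X) = r - rdeg (ext_seq X) - (d - ddeg (ext_seq X)).
    have := hdeg_minimal (ext_seq_minimal X); have := ddeg_minimal (ext_seq_minimal X).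
    by lia.
  apply: lspan_gen; exists (r - rdeg (ext_seq X)), (d - ddeg (ext_seq X)); split.
    exact: (BPS_HL hBPS pX E fX).
  by rewrite -E.
have [q [uq sq q0 Ex]] := tcoef_expand hS hT x.
rewrite {1}Ex -(@fsum_seqT _ _ q) //; last by move=> s /q0 ->; rewrite (tensor0l hTT).
rewrite (@fsum_seqT _ _ (map (@ext_seq R g) (enum {: {set I}}))).
- rewrite big_map big_enum /Psi; apply: eq_bigr => X _.
  rewrite ffunE cE (tensorZl hTA) (tensorZr hTT) !scalerA -/(f _).
  by rewrite mulrA mulrA -expr2 sqrr_sign mul1r mulVf // scale1r.
- by rewrite map_inj_uniq ?enum_uniq //; exact: ext_seq_inj.
move=> s sn; case: (eqVneq (f s) 0) => [fs|fs]; first by rewrite -/(f s) fs (tensor0l hTT).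
have ss : sorted (@creation_lt _) s.
  have := allP sq s; apply; apply: contraT => /q0 E.
  by move/eqP: fs => /(_ E).
have [X EX] := minimal_sorted_ext ss (f0 s fs).
by case/negP: sn; rewrite EX; apply/mapP; exists X; rewrite ?mem_enum.
Qed.

Lemma HL_Psi (u : ext) : HL_valued u -> HL tT (Ps idfun u).
Proof.
move=> uH; apply: subspace_sum => [|X _]; first exact: lspan_subspace.
apply: subspaceZ; first exact: lspan_subspace.
have sP : subspace [set v : V | HL tT (tens v (ext_mono eta X))].
  split=> [|a v w /= Hv Hw]; first by rewrite /= (tensor0l hTT); apply: subspace0; exact: lspan_subspace.
  by rewrite (tensorDl hTT) (tensorZl hTT); have [_] : subspace (HL tT) := lspan_subspace _; apply.
apply: (HL_ind sP _ (uH X)) => r d v d0 pv /=.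
apply: lspan_gen; exists (r + #|X|%:Z), (d - #|X|%:Z); split; first by lia.
have := tensor_piece X pv.
by rewrite (_ : r - d + 2 * #|X|%:Z = r + #|X|%:Z - (d - #|X|%:Z)) //; lia.
Qed.

Lemma HL_tensorP x : HL tT x <-> exists2 u : ext, HL_valued u & x = Ps idfun u.
Proof.
split=> [|[u uH ->]]; last exact: HL_Psi.
have sP : subspace [set x | exists2 u : ext, HL_valued u & x = Ps idfun u].
  split; first by exists 0 => // X; rewrite ffunE; exact: subspace0 (HL_subspace).
  move=> a _ _ [u uH ->] [v vH ->]; exists (a *: u + v); last by rewrite PsL.
  exact: HL_valued_linear.
by apply: lspan_min sP _ x => x [r [d [d0 px]]]; exact: HL_piece_ext px.
Qed.

(** The homogeneous components of an invariant vector are invariant, as the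
    adjoint action preserves charge and internal degree, and these determine the
    weight of a Hall-Littlewood vector. *)
Lemma HL_invariantsP x : HL tV x <-> HL tT x /\ Inv x.
Proof.
have sI : subspace Inv by exact: invariants_subspace.
split.
  have sP : subspace (HL tT `&` Inv) by apply: subspaceI => //; exact: lspan_subspace.
  apply: (lspan_min sP) => y [r [d [d0 [[[yh yI] [yr _]] [yd _]]]]].
  by split=> //; apply: lspan_gen; exists r, d.
move=> [[n [c [e [eP ->]]]] Ix].
have [r rP] := choice eP.
have [d dP] := choice rP.
pose P p q := component (tri_d tT) q (component (tri_R tT) p (\sum_(i < n) c i *: e i)).
have PE p q : P p q = \sum_(i < n) (if (p == r i) && (q == d i) then c i *: e i else 0).
  rewrite /P (component_sum dRT) (component_sum ddT); apply: eq_bigr => i _.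
  have [_ [[_ er] ed]] := dP i.
  rewrite (componentZ dRT) (componentZ ddT) (component_homog dRT p er).
  case: eqP => _ /=; last by rewrite (component0 ddT) scaler0.
  rewrite (component_homog ddT q ed); case: eqP => // _; by rewrite scaler0.
have HP p q : HL tV (P p q).
  have [qp|qn] := leP q 0; last first.
    rewrite PE big1 => [|i _]; first by apply: subspace0; exact: lspan_subspace.
    by case: andP => // -[_ /eqP qd]; have [d0 _] := dP i; rewrite qd ltNge d0 in qn.
  have PI : Inv (P p q).
    apply: (invariants_componentd).
    exact: (invariants_componentR).
  apply: lspan_gen; exists p, q; split=> //; split; [split|]; split=> //.
  - rewrite PE; apply: subspace_sum => [|i _]; first exact: lspan_subspace.
    case: andP => [[/eqP -> /eqP ->]|_]; last by apply: subspace0; exact: lspan_subspace.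
    by apply: subspaceZ; [exact: lspan_subspace|have [_ [[]]] := dP i].
  - rewrite PE; apply: subspace_sum => [|i _]; first exact: lspan_subspace.
    case: andP => [[/eqP -> _]|_]; last by apply: subspace0; exact: lspan_subspace.
    by apply: subspaceZ; [exact: lspan_subspace|have [_ [[]]] := dP i].
  - exact: component_in ddT _ _.
have [s [_ _ ->]] := component_support dRT (\sum_(i < n) c i *: e i).
apply: subspace_sum => [|p _]; first exact: lspan_subspace.
have [s' [_ _ ->]] := component_support ddT (component (tri_R tT) p (\sum_(i < n) c i *: e i)).
by apply: subspace_sum => [|q _]; [exact: lspan_subspace|exact: HP].
Qed.

Definition ext_carrier (u : ext) : Prop :=
  HL_valued u /\ forall a, @ext_action R g A J a u = 0.

Lemma HL_PsiP x : HL tV x <-> exists2 u : ext, ext_carrier u & x = Ps idfun u.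
Proof.
split=> [/HL_invariantsP[/HL_tensorP[u uH ->] /invariantsP Iu]|[u [uH ua] ->]].
  exists u => //; split=> // a; apply: (Psi_inj); rewrite Ps0.
  by rewrite -(adj_Psi) // Iu.
apply/HL_invariantsP; split; first exact: HL_Psi.
by apply/invariantsP => a; rewrite (adj_Psi) // ua Ps0.
Qed.

(** * Product and bracket *)

Lemma ext_piece_rdeg l x : ext_piece eta l x -> sf_grading eta rdeg l%:Z x.
Proof. by apply: lspan_mono => y [s [-> E _]]; exists s; rewrite /rdeg E. Qed.

(** A fermionic factor of known charge just shifts the components. *)
Lemma component_tens k l y w : sf_grading eta rdeg l w ->
  component (tri_R tT) k (tens y w) = tens (component (tri_R t) (k - l) y) w.
Proof.
move=> wl; have [s [us s0 Ey]] := component_support dR y.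
rewrite {1}Ey (tensor_suml hTT) (component_sum dRT).
rewrite [in RHS]Ey (component_sum dR) (tensor_suml hTT).
apply: eq_bigr => i _.
have yi : tri_R t i (component (tri_R t) i y) by exact: component_in dR _ _.
have Ti : tri_R tT (i + l) (tens (component (tri_R t) i y) w).
  by apply: lspan_gen; exists i, l, (component (tri_R t) i y), w.
rewrite (component_homog dRT _ Ti) (component_homog dR _ yi) subr_eq.
by case: eqP => // _; rewrite (tensor0l hTT).
Qed.

(** Among the modes of the fermionic factor only the (-1)-mode contributes to
    the leading component: larger modes vanish, and smaller ones come with modes
    of the matter factor that miss the required charge. *)
Lemma tensor_gr_mode n k r1 d1 r2 d2 v w (X Y : {set I}) :
  (forall j, n < j -> component (tri_R t) (r1 + r2 + k) (mode v j w) = 0) ->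
  tri_piece t (r1 - d1) r1 d1 v -> tri_piece t (r2 - d2) r2 d2 w ->
  gr_mode tT n k (tens v (ext_mono eta X)) (tens w (ext_mono eta Y)) =
  tens (gr_mode t n k v (iter #|X| (@parity_sign R V) w))
       (mode (ext_mono eta X) (-1) (ext_mono eta Y)).
Proof.
move=> low pv pw; have [[_ vr] _] := pv; have [[_ wr] wd] := pw.
have [[_ vX] _] := tensor_piece X pv.
have [[_ wY] _] := tensor_piece Y pw.
rewrite (gr_mode_homog dRT _ _ vX wY).
have wp := intdeg_par wd.
have Xp : par (odd #|X|) (ext_mono eta X).
  by rewrite cardE; exact: (ext_list_par hS).
rewrite (tensor_mode_sum hT _ _ _ wp Xp) (componentZ dRT).
rewrite (iter_parity_homog _ wp).
have -> : gr_mode t n k v ((-1) ^+ (oddz d2 && odd #|X|) *: w) =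
    (-1) ^+ (oddz d2 && odd #|X|) *: component (tri_R t) (r1 + r2 + k) (mode v n w).
  have wr' : tri_R t r2 ((-1) ^+ (oddz d2 && odd #|X|) *: w).
    by apply: subspaceZ => //; exact: Rcharge_subspace.
  by rewrite (gr_mode_homog dR _ _ vr wr') modeZr (componentZ dR).
rewrite (tensorZl hTT); congr (_ *: _).
pose F j := tens (mode v j w) (mode (ext_mono eta X) (n - j - 1) (ext_mono eta Y)).
have XY j : ext_piece eta (#|X| + #|Y|) (mode (ext_mono eta X) j (ext_mono eta Y)).
  have := ext_list_piece eta (enum Y); rewrite -cardE => /(ext_list_mode hS (enum X) j) [].
  by rewrite -cardE.
have Xge j : 0 <= j -> mode (ext_mono eta X) j (ext_mono eta Y) = 0.
  by have [_ Hj _] := ext_list_mode hS (enum X) j (ext_list_piece eta (enum Y)).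
have cF j : component (tri_R tT) (r1 + #|X|%:Z + (r2 + #|Y|%:Z) + k) (F j) =
    tens (component (tri_R t) (r1 + r2 + k) (mode v j w))
      (mode (ext_mono eta X) (n - j - 1) (ext_mono eta Y)).
  rewrite /F (component_tens _ _ (ext_piece_rdeg (XY _))); congr (tens (component _ _ _) _).
  by lia.
(* Truncation bounds j from above, and the fermionic modes bound it from below. *)
have [N vN] := mode_trunc v w.
pose s := [seq n + i%:Z | i <- iota 0 `|N - n|.+1].
have us : uniq s by rewrite map_inj_uniq ?iota_uniq // => i j /addrI [].
have Fs j : j \notin s -> F j = 0.
  move=> js; case: (ltP j n) => [jn|nj].
    by rewrite /F Xge ?(tensor0r hTT) //; lia.
  rewrite /F vN ?(tensor0l hTT) // leNgt; apply: contra js => jN.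
  by apply/mapP; exists `|j - n|%N; rewrite ?mem_iota; lia.
rewrite (fsum_seqT us Fs) (component_sum dRT) -fsum_seqT //; last first.
  by move=> j /Fs ->; rewrite (component0 dRT).
rewrite (fsum_single (i0 := n)) => [|j jn].
  by rewrite cF subrr sub0r.
rewrite cF; case: (ltP n j) => [lt|le]; first by rewrite low // (tensor0l hTT).
by rewrite Xge ?(tensor0r hTT) //; move/eqP: jn => jn; lia.
Qed.

Lemma HL_tensor_gr_mode n k v w (X Y : {set I}) :
  (forall r1 d1 r2 d2 v w j, d1 <= 0 -> d2 <= 0 -> tri_piece t (r1 - d1) r1 d1 v ->
    tri_piece t (r2 - d2) r2 d2 w -> n < j ->
    component (tri_R t) (r1 + r2 + k) (mode v j w) = 0) ->
  HL t v -> HL t w ->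
  gr_mode tT n k (tens v (ext_mono eta X)) (tens w (ext_mono eta Y)) =
  tens (gr_mode t n k v (iter #|X| (@parity_sign R V) w))
       (mode (ext_mono eta X) (-1) (ext_mono eta Y)).
Proof.
move=> low vH wH.
have lin0 (W W' : lmodType C) (f : W -> W') : linear f -> f 0 = 0.
  by move=> fl; have := fl (-1) 0 0; rewrite scaler0 addr0 scaleN1r addNr.
have sP : subspace [set v | gr_mode tT n k (tens v (ext_mono eta X)) (tens w (ext_mono eta Y)) =
  tens (gr_mode t n k v (iter #|X| (@parity_sign R V) w))
       (mode (ext_mono eta X) (-1) (ext_mono eta Y))].
  split=> [|a x y /= Ex Ey].
    rewrite /= (tensor0l hTT) (lin0 _ _ _ (gr_mode_linearl dRT n k _)).
    by rewrite (lin0 _ _ _ (gr_mode_linearl dR n k _)) (tensor0l hTT).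
  rewrite (tensorDl hTT) (tensorZl hTT) (gr_mode_linearl dRT) Ex Ey.
  by rewrite (gr_mode_linearl dR) (tensorDl hTT) (tensorZl hTT).
apply: (HL_ind sP _ vH) => r1 d1 {v sP vH} v d10 pv.
have sP : subspace [set w | gr_mode tT n k (tens v (ext_mono eta X)) (tens w (ext_mono eta Y)) =
  tens (gr_mode t n k v (iter #|X| (@parity_sign R V) w))
       (mode (ext_mono eta X) (-1) (ext_mono eta Y))].
  split=> [|a x y /= Ex Ey].
    rewrite /= (tensor0l hTT) (lin0 _ _ _ (gr_mode_linearr dRT n k _)).
    rewrite (lin0 _ _ _ (iter_parity_linear (V := V) #|X|)).
    by rewrite (lin0 _ _ _ (gr_mode_linearr dR n k _)) (tensor0l hTT).
  rewrite (tensorDl hTT) (tensorZl hTT) (gr_mode_linearr dRT) Ex Ey.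
  by rewrite iter_parity_linear (gr_mode_linearr dR) (tensorDl hTT) (tensorZl hTT).
apply: (HL_ind sP _ wH) => r2 d2 {w sP wH} w d20 pw.
by apply: (tensor_gr_mode X Y _ pv pw) => j; exact: (low _ _ _ _ _ _ _ d10 d20 pv pw).
Qed.

Lemma Psi_gr_product (u v : ext) : HL_valued u -> HL_valued v ->
  gr_mode tT (-1) 0 (Ps idfun u) (Ps idfun v) = Ps idfun (ext_op (@pois_mul R A) u v).
Proof.
move=> uH vH; apply: (@Psi_product R g A S T tens eta hS hTA).
- by move=> a x y z; rewrite gr_mode_linearl.
- by move=> a x y z; rewrite gr_mode_linearr.
move=> X Y; apply: HL_tensor_gr_mode => //.
move=> r1 d1 r2 d2 x y j _ _ [[_ xr] _] [[_ yr] _] j0.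
by rewrite addr0; apply: product_lower => //; lia.
Qed.

Lemma Psi_gr_bracket (u v : ext) : HL_valued u -> HL_valued v ->
  gr_mode tT 0 (-2) (Ps idfun u) (Ps idfun v) = Ps idfun (ext_op (@pois_br R A) u v).
Proof.
move=> uH vH; apply: (@Psi_product R g A S T tens eta hS hTA).
- by move=> a x y z; rewrite gr_mode_linearl.
- by move=> a x y z; rewrite gr_mode_linearr.
move=> X Y; apply: HL_tensor_gr_mode => //.
move=> r1 d1 r2 d2 x y j d10 d20 px py j0.
exact: (bracket_lower hBPS j0 d10 d20 px py).
Qed.

(** * The differential *)

Lemma Lambda_left_current (a : I) n z : Lam (mode (lc a) n z) = mode (lc a) n (Lam z).
Proof.
have [_ ->] := Lambda_derivation hLam.
by rewrite (Lambda_left hLam) mode0l add0r.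
Qed.

(** The commutator of the two derivations is again a derivation killing the
    matter factor, and it vanishes on the generators, so it is zero. *)
Lemma Lambda_theta a z : Lam (theta a z) = theta a (Lam z).
Proof.
pose E : {linear T -> T} := (Lam \o theta a) \- (theta a \o Lam).
suff H0 : forall x, E x = 0 by apply/eqP; rewrite -subr_eq0; apply/eqP/(H0 z).
have [Lp Lm] := Lambda_derivation hLam; have [tp tm] := theta_derivation htheta a.
have EE x : E x = Lam (theta a x) - theta a (Lam x) by [].
have dE : even_derivation E.
  split=> [b x xb|x n y].
    by apply: (subspaceB (@par_sub R T b)); [apply: Lp; apply: tp|apply: tp; apply: Lp].
  rewrite !EE tm Lm (linearD Lam) (linearD (theta a)) !Lm !tm modeBr modeDl modeNl.
  exact: leibniz_commutator.
have E0 x : E (tens x (vac S)) = 0.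
  by rewrite EE (theta_left htheta) (Lambda_left hLam) (linear0 Lam) (linear0 (theta a)) subrr.
have Eeta i : E (tens (vac V) (eta i)) = tens (vac V) 0.
  case: i => -[] c; rewrite EE (theta_genE hT htheta) (Lambda_genE hT hLam).
    rewrite /Lambda_gen /= (tensor0r hTT) (linear0 (theta a)) subr0 /theta_gen /= -scaleN1r.
    rewrite (tensorZr hTT) (linearZ_LR Lam) (tensor_sumr hTT) linear_sum big1 ?scaler0 // => e _.
    rewrite (tensorZr hTT) (linearZ_LR Lam) (Lambda_genE hT hLam).
    by rewrite /Lambda_gen /= (tensor0r hTT) scaler0.
  have tN w : tens (vac V) (- w) = - tens (vac V) w.
    by rewrite -scaleN1r (tensorZr hTT) scaleN1r.
  rewrite /Lambda_gen /= (theta_genE hT htheta) /theta_gen /= !tN (linearN Lam).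
  rewrite !(tensor_sumr hTT) linear_sum (tensor0r hTT).
  apply/eqP; rewrite subr_eq0; apply/eqP; congr (- _); apply: eq_bigr => e _.
  by rewrite !(tensorZr hTT) (linearZ_LR Lam) (Lambda_genE hT hLam).
have p0 i : par true ((fun _ : bool * I => 0 : S) i).
  by apply: subspace0; exact: par_sub.
have dm0 s : dmono eta (fun=> 0) s = 0.
  by elim: s => [|q s IH] //=; rewrite IH mode0r mode0l addr0.
move=> x; have [r [_ _ _ ->]] := tcoef_expand hS hT x.
rewrite linear_sum big1 // => s _.
by rewrite (derivation_mono hS hT dE E0 Eeta p0) dm0 (tensor0r hTT).
Qed.

Lemma invariants_Lambda z : Inv z -> Inv (Lam z).
Proof.
move=> /invariantsP Iz b; rewrite -adjE.
have -> : adj b (Lam z) = Lam (adj b z).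
  by rewrite !adjE linearD Lambda_left_current Lambda_theta.
by rewrite Iz linear0.
Qed.

Definition lin_term (n : int) (z : T) : T :=
  \sum_(a : I) n%:~R^-1 *: mode (rf (false, a)) (- n) (mode (lc a) n z).

Definition cubic_term (mn : int * int) (z : T) : T :=
  \sum_(a : I) \sum_(b : I) \sum_(c : I)
    (flow a b c / (2 * mn.1%:~R * mn.2%:~R)) *:
      normal_ordered [:: (rf (false, a), - mn.2); (rf (false, b), mn.1);
                         (rf (true, c), mn.2 - mn.1)] z.

Lemma QminusE z : Qminus lc rf z =
  \sum_(n \in [set n : int | n != 0]) lin_term n z +
  \sum_(mn \in [set mn : int * int | [&& mn.1 != 0, mn.2 != 0 & mn.1 != mn.2]])
     cubic_term mn z.
Proof. by []. Qed.

Lemma lin_term_linear n : linear (lin_term n).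
Proof.
move=> k x y; rewrite /lin_term scaler_sumr -big_split; apply: eq_bigr => a _ /=.
by rewrite !(modeDr, modeZr) scalerDr !scalerA mulrC.
Qed.

Lemma cubic_term_linear mn : linear (cubic_term mn).
Proof.
move=> k x y; rewrite /cubic_term scaler_sumr -big_split; apply: eq_bigr => a _ /=.
rewrite scaler_sumr -big_split; apply: eq_bigr => b _ /=.
rewrite scaler_sumr -big_split; apply: eq_bigr => c _ /=.
rewrite -[X in _ *: X = _]/(normal_ordered [:: (rf (false, a), - mn.2); (rf (false, b), mn.1);
                         (rf (true, c), mn.2 - mn.1)] (k *: x + y)).
by rewrite normal_ordered_linear scalerDr !scalerA mulrC.
Qed.

(** The contraction of eta^-, which transforms in the coadjoint representation,
    with the current, which transforms in the adjoint one, is invariant. *)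
Lemma adj_lin_term (a : I) n z : adj a (lin_term n z) = lin_term n (adj a z).
Proof.
have Xm := adj_mode a.
have Xr b := adj_right_fermion a false b.
have Xl := adj_left_current a.
move: (adj a) Xm Xr Xl => X Xm Xr Xl.
rewrite /lin_term linear_sum -scaler_sumr.
under eq_bigr do rewrite linearZ_LR.
rewrite -scaler_sumr; congr (_ *: _).
under eq_bigr => b _ do rewrite !Xm !modeDr Xr Xl addrA.
rewrite big_split /= [Y in Y + _ = _](_ : _ = 0) ?add0r //.
rewrite big_split /= [Y in _ + Y](_ : _ = \sum_b \sum_c fC a b c *:
     mode (rf (false, b)) (- n) (mode (lc c) n z)); last first.
  by apply: eq_bigr => b _; rewrite mode_suml mode_sumr; apply: eq_bigr => c _; rewrite modeZl modeZr.
rewrite exchange_big /= -big_split big1 // => b _ /=.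
rewrite modeNl mode_suml addrC; apply/eqP; rewrite subr_eq0; apply/eqP.
by apply: eq_bigr => c _; rewrite modeZl.
Qed.

Local Notation LT := lin_term.
Local Notation CT := cubic_term.

Lemma adj_cubic_term (d : I) mn z :
  adj d (CT mn z) = CT mn (adj d z).
Proof.
have Xm := adj_mode d.
have Xr := adj_right_fermion d.
move: (adj d) Xm Xr => X Xm Xr.
pose M a b c := normal_ordered [:: (rf (false, a), - mn.2); (rf (false, b), mn.1);
                         (rf (true, c), mn.2 - mn.1)] z.
pose k (a b c : I) : C := flow a b c / (2 * mn.1%:~R * mn.2%:~R).
have XM a b c : X (M a b c) = normal_ordered [:: (rf (false, a), - mn.2); (rf (false, b), mn.1);
                         (rf (true, c), mn.2 - mn.1)] (X z) +
    ((- \sum_e fC d e a *: M e b c) + ((- \sum_e fC d e b *: M a e c) + (- \sum_e fC d e c *: M a b e))).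
  rewrite /M (derivation_normal_ordered3 _ _ _ _ _ _ _ Xm) !Xr; congr (_ + (_ + (_ + _))).
  - exact: (normal_ordered_slot_sum [::]).
  - exact: (normal_ordered_slot_sum [:: _]).
  - exact: (normal_ordered_slot_sum [:: _; _]).
have -> : X (CT mn z) = \sum_a \sum_b \sum_c k a b c *: X (M a b c).
  rewrite /cubic_term linear_sum; apply: eq_bigr => a _.
  rewrite linear_sum; apply: eq_bigr => b _.
  by rewrite linear_sum; apply: eq_bigr => c _; rewrite linearZ_LR.
under eq_bigr do under eq_bigr do under eq_bigr do rewrite XM scalerDr.
under eq_bigr do under eq_bigr do rewrite big_split.
under eq_bigr do rewrite big_split.
rewrite big_split -[RHS]addr0; congr (_ + _).
pose k1 a b c := \sum_e fC d a e * k e b c.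
pose k2 a b c := \sum_e fC d b e * k a e c.
pose k3 a b c := \sum_e fC d c e * k a b e.
transitivity (- \sum_a \sum_b \sum_c (k1 a b c + k2 a b c + k3 a b c) *: M a b c).
  under eq_bigr do under eq_bigr do under eq_bigr do rewrite !scalerDr.
  under eq_bigr do under eq_bigr do rewrite !big_split.
  under eq_bigr do rewrite !big_split.
  rewrite !big_split /=.
  under [in RHS]eq_bigr do under eq_bigr do under eq_bigr do rewrite !scalerDl.
  under [in RHS]eq_bigr do under eq_bigr do rewrite !big_split.
  under [in RHS]eq_bigr do rewrite !big_split.
  rewrite !big_split /= !opprD addrA; congr (_ + _ + _).
  - rewrite exchange_big [in RHS]exchange_big -sumrN; apply: eq_bigr => b _ /=.
    rewrite exchange_big [in RHS]exchange_big -sumrN; apply: eq_bigr => c _ /=.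
    exact: (sum_index_swap (fun a => k a b c) (fun e a => fC d e a) (fun a => M a b c)).
  - rewrite -sumrN; apply: eq_bigr => a _ /=.
    rewrite exchange_big [in RHS]exchange_big -sumrN; apply: eq_bigr => c _ /=.
    exact: (sum_index_swap (fun b => k a b c) (fun e b => fC d e b) (fun b => M a b c)).
  - rewrite -sumrN; apply: eq_bigr => a _ /=.
    rewrite -sumrN; apply: eq_bigr => b _ /=.
    exact: (sum_index_swap (fun c => k a b c) (fun e c => fC d e c) (fun c => M a b c)).
rewrite big1 ?oppr0 // => a _; rewrite big1 // => b _; rewrite big1 // => c _.
rewrite /k1 /k2 /k3 /k.
set q := 2 * _ * _.
have E (f : I -> C) (h : I -> C) : \sum_e f e * (h e / q) = (\sum_e f e * h e) / q.
  by rewrite mulr_suml; apply: eq_bigr => e _; rewrite mulrA.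
rewrite !E -!mulrDl flow_invariant mul0r scale0r //.
Qed.

(** Each summand of Q^- commutes with the adjoint action. This suffices for the
    infinite sums, which are finite or zero by convention. *)
Lemma invariants_Qplus z : Inv z -> Inv (Qplus lc rf Lam z).
Proof.
have sI : subspace Inv by exact: invariants_subspace.
have QI y : Inv y -> Inv (Qminus lc rf y).
  move=> /invariantsP Iy; rewrite QminusE; apply: (subspaceD sI).
    apply: (subspace_fsum sI) => n _; apply/invariantsP => a.
    by rewrite (adj_lin_term) Iy; have := lin_term_linear n (-1) 0 0;
      rewrite scaler0 addr0 scaleN1r addNr.
  apply: (subspace_fsum sI) => n _; apply/invariantsP => a.
  by rewrite adj_cubic_term Iy; have := cubic_term_linear n (-1) 0 0;
    rewrite scaler0 addr0 scaleN1r addNr.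
move=> Iz; apply: (subspaceB sI).
  by apply: (invariants_Lambda); exact: QI.
by apply: QI; apply: (invariants_Lambda).
Qed.

Lemma right_mode_piece b v i n h r d w : par b v -> sf_piece eta h r d w ->
  exists2 w', sf_piece eta (h - 2 * n) (r + sfchange n) (d + dsgn i.1) w' &
    mode (rf i) n (tens v w) = tens v w'.
Proof.
move=> vb wp; exists ((-1) ^+ (b && true) *: mode (eta i) n w).
  by apply: (subspaceZ _ (sf_piece_subspace _ _ _ _)); exact: sf_piece_mode.
by rewrite (tensor_mode_right hT n w vb (fermion_par hS i)) (tensorZr hTT).
Qed.

Lemma normal_ordered_piece b v (s : seq ((bool * I) * int)) h r d w :
  par b v -> sf_piece eta h r d w ->
  exists2 w', sf_piece eta (h - 2 * \sum_(q <- s) q.2)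
      (r + \sum_(q <- s) sfchange q.2) (d + \sum_(q <- s) dsgn q.1.1) w' &
    normal_ordered [seq (rf q.1, q.2) | q <- s] (tens v w) = tens v w'.
Proof.
move=> vb; elim: s h r d w => [|q s IH] h r d w wp.
  by exists w => //; rewrite !big_nil mulr0 subr0 !addr0.
rewrite !big_cons /=; move: IH.
move: (\sum_(j <- s) j.2) (\sum_(j <- s) sfchange j.2) (\sum_(j <- s) dsgn j.1.1).
move=> n1 n2 n3 IH; case: ifP => _.
  have [w1 p1 E1] := IH _ _ _ _ wp.
  have [w2 p2 E2] := right_mode_piece q.1 q.2 vb p1.
  exists w2; last by rewrite E1 E2.
  by move: p2; congr (sf_piece _ _ _ _ _); lia.
have [w1 p1 E1] := right_mode_piece q.1 q.2 vb wp.
have [w2 p2 E2] := IH _ _ _ _ p1.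
exists ((-1) ^+ size [seq (rf q.1, q.2) | q <- s] *: w2); last by rewrite E1 E2 (tensorZr hTT).
apply: (subspaceZ _ (sf_piece_subspace _ _ _ _)).
by move: p2; congr (sf_piece _ _ _ _ _); lia.
Qed.

(** In terms of this subspace, it can be said of infinite sums that all their
    terms are irrelevant for the leading charge. *)
Definition without_charge (p : int) : set T := [set y | component (tri_R tT) p y = 0].

Lemma without_charge_subspace p : subspace (without_charge p).
Proof.
split=> [|a x y Ex Ey]; first exact: component0.
by rewrite /without_charge /= (componentD dRT) (componentZ dRT) Ex Ey scaler0 addr0.
Qed.

Lemma sf_piece_rdeg h r d w : sf_piece eta h r d w -> sf_grading eta rdeg r w.
Proof. by apply: lspan_mono => y [s [-> _ E _]]; exists s; rewrite E. Qed.

Lemma without_charge_tens p l r v w : Rcharge U r v -> sf_grading eta rdeg l w ->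
  (p = r + l -> w = 0) -> without_charge p (tens v w).
Proof.
move=> vr wl w0; rewrite /without_charge /= (component_tens _ _ wl).
rewrite (component_homog dR _ vr); case: eqP => [E|_]; last by rewrite (tensor0l hTT).
by rewrite w0 ?(tensor0r hTT) // -E subrK.
Qed.

Lemma without_charge_tens_comp p l v w : component (Rcharge U) (p - l) v = 0 ->
  sf_grading eta rdeg l w -> without_charge p (tens v w).
Proof.
by move=> v0 wl; rewrite /without_charge /= (component_tens _ _ wl) v0 (tensor0l hTT).
Qed.

Lemma without_charge_Lambda p y : without_charge p y -> without_charge p (Lam y).
Proof.
move=> y0; rewrite /without_charge /= (component_commute dRT) ?y0 ?linear0 // => k x.
exact: (Lambda_grading_R hS hT hLam).
Qed.

Lemma Lambda_ext_mono (X : {set I}) :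
  exists2 w, sf_piece eta (2 * #|X|%:Z) #|X|%:Z (- #|X|%:Z + 2) w &
    forall v, Lam (tens v (ext_mono eta X)) = tens v w.
Proof.
have [c _ E] := ext_seqE hS X.
exists (c *: dmono eta (Lambda_gen eta) (ext_seq X)).
  apply: (subspaceZ _ (sf_piece_subspace _ _ _ _)).
  have := dmono_piece (fun i k h r d x => @Lambda_gen_piece _ _ _ eta i k h r d x) (ext_seq X).
  have m := ext_seq_minimal X.
  rewrite (hdeg_minimal m) (ddeg_minimal m) /rdeg size_ext_seq.
  exact.
move=> v; rewrite E !(tensorZr hTT) linearZ_LR /=.
by rewrite (derivation_mono hS hT (Lambda_derivation hLam) (Lambda_left hLam)
  (Lambda_genE hT hLam) (Lambda_gen_par hS)).
Qed.

(** Generators for the charge [p] part of the Hall-Littlewood vectors, on which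
    the terms of Q^+ can be followed. *)
Definition HL_charge (p : int) : set T := lspan [set z | exists r d v (X : {set I}),
  [/\ d <= 0, tri_piece t (r - d) r d v, r + #|X|%:Z = p & z = tens v (ext_mono eta X)]].

Lemma HL_component_charge p x : HL tT x -> HL_charge p (component (tri_R tT) p x).
Proof.
move=> /(HL_tensorP) [u uH ->].
have sB : subspace (HL_charge p) by exact: lspan_subspace.
rewrite (component_sum dRT); apply: (subspace_sum _ sB) => X _.
rewrite (componentZ dRT); apply: (subspaceZ _ sB).
have sP : subspace [set v : V | HL_charge p (component (tri_R tT) p (tens v (ext_mono eta X)))].
  split=> [|a v w /= Hv Hw].
    by rewrite /= (tensor0l hTT) (component0 dRT); exact: subspace0 sB.
  rewrite (tensorDl hTT) (tensorZl hTT) (componentD dRT) (componentZ dRT).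
  by have [_] := sB; apply.
apply: (HL_ind sP _ (uH X)) => r d v d0 pv /=.
have [[_ vR] _] := tensor_piece X pv.
rewrite (component_homog dRT _ vR); case: eqP => [->|_]; last exact: subspace0 sB.
by apply: lspan_gen; exists r, d, v, X.
Qed.

Let LTL n : {linear T -> T} := HB.pack (LT n)
  (GRing.isLinear.Build C T T *:%R (LT n) (lin_term_linear n)).
Let CTL mn : {linear T -> T} := HB.pack (CT mn)
  (GRing.isLinear.Build C T T *:%R (CT mn) (cubic_term_linear mn)).

Lemma piece_par r d v n a : tri_piece t (r - d) r d v -> par (oddz d) (mode (J a) n v).
Proof. by move=> [_ vd]; exact: (par_mode n (current_par H a) (intdeg_par vd)). Qed.

(** For n > 0 the fermionic factor gains the required charge, so the matter
    factor must keep its own, which the bound excludes. *)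
Lemma without_charge_lin_pos (n : int) r d v k h d' w : 0 < n -> tri_piece t (r - d) r d v ->
  sf_piece eta h k d' w -> without_charge (r + k + 1) (LT n (tens v w)).
Proof.
move=> n0 pv wp; apply: (subspace_sum _ (without_charge_subspace _)) => a _.
apply: (subspaceZ _ (without_charge_subspace _)); rewrite left_current_mode //.
have [w' wp' ->] := right_mode_piece (false, a) (- n) (piece_par n a pv) wp.
apply: without_charge_tens_comp (sf_piece_rdeg wp').
rewrite /sfchange ifT; last by lia.
have -> : r + k + 1 - (k + 1) = r by lia.
exact: (current_pos_component hCFT hBPS hH a n0 pv).
Qed.

(** For n < 0 it is the fermionic factor that lands in a degree without
    monomials, when the excess is as stated. *)
Lemma lin_neg_zero (n : int) r d v k h d' w : n < 0 -> tri_piece t (r - d) r d v ->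
  sf_piece eta h k d' w -> h + 2 * n - k + d' < 0 -> LT n (tens v w) = 0.
Proof.
move=> n0 pv wp hd; apply: big1 => a _; rewrite left_current_mode //.
have [w' wp' ->] := right_mode_piece (false, a) (- n) (piece_par n a pv) wp.
rewrite (sf_piece_empty _ _ wp') ?(tensor0r hTT) ?scaler0 //;
  rewrite /sfchange ifF /dsgn /=; by lia.
Qed.

(** The cubic terms do not touch the matter factor. In the leading charge they
    would add one to the number of fermions, keep their weight and lower d by one;
    there is no such monomial. The case e = 2 is that of a vector to which Lambda
    has been applied. *)
Lemma without_charge_cubic mn r d v k w e : tri_piece t (r - d) r d v -> e = 0 \/ e = 2 ->
  sf_piece eta (2 * k) k (- k + e) w -> without_charge (r + k + 1) (CT mn (tens v w)).
Proof.
move=> pv he wp.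
apply: (subspace_sum _ (without_charge_subspace _)) => a _.
apply: (subspace_sum _ (without_charge_subspace _)) => b _.
apply: (subspace_sum _ (without_charge_subspace _)) => c _.
apply: (subspaceZ _ (without_charge_subspace _)).
have [[_ vr] vd] := pv.
have [w' wp' E] := normal_ordered_piece [:: ((false, a), - mn.2); ((false, b), mn.1);
  ((true, c), mn.2 - mn.1)] (intdeg_par vd) wp.
rewrite [X in without_charge _ X]E; apply: (without_charge_tens vr (sf_piece_rdeg wp')) => Ek.
have {Ek} Ek : k + 1 = k + \sum_(q <- [:: ((false, a), - mn.2); ((false, b), mn.1);
  ((true, c), mn.2 - mn.1)]) sfchange q.2 by apply: (addrI r); rewrite addrA.
move: wp'; rewrite -Ek !big_cons !big_nil /dsgn /= => wp'.
by apply: (sf_piece_empty _ _ wp'); case: he => ->; lia.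
Qed.

Lemma without_charge_Qminus_HL_charge p z : HL_charge p z -> without_charge (p + 1) (Lam (Qminus lc rf z)).
Proof.
move=> bz; apply: without_charge_Lambda; have sL := without_charge_subspace (p + 1).
rewrite QminusE; apply: (subspaceD sL); apply: (subspace_fsum sL).
  move=> n /= n0.
  apply: (lspan_min (subspace_preim (LTL n) sL) _ bz).
  move=> _ [r [d [v [X [d0 pv <- ->]]]]] /=.
  have mp := ext_list_sf_piece eta (enum X); rewrite -cardE in mp.
  case: (ltP 0 n) => [npos|nneg]; first exact: (without_charge_lin_pos npos pv mp).
  have nlt : n < 0 by rewrite lt_neqAle n0.
  rewrite /LTL /= (lin_neg_zero nlt pv mp); last by lia.
  exact: subspace0 (without_charge_subspace _).
move=> mn _; apply: (lspan_min (subspace_preim (CTL mn) sL) _ bz).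
move=> _ [r [d [v [X [d0 pv <- ->]]]]] /=.
have mp := ext_list_sf_piece eta (enum X); rewrite -cardE -[- _]addr0 in mp.
by apply: (without_charge_cubic mn pv _ mp); left.
Qed.

(** Unlike a vanishing sum, the surviving part of Q^- has to be an honest finite
    sum. *)
Lemma lin_finite_support p z : HL_charge p z ->
  exists N : nat, forall n : int, n < -1 \/ N%:Z < n -> LT n (Lam z) = 0.
Proof.
move=> bz.
pose P := [set z | exists N : nat, forall n : int, n < -1 \/ N%:Z < n -> LT n (Lam z) = 0].
have sP : subspace P.
  split; first by exists 0%N => n _; rewrite linear0; exact: (linear0 (LTL n)).
  move=> a x y [N HN] [M HM]; exists (maxn N M) => n Hn.
  have -> : Lam (a *: x + y) = a *: Lam x + Lam y by rewrite linearP.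
  rewrite lin_term_linear HN ?HM ?scaler0 ?addr0 //.
    by case: Hn => ?; [left|right; lia].
  by case: Hn => ?; [left|right; lia].
apply: (lspan_min sP _ bz) => _ [r [d [v [X [d0 pv _ ->]]]]].
have [w wp Ew] := Lambda_ext_mono X.
have [N NP] := choice (fun a => mode_trunc (J a) v).
exists (\sum_a `|N a|)%N => n Hn; rewrite Ew.
case: Hn => Hn; first by apply: (lin_neg_zero _ pv wp); lia.
apply: big1 => a _; rewrite left_current_mode // NP.
  by rewrite (tensor0l hTT) mode0r scaler0.
have : (`|N a| <= \sum_a `|N a|)%N by rewrite (bigD1 a) //= leq_addr.
by lia.
Qed.

(** Lambda Q^- does not reach the leading charge at all, and in Q^- Lambda the
    excess of the fermionic factor is zero only at n = -1. *)
Lemma Qplus_leading p z : HL_charge p z ->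
  component (tri_R tT) (p + 1) (Qplus lc rf Lam z) =
  component (tri_R tT) (p + 1) (- LT (-1) (Lam z)).
Proof.
move=> bz; have sL := without_charge_subspace (p + 1).
rewrite /Qplus (componentB dRT) [X in X - _ = _](without_charge_Qminus_HL_charge bz) sub0r.
have cN x : component (tri_R tT) (p + 1) (- x) = - component (tri_R tT) (p + 1) x.
  by rewrite -scaleN1r (componentZ dRT) scaleN1r.
rewrite cN; congr (- _).
rewrite QminusE (componentD dRT) [X in _ + X = _](_ : _ = 0) ?addr0; last first.
  apply: (subspace_fsum sL) => mn _.
  apply: (lspan_min (subspace_preim (CTL mn \o Lam) sL) _ bz).
  move=> _ [r [d [v [X [d0 pv <- ->]]]]] /=.
  have [w wp ->] := Lambda_ext_mono X.
  by apply: (without_charge_cubic mn pv _ wp); right.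
have [N HN] := lin_finite_support bz.
pose s := (-1 : int) :: [seq i.+1%:Z | i <- iota 0 N].
rewrite (@fsum_seq _ _ _ s).
- rewrite /s big_cons (componentD dRT) -[RHS]addr0; congr (_ + _).
  rewrite big_map (component_sum dRT) big1 // => i _.
  apply: (lspan_min (subspace_preim (LTL i.+1%:Z \o Lam) sL) _ bz).
  move=> _ [r [d [v [X [d0 pv <- ->]]]]] /=.
  have [w wp ->] := Lambda_ext_mono X.
  exact: (without_charge_lin_pos _ pv wp).
- rewrite /s /= map_inj_uniq ?iota_uniq ?andbT; last by move=> i j [].
  by apply/mapP => -[].
- by move=> n; rewrite inE => /orP[/eqP -> //|/mapP[i _ ->]].
move=> n /= n0 ns; apply: HN.
case: (ltP n (-1)) => [|le]; [by left|right; rewrite ltNge; apply: contra ns => nN].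
rewrite inE; case: eqP => //= n1; apply/mapP; exists `|n - 1|%N; rewrite ?mem_iota; lia.
Qed.

Let lead_fun (z : T) : T := - LT (-1) (Lam z).

Let lead_linear : linear lead_fun.
Proof.
move=> a x y; rewrite /lead_fun.
have -> : Lam (a *: x + y) = a *: Lam x + Lam y by rewrite linearP.
by rewrite lin_term_linear opprD scalerN.
Qed.

(** The convention on infinite sums leaves open whether Q^+ is linear on the whole
    tensor product; its leading part on Hall-Littlewood vectors is replaced by this linear
    operator. *)
Let lead : {linear T -> T} := HB.pack lead_fun
  (GRing.isLinear.Build C T T *:%R lead_fun lead_linear).

Let gr_Qplus x : HL tV x ->
  gr_operator tV 1 (Qplus lc rf Lam) x = gr_operator tT 1 lead x.
Proof.
move=> /(HL_invariantsP)[xH xI].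
rewrite (inv_gr_operator _ _ xI); last first.
  exact: (invariants_Qplus).
apply: fsum_ext => p _.
exact: (Qplus_leading (HL_component_charge _ xH)).
Qed.

(** As eta^-_1 kills the exterior algebra, eta^-_1 Lambda is minus the
    contraction [Lambda, eta^-_1] = eta^+_1. *)
Let lead_tens r d v (X : {set I}) : tri_piece t (r - d) r d v ->
  lead (tens v (ext_mono eta X)) = - \sum_a (-1) ^+ oddz d *:
    tens (mode (J a) (-1) v) (mode (eta (true, a)) 1 (ext_mono eta X)).
Proof.
move=> pv; have [[_ vr] vd] := pv.
rewrite /= /lead_fun /lin_term -sumrN -[RHS]sumrN; apply: eq_bigr => a _.
rewrite mulrN1z invrN1 scaleN1r opprK opprK.
rewrite -(Lambda_left_current) left_current_mode //.
set y := mode (J a) (-1) v.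
have yp : par (oddz d) y := piece_par (-1) a pv.
have [Lp Lm] := Lambda_derivation hLam.
have mp := ext_list_sf_piece eta (enum X); rewrite -cardE in mp.
have z0 : mode (rf (false, a)) 1 (tens y (ext_mono eta X)) = 0.
  have [w wp ->] := right_mode_piece (false, a) 1 yp mp.
  by rewrite (sf_piece_empty _ _ wp) ?(tensor0r hTT) // /sfchange /dsgn /=; lia.
have := Lm (rf (false, a)) 1 (tens y (ext_mono eta X)).
rewrite z0 linear0 => /esym/eqP; rewrite addrC addr_eq0 => /eqP ->.
have [_ _ /(_ a)[-> _]] := hLam.
by rewrite (tensor_mode_right hT 1 _ yp (fermion_par hS (true, a))) andbT.
Qed.

Let gr_lead_tens v (X : {set I}) : HL t v ->
  gr_operator tT 1 lead (tens v (ext_mono eta X)) =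
  - \sum_a tens (gr_mode t (-1) 0 (parity_sign v) (J a))
      (mode (eta (true, a)) 1 (ext_mono eta X)).
Proof.
have lin0 (W W' : lmodType C) (f : W -> W') : linear f -> f 0 = 0.
  by move=> fl; have := fl (-1) 0 0; rewrite scaler0 addr0 scaleN1r addNr.
have sP : subspace [set v : V | gr_operator tT 1 lead (tens v (ext_mono eta X)) =
  - \sum_a tens (gr_mode t (-1) 0 (parity_sign v) (J a))
      (mode (eta (true, a)) 1 (ext_mono eta X))].
  split=> [|k x y /= Ex Ey].
    rewrite /= (tensor0l hTT) (lin0 _ _ _ (gr_operator_linear dRT 1 lead)).
    rewrite (lin0 _ _ _ (@parity_sign_linear R V)) big1 ?oppr0 // => a _.
    by rewrite (lin0 _ _ _ (gr_mode_linearl dR _ _ _)) (tensor0l hTT).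
  rewrite (tensorDl hTT) (tensorZl hTT) (gr_operator_linear dRT 1 lead) Ex Ey.
  rewrite scalerN -opprD scaler_sumr -big_split; congr (- _); apply: eq_bigr => a _ /=.
  by rewrite parity_sign_linear (gr_mode_linearl dR) (tensorDl hTT) (tensorZl hTT).
apply: (HL_ind sP) => r d {}v d0 pv /=; have [[_ vr] vd] := pv.
have [[_ vX] _] := tensor_piece X pv.
rewrite (gr_operator_homog dRT _ (linear0 lead) vX) (lead_tens X pv).
have cN x : component (tri_R tT) (r + #|X|%:Z + 1) (- x) = - component (tri_R tT) (r + #|X|%:Z + 1) x.
  by rewrite -scaleN1r (componentZ dRT) scaleN1r.
rewrite cN (component_sum dRT); congr (- _); apply: eq_bigr => a _.
have mp := ext_list_sf_piece eta (enum X); rewrite -cardE in mp.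
have := sf_piece_annihilate hS (true, a) 1 mp; move/sf_piece_rdeg => ip.
rewrite (componentZ dRT) (component_tens _ _ ip) -(tensorZl hTT).
have Ei : r + #|X|%:Z + 1 - (#|X|%:Z - 1) = r + 2 by lia.
rewrite (parity_sign_homog (intdeg_par vd)) Ei.
have vr' : tri_R t r ((-1) ^+ oddz d *: v).
  by apply: subspaceZ => //; exact: Rcharge_subspace.
rewrite (gr_mode_homog dR _ _ vr' (current_charge hCFT hH a)) addr0.
by rewrite modeZl (componentZ dR) (current_product_sym hH a vr vd).
Qed.

Let gr_lead_Psi (u : ext) : HL_valued u ->
  gr_operator tT 1 lead (Ps idfun u) = Ps idfun (@koszul R g A J u).
Proof.
move=> uH.
pose w a : ext := [ffun X : {set I} => gr_mode t (-1) 0 (parity_sign (u X : V)) (J a)].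
have lin0 (W W' : lmodType C) (f : W -> W') : linear f -> f 0 = 0.
  by move=> fl; have := fl (-1) 0 0; rewrite scaler0 addr0 scaleN1r addNr.
have -> : @koszul R g A J u = \sum_a contract a (w a).
  apply/ffunP => X; rewrite sum_ffunE ffunE; apply: eq_bigr => a _.
  rewrite !contractE /pois_mul /pois_sgn /=; case: ifP => _.
    by rewrite (lin0 _ _ _ (@parity_sign_linear R V)) (lin0 _ _ _ (gr_mode_linearl dR _ _ _)).
  rewrite ffunE; set s := (-1) ^+ _; set x := u _.
  have := parity_sign_linear s x 0; rewrite addr0 (lin0 _ _ _ (@parity_sign_linear R V)) addr0 => ->.
  have := gr_mode_linearl dR (-1) 0 (J a) s (parity_sign (x : V)) 0.
  by rewrite addr0 (lin0 _ _ _ (gr_mode_linearl dR _ _ _)) addr0.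
have PsS (f : I -> ext) : Ps idfun (\sum_a f a) = \sum_a Ps idfun (f a).
  elim/big_rec2: _ => [|a y x _ <-]; first exact: lin0 PsL.
  by have := PsL 1 (f a) x; rewrite !scale1r.
rewrite PsS; under [RHS]eq_bigr do rewrite (@Psi_contract R g A S T tens eta hS hTA idfun).
rewrite /Psi sumrN exchange_big -sumrN.
have grS (F : {set I} -> T) (k : {set I} -> C) : gr_operator tT 1 lead (\sum_X k X *: F X) =
    \sum_X k X *: gr_operator tT 1 lead (F X).
  elim/big_rec2: _ => [|X y x _ <-]; first exact: lin0 (gr_operator_linear dRT 1 lead).
  exact: (gr_operator_linear dRT 1 lead).
rewrite grS; apply: eq_bigr => X _ /=.
rewrite gr_lead_tens // scalerN scaler_sumr; congr (- _); apply: eq_bigr => a _.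
by rewrite ffunE.
Qed.

Lemma HL_complex_differential (u : ext) : ext_carrier u ->
  gr_operator tV 1 (Qplus lc rf Lam) (Ps idfun u) = Ps idfun (@koszul R g A J u).
Proof.
move=> uc; rewrite gr_Qplus ?gr_lead_Psi //; first by case: uc.
by apply/(HL_PsiP); exists u.
Qed.

(** * The isomorphism *)

Lemma Psi_parity (u : ext) : parity_sign (Ps idfun u) =
  Ps idfun [ffun X : {set I} => (-1) ^+ #|X| *: @pois_sgn R A (u X)].
Proof.
have lin0 (W W' : lmodType C) (f : W -> W') : linear f -> f 0 = 0.
  by move=> fl; have := fl (-1) 0 0; rewrite scaler0 addr0 scaleN1r addNr.
have psS (F : {set I} -> T) (k : {set I} -> C) : parity_sign (\sum_X k X *: F X) =
    \sum_X k X *: parity_sign (F X).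
  elim/big_rec2: _ => [|X y x _ <-]; first exact: lin0 (@parity_sign_linear R T).
  exact: parity_sign_linear.
rewrite /Psi psS; apply: eq_bigr => X _; congr (_ *: _); rewrite ffunE /=.
set m := ext_mono eta X.
have mp : par (odd #|X|) m by rewrite cardE; exact: (ext_list_par hS).
apply: (@par_ind _ _ [set x : V | parity_sign (tens x m) = tens ((-1) ^+ #|X| *: parity_sign x) m]).
  split=> [|k x y /= Ex Ey].
    by rewrite /= (tensor0l hTT) !(lin0 _ _ _ (@parity_sign_linear R _)) scaler0 (tensor0l hTT).
  rewrite (tensorDl hTT) (tensorZl hTT) parity_sign_linear Ex Ey parity_sign_linear.
  by rewrite (scalerDr _ (k *: _)) scalerA mulrC -scalerA (tensorDl hTT) (tensorZl hTT k).
move=> b x xb /=; rewrite (parity_sign_homog (tensor_par hT xb mp)) (parity_sign_homog xb).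
rewrite scalerA (tensorZl hTT); congr (_ *: _).
by rewrite signr_addb mulrC signr_odd.
Qed.

Lemma Psi_one : Ps idfun [ffun X : {set I} => if X == finset.set0 then vac V else 0] = vac T.
Proof.
rewrite /Psi (bigD1 finset.set0) //= big1 ?addr0.
  rewrite ffunE eqxx cards0 expr0 scale1r /ext_mono enum_set0 /=.
  by have [_ -> _ _] := hT.
by move=> X /negbTE X0; rewrite ffunE X0 (tensor0l hTA) scaler0.
Qed.

Lemma Psi_degree (u : ext) k : HL_valued u ->
  tri_d tT k (Ps idfun u) <-> forall X : {set I}, intdeg D (k + #|X|%:Z) (u X).
Proof.
move=> uH; split=> [ud X|ud].
  have := proj1 (tensor_gradingP hS hT (intdeg_direct D) (@ddeg_perm R g) _ _) ud (ext_seq X).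
  have [c c0 ->] := Psi_tcoef X => uX.
  rewrite (ddeg_minimal (ext_seq_minimal X)) /rdeg size_ext_seq opprK in uX.
  have := subspaceZ c^-1 (intdeg_subspace D _) uX.
  by rewrite scalerA mulVf // scale1r.
have sT : subspace (tri_d tT k) by exact: lspan_subspace.
apply: (subspace_sum _ sT) => X _; apply: (subspaceZ _ sT).
have [_ _ md] := ext_mono_sf_grading X.
by apply: lspan_gen; exists (k + #|X|%:Z), (- #|X|%:Z), (u X), (ext_mono eta X);
  split; [exact: ud|exact: md|exact: addrK|].
Qed.

End Comparison.

Theorem proposition5p14 (R : realType) (g : reductiveLie R)
  (Vmatter : vertexAlgebra R) (U : gradedUnitary Vmatter)
  (hCFT : CFT_type U)
  (D : internalGrading U) (hBPS : BPS_bound (trigrading_of D))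
  (H : hamiltonianAction g Vmatter) (hH : good_action U H)
  (S : vertexAlgebra R) (eta : bool * 'I_(dimg g) -> S)
  (hS : is_symplectic_fermions eta)
  (T : vertexAlgebra R) (tens : Vmatter -> S -> T) (hT : is_tensor_va tens)
  (theta : 'I_(dimg g) -> {linear T -> T})
  (htheta : is_theta tens eta theta)
  (Lam : {linear T -> T}) (hLam : is_Lambda tens eta Lam) :
  dg_poisson_iso
    (HL_complex tens (current H) eta theta Lam (trigrading_of D))
    (@derived_reduction R g (HL_poisson (trigrading_of D)) (current H)).
Proof.
pose A := HL_poisson (trigrading_of D).
pose ext := {ffun {set 'I_(dimg g)} -> A}.
pose P : ext -> T := @Psi R g A S T tens eta idfun.
have hTA : @is_tensor_product _ A S T tens := va_tensor hT.
have PL : linear P := @Psi_linear R g A S T tens eta hTA idfun.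
have Pinj u v : P u = P v -> u = v by exact: (Psi_inj hS hT).
(* As Psi is injective, its inverse on the image can be chosen on all of T. *)
pose phi (x : T) : ext := xget 0 [set u | P u = x].
have phiK u : phi (P u) = u.
  by rewrite /phi; case: xgetP => [v _ /Pinj -> //|/(_ u) []].
have carP x : HL (inv_tri D H tens eta theta) x <->
    exists2 u : ext, ext_carrier H u & x = P u.
  exact: (HL_PsiP hCFT hBPS hH hS hT htheta x).
have inI x : HL (inv_tri D H tens eta theta) x -> invariants tens (current H) theta x.
  by move=> /(HL_invariantsP hCFT hBPS hH hS hT htheta)[].
exists phi; split.
- split.
  + by move=> _ /carP [u uc ->]; rewrite /= phiK.
  + by move=> x y /set_mem /carP [u _ ->] /set_mem /carP [v _ ->]; rewrite !phiK => ->.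
  + by move=> u uc; exists (P u); [apply/carP; exists u|rewrite phiK].
- by move=> a _ _ /carP [u _ ->] /carP [v _ ->]; rewrite !phiK -PL phiK.
- move=> x xc; have /carP [u uc Ex] := xc; have [uH ua] := uc.
  split; last first.
    transitivity (phi (P [ffun X : {set 'I_(dimg g)} => (-1) ^+ #|X| *: @pois_sgn R A (u X)])).
      by congr phi; rewrite Ex; exact: (Psi_parity hS hT u).
    by rewrite Ex !phiK.
  move=> k; rewrite /= Ex phiK; split.
    move=> [_ [ud _]] X; split; first exact: uH.
    by have := proj1 (Psi_degree hS hT k uH) ud; apply.
  move=> ud; split; first by rewrite -Ex.
  split; last by apply: inI; rewrite -Ex.
  by apply/(Psi_degree hS hT k uH) => X; have [] := ud X.
- split; first by rewrite /= -(Psi_one D eta hT) phiK.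
  move=> x y xc yc.
  have [/carP [u [uH _] Ex] /carP [v [vH _] Ey]] := (xc, yc).
  split; rewrite /= (inv_gr_mode D hCFT hH hS hT htheta); try exact: inI.
    by rewrite Ex Ey (Psi_gr_product hS hT uH vH) !phiK.
  by rewrite Ex Ey (Psi_gr_bracket hBPS hS hT uH vH) !phiK.
- move=> _ /carP [u uc ->]; rewrite /= (HL_complex_differential hCFT hBPS hH hS hT htheta hLam uc).
  by rewrite !phiK.
Qed.
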